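(* Let $k$ be a perfect field of characteristic $p>0$, let $R$ be a Noetherian standard graded ring over $k$ of dimension $d\geq 2$, let $I\subset R$ be a homogeneous ideal with $\ell(R/I)<\infty$, and let $M$ be a finitely generated non-negatively graded $R$-module. Let $g_n:\mathbb{R}\to\mathbb{R}$ ($n\in\mathbb{N}$) be the functions attached to $(M,I)$ defined in the context. Then each $g_n$ is a compactly supported, piecewise linear continuous function, and $\{g_n\}_{n\in\mathbb{N}}$ is a uniformly convergent sequence. If $f(x)=\lim_{n\to\infty}g_n(x)$, then $f$ is a compactly supported continuous function, and $$e_{HK}(M,I)=\int_{\mathbb{R}}f(x)\,dx.$$
   Context: Standard graded means $R=\bigoplus_{m\ge 0}R_m$ with $R_0=k$ and $R$ generated over $k$ by $R_1$. $\ell(-)$ denotes length, and for a graded module $N$, $N_m$ denotes its degree $m$ component (so $N_m=0$ for $m<0$ when $N$ is non-negatively graded). For $n\in\mathbb{N}$ write $q=p^n$; $I^{[q]}$ is the ideal generated by the $q$-th powers of elements of $I$. Definition of $g_n$: for $x=m/q$ with $m\in\mathbb{Z}$, put $g_n(m/q)=\frac{1}{q^{d-1}}\ell(M/I^{[q]}M)_m$. Otherwise $x\in[m/q,(m+1)/q)$ for a unique integer $m$, and writing $x=(1-t)\frac{m}{q}+t\frac{m+1}{q}$ with $t\in[0,1)$, put $g_n(x)=(1-t)g_n(m/q)+t\,g_n((m+1)/q)$. The Hilbert-Kunz multiplicity is $e_{HK}(M,I)=\lim_{n\to\infty}\ell(M/I^{[p^n]}M)/p^{nd}$. *)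

(* Defs.v *)
From HB Require Import structures.
From mathcomp Require Import all_boot all_order all_algebra.
From mathcomp Require Import all_classical all_reals all_analysis.

Set Implicit Arguments.
Unset Strict Implicit.
Unset Printing Implicit Defensive.

Import Order.TTheory GRing.Theory Num.Theory.
Import numFieldNormedType.Exports.

Local Open Scope classical_set_scope.
Local Open Scope ring_scope.

Definition perfect_field (k : fieldType) : Prop :=
  forall p, p \in [pchar k] -> forall a : k, exists b : k, b ^+ p = a.

Section Submodules.
Context {A : nzRingType} {V : lmodType A}.

Definition submodule (N : set V) : Prop := submod_closed [in N].

Definition submod_gen (S : set V) : set V := smallest submodule S.

Definition fin_gen (N : set V) : Prop :=
  exists s : seq V, N = submod_gen [set` s].

(* For submodules N' `<=` N, the length of N / N': submodules of N / N' are
   identified with the submodules of V lying between N' and N. *)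
Definition quot_length (R : realType) (N N' : set V) : \bar R :=
  ereal_sup [set n%:R%:E | n in [set n : nat | exists C : nat -> set V,
    (forall i, (i <= n)%N -> submodule (C i) /\ N' `<=` C i /\ C i `<=` N) /\
    (forall i, (i < n)%N -> C i `<` C i.+1)]].

End Submodules.

Section RestrictionOfScalars.
Context (k : fieldType) (A : comAlgType k) (M : lmodType A).

(* The k-vector space underlying an A-module. *)
Definition restr_scalars : Type := M.

HB.instance Definition _ := GRing.Zmodule.on restr_scalars.

Definition restr_scale (a : k) (v : restr_scalars) : restr_scalars :=
  (a%:A : A) *: (v : M).

Fact restr_scaleA a b v :
  restr_scale a (restr_scale b v) = restr_scale (a * b) v.
Proof. by rewrite /restr_scale scalerA -scalerAl mul1r scalerA. Qed.

Fact restr_scale1 : left_id 1 restr_scale.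
Proof. by move=> v; rewrite /restr_scale scale1r scale1r. Qed.

Fact restr_scaleDr : right_distributive restr_scale +%R.
Proof. by move=> a u v; rewrite /restr_scale scalerDr. Qed.

Fact restr_scaleDl v : {morph restr_scale^~ v : a b / a + b}.
Proof. by move=> a b; rewrite /restr_scale scalerDl scalerDl. Qed.

HB.instance Definition _ := GRing.Zmodule_isLmodule.Build k restr_scalars
  restr_scaleA restr_scale1 restr_scaleDr restr_scaleDl.

End RestrictionOfScalars.

Section Ideals.
Context {A : comNzRingType}.

(* Unlike [idealr_closed], the unit ideal is allowed. *)
Definition ideal (I : set A) : Prop := submodule (I : set A^o).

Definition ideal_gen (S : set A) : set A := submod_gen (S : set A^o).

Definition noetherian : Prop :=
  forall I : set A, ideal I -> fin_gen (I : set A^o).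

Definition prime_ideal (P : set A) : Prop :=
  idealr_closed [in P] /\ prime_idealr_closed [in P].

Definition krull_dim (R : realType) : \bar R :=
  ereal_sup [set n%:R%:E | n in [set n : nat | exists P : nat -> set A,
    (forall i, (i <= n)%N -> prime_ideal (P i)) /\
    (forall i, (i < n)%N -> P i `<` P i.+1)]].

Definition frob_power (I : set A) (q : nat) : set A :=
  ideal_gen [set x ^+ q | x in I].

Definition ideal_smul (I : set A) (M : lmodType A) : set M :=
  submod_gen [set a *: v | a in I & v in [set: M]].

End Ideals.

Arguments noetherian : clear implicits.
Arguments krull_dim : clear implicits.
Arguments ideal_smul {A} I M.

(* V is the internal direct sum of the additive subgroups G i. *)
Definition direct_sum (V : zmodType) (G : nat -> set V) : Prop :=
  (forall i, zmod_closed [in G i]) /\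
  (forall x : V, exists! c : nat -> V, (forall i, G i (c i)) /\
     exists n, (forall i, (n <= i)%N -> c i = 0) /\ x = \sum_(i < n) c i).

(* The grading is indexed by nat, so the module is non-negatively graded. *)
Definition graded_module (A : nzRingType) (GA : nat -> set A)
    (M : lmodType A) (GM : nat -> set M) : Prop :=
  direct_sum GM /\
  (forall i j a v, GA i a -> GM j v -> GM (i + j)%N (a *: v)).

Definition standard_graded (k : fieldType) (A : comAlgType k)
    (GA : nat -> set A) : Prop :=
  [/\ graded_module GA (GA : nat -> set A^o),
      GA 0%N = [set a%:A | a in [set: k]] &
      forall S : set A, subalg_closed [in S] -> GA 1%N `<=` S -> S = setT].

Definition homogeneous_ideal (A : comNzRingType) (GA : nat -> set A)
    (I : set A) : Prop :=
  exists S : set A, S `<=` \bigcup_i GA i /\ I = ideal_gen S.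

Section HilbertKunz.
Context (R : realType) (k : fieldType) (p : nat) (A : comAlgType k)
  (d : nat) (I : set A) (M : lmodType A) (GM : nat -> set M).

(* l(M / I^[q] M)_m with q = p ^ n: as I^[q] M is homogeneous, the degree m
   component of the quotient is M_m / (M_m `&` I^[q] M), a module over
   R_0 = k. *)
Definition hk_component_length (n : nat) (m : int) : \bar R :=
  match m with
  | Posz j => quot_length (V := restr_scalars M) R
                (GM j) (GM j `&` ideal_smul (frob_power I (p ^ n)) M)
  | Negz _ => 0%E
  end.

(* g_n (m / q) *)
Definition hk_node (n : nat) (m : int) : R :=
  fine (hk_component_length n m) / ((p ^ n)%:R ^+ d.-1).

Definition hk_g (n : nat) (x : R) : R :=
  let m := Num.floor (x * (p ^ n)%:R) in
  let t := x * (p ^ n)%:R - m%:~R in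
  (1 - t) * hk_node n m + t * hk_node n (m + 1).

Definition hk_seq (n : nat) : R :=
  fine (quot_length R [set: M] (ideal_smul (frob_power I (p ^ n)) M))
    / (p ^ (n * d))%:R.

Definition e_HK : R := limn hk_seq.

End HilbertKunz.

Definition compactly_supported (R : realType) (f : R -> R) : Prop :=
  compact (closure [set x | f x != 0]).

(* Affine on every interval that avoids a finite set of break points. *)
Definition piecewise_linear (R : realType) (f : R -> R) : Prop :=
  exists s : seq R, forall J : interval R, {in s, forall c, c \notin J} ->
    exists a b : R, {in J, forall x, f x = a * x + b}.

(* Main.v *)
(* Let h_n(m) be the length of the degree m part of M/I^[q]M, where q = p^n.  Let R
   act on M through the e-th iterate of Frobenius, which is a finite action because
   k is perfect.  For e large, and up to a module whose Hilbert function is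
   O(m^(d-2)), M is then filtered by finitely many "blocks" made of shifted copies of
   R/P, with P homogeneous primes of dimension d.  A homogeneous y of degree 1 modulo
   p^e which avoids all these primes spreads each copy over all residues of degrees,
   so that the degree m part of a block is the degree m/p^e + O(1) part of R/P.
   Passing to the quotient by I^[q] keeps the error O(m^(d-2)), uniformly in n, and
   shifting degrees costs as much, since multiplication by a linear form x not in P
   has a cokernel R/(P + xR) of smaller dimension.  Hence
   h_n(m + 1) = h_n(m) + O(m^(d-2)).  The same decomposition for R/P and e = 1
   consists of p^(d-1) blocks R/P, by comparing Hilbert polynomials, and therefore
   h_{n+1}(m) = p^(d-1) h_n(floor(m/p)) + O(m^(d-2)) for n large.  As h_n(m) vanishes
   for m >= B q, it follows that g_{n+1} - g_n is O(p^-n) uniformly, and the total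
   lengths divided by q^d are Riemann sums of the limit up to O(p^-n). *)

Require Import Defs.
From mathcomp Require Import all_boot all_order all_algebra.
From mathcomp Require Import all_classical all_reals all_analysis.
From mathcomp Require Import measurable_realfun ring lra zify.

Set Implicit Arguments.
Unset Strict Implicit.
Unset Printing Implicit Defensive.

Import Order.TTheory GRing.Theory Num.Theory.
Import numFieldNormedType.Exports.

Local Open Scope classical_set_scope.
Local Open Scope ring_scope.

(** * Dimension of quotients of vector spaces *)

Section RelativeDimension.
Context {k : fieldType} {V : lmodType k}.
Implicit Types U W X : set V.

(** The obstacle is uniformity in n. Filtrations by shifted copies of R/P are standard, but
    tensoring them with R/I^[q] destroys exactness, and the correcting Tor terms would have to be
    bounded for all q at once. Here nothing is tensored. Lengths are compared inside M by
    [hdim_compare], whose error is a fixed multiple of the dimension of what is discarded, and a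
    block meets the rest of the filtration in relations only ([hdim_add_block]), so that its length
    is added exactly. Exponents n q occur because f^(n q) = (f^n)^q acts on a Frobenius-twisted copy
    of R/P as f^n acts on R/P. The iteration of Frobenius has another purpose: localized at a prime
    P of dimension d, M is killed only by a power of P, and p^e-th powers of elements of P kill it
    once p^e is large. Finally, a twisted copy of R/P lives in one residue class of degrees modulo
    q; the powers y^i with i < q, whose degrees are i modulo q, spread it over all classes, and this
    is why the floor of m/q appears. *)

Definition subsp U := U 0 /\ forall c u v, U u -> U v -> U (c *: u + v).

Definition addS U W : set V := [set x | exists u w, [/\ U u, W w & x = u + w]].

Definition lcomb n (c : 'I_n -> k) (s : 'I_n -> V) := \sum_i c i *: s i.

Definition relbasis U W n (s : 'I_n -> V) :=
  [/\ forall i, U (s i), forall c, W (lcomb c s) -> forall i, c i = 0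
    & forall u, U u -> exists c, W (u - lcomb c s)].

(** The spanning family is required neither to be free nor to lie in [U], so the property passes to
    subsets at once. *)
Definition fdim U :=
  exists n (s : 'I_n -> V), forall u, U u -> exists c, u = lcomb c s.

(* The dimension of [U / (U `&` W)]: [W] need not lie in [U]. *)
Definition rdim U W : nat :=
  xget 0%N [set n | exists s : 'I_n -> V, relbasis U W s].

Lemma subsp0 U : subsp U -> U 0. Proof. by case. Qed.

Lemma subspZD U c u v : subsp U -> U u -> U v -> U (c *: u + v).
Proof. by move=> [_ h]; apply: h. Qed.

Lemma subspD U u v : subsp U -> U u -> U v -> U (u + v).
Proof. by move=> [_ h] Uu Uv; rewrite -[u]scale1r; apply: h. Qed.

Lemma subspZ U c u : subsp U -> U u -> U (c *: u).
Proof. by move=> [U0 h] Uu; rewrite -[_ *: u]addr0; apply: h. Qed.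

Lemma subspN U u : subsp U -> U u -> U (- u).
Proof. by move=> sU Uu; rewrite -scaleN1r; apply: subspZ. Qed.

Lemma subspB U u v : subsp U -> U u -> U v -> U (u - v).
Proof. by move=> sU Uu Uv; apply: subspD => //; apply: subspN. Qed.

Lemma subsp_sum U (I : Type) (r : seq I) (P : pred I) (F : I -> V) :
  subsp U -> (forall i, P i -> U (F i)) -> U (\sum_(i <- r | P i) F i).
Proof.
by move=> sU UF; elim/big_rec: _ => [|i x Pi Ux]; [apply: subsp0|apply: subspD=> //; apply: UF].
Qed.

Lemma subsp_lcomb U n (c : 'I_n -> k) s :
  subsp U -> (forall i, U (s i)) -> U (lcomb c s).
Proof. by move=> sU Us; apply: subsp_sum => // i _; apply: subspZ. Qed.

Lemma subsp_set0 : subsp [set 0].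
Proof. by split=> // c u v -> ->; rewrite scaler0 addr0. Qed.

Lemma subspI U W : subsp U -> subsp W -> subsp (U `&` W).
Proof.
move=> sU sW; split; first by split; apply: subsp0.
by move=> c u v [? ?] [? ?]; split; apply: subspZD.
Qed.

Lemma subsp_addS U W : subsp U -> subsp W -> subsp (addS U W).
Proof.
move=> sU sW; split; first by exists 0, 0; split; rewrite ?addr0//; apply: subsp0.
move=> c _ _ [u [w [Uu Ww ->]]] [u' [w' [Uu' Ww' ->]]].
exists (c *: u + u'), (c *: w + w'); split; try exact: subspZD.
by rewrite scalerDr addrACA.
Qed.

Lemma addSl U W : subsp W -> U `<=` addS U W.
Proof. by move=> sW u Uu; exists u, 0; split; rewrite ?addr0//; apply: subsp0. Qed.

Lemma addSr U W : subsp U -> W `<=` addS U W.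
Proof. by move=> sU u Uu; exists 0, u; split; rewrite ?add0r//; apply: subsp0. Qed.

Lemma addS_sub U W X : subsp X -> U `<=` X -> W `<=` X -> addS U W `<=` X.
Proof. by move=> sX UX WX _ [u [w [/UX ? /WX ? ->]]]; apply: subspD. Qed.

Lemma addS_mono U U' W W' : U `<=` U' -> W `<=` W' -> addS U W `<=` addS U' W'.
Proof. by move=> h h' _ [u [w [/h ? /h' ? ->]]]; exists u, w. Qed.

Lemma addSC U W : addS U W = addS W U.
Proof.
by apply/seteqP; split=> _ [u [w [? ? ->]]]; exists w, u; split=> //; rewrite addrC.
Qed.

Lemma addSA U W X : addS U (addS W X) = addS (addS U W) X.
Proof.
apply/seteqP; split=> x.
  move=> [u [_ [? [w [z [? ? ->]]] ->]]].
  by exists (u + w), z; split=> //; [exists u, w|rewrite addrA].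
move=> [_ [z [[u [w [? ? ->]]] ? ->]]].
by exists u, (w + z); split=> //; [exists w, z|rewrite addrA].
Qed.

Lemma addSACA U W X Y : addS (addS U W) (addS X Y) = addS (addS U X) (addS W Y).
Proof.
rewrite -!addSA; congr addS.
by rewrite !addSA; congr addS; apply: addSC.
Qed.

Lemma fdim_sub U W : U `<=` W -> fdim W -> fdim U.
Proof. by move=> UW [n [s h]]; exists n, s => u /UW /h. Qed.

Lemma fdim_set0 : fdim [set 0].
Proof.
exists 0, (fun=> 0) => _ ->; exists (fun=> 0).
by rewrite /lcomb big1// => i _; rewrite scaler0.
Qed.

Lemma lcombD n (c c' : 'I_n -> k) s :
  lcomb c s + lcomb c' s = lcomb (fun i => c i + c' i) s.
Proof. by rewrite /lcomb -big_split; apply: eq_bigr => i _; rewrite scalerDl. Qed.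

Lemma lcombN n (c : 'I_n -> k) s : - lcomb c s = lcomb (fun i => - c i) s.
Proof. by rewrite /lcomb -sumrN; apply: eq_bigr => i _; rewrite scaleNr. Qed.

Lemma lcombZ n a (c : 'I_n -> k) s : a *: lcomb c s = lcomb (fun i => a * c i) s.
Proof. by rewrite /lcomb scaler_sumr; apply: eq_bigr => i _; rewrite scalerA. Qed.

Definition fcat T m n (f : 'I_m -> T) (g : 'I_n -> T) (i : 'I_(m + n)) :=
  match fintype.split i with inl j => f j | inr j => g j end.

Lemma fcatl T m n (f : 'I_m -> T) (g : 'I_n -> T) i : fcat f g (lshift n i) = f i.
Proof. by rewrite /fcat -[lshift n i]/(unsplit (inl i)) unsplitK. Qed.

Lemma fcatr T m n (f : 'I_m -> T) (g : 'I_n -> T) i : fcat f g (rshift m i) = g i.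
Proof. by rewrite /fcat -[rshift m i]/(unsplit (inr i)) unsplitK. Qed.

Lemma lcomb_cat m n (c : 'I_m -> k) (c' : 'I_n -> k) s s' :
  lcomb (fcat c c') (fcat s s') = lcomb c s + lcomb c' s'.
Proof.
rewrite /lcomb big_split_ord /=.
by congr (_ + _); apply: eq_bigr => i _; rewrite ?fcatl ?fcatr.
Qed.

Lemma lcomb_split m n (c : 'I_(m + n) -> k) (s : 'I_m -> V) (s' : 'I_n -> V) :
  lcomb c (fcat s s') = lcomb (c \o lshift n) s + lcomb (c \o @rshift m n) s'.
Proof.
rewrite /lcomb big_split_ord /=.
by congr (_ + _); apply: eq_bigr => i _; rewrite ?fcatl ?fcatr.
Qed.

Lemma fdim_addS U W : fdim U -> fdim W -> fdim (addS U W).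
Proof.
move=> [m [s hs]] [n [t ht]]; exists (m + n)%N, (fcat s t).
move=> _ [u [w [/hs [c ->] /ht [c' ->] ->]]]; exists (fcat c c').
by rewrite lcomb_cat.
Qed.

(** If m < n, the n by m matrix of coordinates modulo [W] has a nonzero row in its left kernel,
    which is a nontrivial relation between the [s i] modulo [W]. *)
Lemma free_le_span W n m (s : 'I_n -> V) (t : 'I_m -> V) : subsp W ->
  (forall c, W (lcomb c s) -> forall i, c i = 0) ->
  (forall i, exists c, W (s i - lcomb c t)) -> (n <= m)%N.
Proof.
move=> sW sfree /choice[T hT]; rewrite leqNgt; apply/negP => mn.
pose A := \matrix_(i, j) T i j.
have : kermx A != 0.
  rewrite -mxrank_eq0 mxrank_ker subn_eq0 -ltnNge.
  by rewrite (leq_ltn_trans (rank_leq_col _)).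
case/matrix0Pn => i [j] /eqP; apply.
pose c j' := kermx A i j'.
apply: (sfree c).
have -> : lcomb c s = \sum_j' c j' *: (s j' - lcomb (T j') t).
  rewrite (eq_bigr (fun j' => c j' *: s j' - c j' *: lcomb (T j') t)); last first.
    by move=> j' _; rewrite scalerBr.
  rewrite big_split /= sumrN.
  suff -> : \sum_j' c j' *: lcomb (T j') t = 0 by rewrite subr0.
  rewrite (eq_bigr (fun j' => \sum_l (c j' * T j' l) *: t l)); last first.
    by move=> j' _; rewrite lcombZ.
  rewrite exchange_big /= big1// => l _; rewrite -scaler_suml.
  have /matrixP/(_ i l) := mulmx_ker A; rewrite mxE [RHS]mxE => h.
  suff -> : \sum_j' c j' * T j' l = 0 by rewrite scale0r.
  by rewrite -[RHS]h; apply: eq_bigr => j' _; rewrite [A _ _]mxE.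
by apply: subsp_sum => // j' _; apply: subspZ.
Qed.

Lemma relbasis_uniq U W n m (s : 'I_n -> V) (t : 'I_m -> V) : subsp W ->
  relbasis U W s -> relbasis U W t -> n = m.
Proof.
move=> sW [Us sf ss] [Ut tf ts]; apply/eqP; rewrite eqn_leq.
rewrite (free_le_span sW sf (fun i => ts _ (Us i))).
by rewrite (free_le_span sW tf (fun i => ss _ (Ut i))).
Qed.

Lemma rdimE U W n (s : 'I_n -> V) : subsp W -> relbasis U W s -> rdim U W = n.
Proof.
move=> sW hs; rewrite /rdim; case: xgetP => [m _ [t ht]|/(_ n)].
  exact: relbasis_uniq ht hs.
by case; exists s.
Qed.

(** Families in [U] that are free modulo [W] have bounded size by [free_le_span]; one of maximal
    size also spans. *)
Lemma relbasis_ex U W : subsp W -> fdim U ->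
  exists s : 'I_(rdim U W) -> V, relbasis U W s.
Proof.
move=> sW [m [t ht]].
pose free n := exists s : 'I_n -> V, (forall i, U (s i)) /\
  (forall c, W (lcomb c s) -> forall i, c i = 0).
have ub n : free n -> (n <= m)%N.
  move=> [s [Us sf]]; apply: (free_le_span (t := t) sW sf) => i.
  by have [c ->] := ht _ (Us i); exists c; rewrite subrr; apply: subsp0.
have e0 : exists n, `[< free n >].
  by exists 0%N; apply/asboolP; exists (fun=> 0); split=> [[]|c _ []].
have ub' n : `[< free n >] -> (n <= m)%N by move/asboolP; apply: ub.
case: (ex_maxnP e0 ub') => n /asboolP[s [Us sf]] nmax.
have hs : relbasis U W s.
  split=> // u Uu; apply: contrapT => /forallNP hu.
  suff /asboolP/nmax : free (n + 1)%N by rewrite addn1 ltnn.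
  exists (fcat s (fun=> u)); split.
    by move=> i; rewrite /fcat; case: (fintype.split i).
  move=> c; rewrite lcomb_split {2}/lcomb big_ord1 /=.
  set a := c _; set c' := _ \o _ => Wc.
  have a0 : a = 0.
    apply: contrapT => /eqP a0; apply: (hu (fun i => - (a^-1 * c' i))).
    rewrite -lcombN -lcombZ opprK addrC.
    rewrite -[X in _ + X](scalerK a0) -scalerDr.
    exact: subspZ.
  rewrite a0 scale0r addr0 in Wc.
  move=> i; rewrite -[i]fintype.splitK; case: (fintype.split i) => j /=.
    exact: (sf _ Wc).
  by rewrite (_ : j = ord0) ?ord1.
by rewrite (rdimE sW hs); exists s.
Qed.

Lemma rdim_le_span U W n (t : 'I_n -> V) : subsp W -> fdim U ->
  (forall u, U u -> exists c, W (u - lcomb c t)) -> (rdim U W <= n)%N.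
Proof.
move=> sW fU ht; have [s [Us sf _]] := relbasis_ex sW fU.
by apply: (free_le_span sW sf (t := t)) => i; apply: ht.
Qed.

Lemma free_le_rdim U W n (s : 'I_n -> V) : subsp W -> fdim U ->
  (forall i, U (s i)) -> (forall c, W (lcomb c s) -> forall i, c i = 0) ->
  (n <= rdim U W)%N.
Proof.
move=> sW fU Us sf; have [t [_ _ ht]] := relbasis_ex sW fU.
by apply: (free_le_span sW sf (t := t)) => i; apply: ht.
Qed.

Lemma rdim_eq_ext U W W' : (forall u, U u -> (W u <-> W' u)) -> subsp U ->
  rdim U W = rdim U W'.
Proof.
move=> h sU; rewrite /rdim; congr xget; apply/funext => n; apply/propext.
by split=> -[s [Us sf ss]]; exists s; split=> // [c /(h _ (subsp_lcomb c sU Us)) /sf//|u Uu];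
  have [c hc] := ss _ Uu; exists c; apply/(h _ _) => //; apply: subspB => //; apply: subsp_lcomb.
Qed.

Lemma rdim_eq0 U W : subsp W -> U `<=` W -> rdim U W = 0%N.
Proof.
move=> sW UW; apply: (rdimE (s := fun i : 'I_0 => 0)) => //.
split=> [[]//|c _ []//|u /UW Wu]; exists (fun=> 0).
by rewrite /lcomb big_ord0 subr0.
Qed.

Lemma rdim_eq0_sub U W : subsp W -> fdim U -> rdim U W = 0%N -> U `<=` W.
Proof.
move=> sW fU h u Uu; have [s [_ _ /(_ _ Uu)[c]]] := relbasis_ex sW fU.
rewrite /lcomb; move: c s; rewrite h => c s.
by rewrite big_ord0 subr0.
Qed.

Lemma rdim_subl U U' W : subsp W -> fdim U' -> U `<=` U' ->
  (rdim U W <= rdim U' W)%N.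
Proof.
move=> sW fU' UU'; have fU := fdim_sub UU' fU'.
have [s [Us sf _]] := relbasis_ex sW fU.
by apply: free_le_rdim sf => // i; apply: UU'.
Qed.

Lemma rdim_subr U W W' : subsp W -> subsp W' -> fdim U -> W `<=` W' ->
  (rdim U W' <= rdim U W)%N.
Proof.
move=> sW sW' fU WW'; have [s [Us _ ss]] := relbasis_ex sW fU.
by apply: (rdim_le_span (t := s)) => // u /ss[c /WW']; exists c.
Qed.

Lemma rdim_trans U X W : subsp U -> subsp X -> subsp W -> W `<=` X -> X `<=` U ->
  fdim U -> rdim U W = (rdim U X + rdim X W)%N.
Proof.
move=> sU sX sW WX XU fU; have fX := fdim_sub XU fU.
have [s [Us sf ss]] := relbasis_ex sX fU.
have [t [Xt tf ts]] := relbasis_ex sW fX.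
apply: (rdimE (s := fcat s t)) => //; split.
- by move=> i; rewrite /fcat; case: (fintype.split i) => // j; apply: XU.
- move=> c; rewrite lcomb_split => Wc.
  have Xc : X (lcomb (c \o @rshift _ _) t) by apply: subsp_lcomb.
  have c0 i : c (lshift _ i) = 0.
    apply: (sf (c \o lshift _)).
    by rewrite -[lcomb _ _](addrK (lcomb (c \o @rshift _ _) t)); apply: subspB => //; apply: WX.
  have l0 : lcomb (c \o lshift _) s = 0.
    by rewrite /lcomb big1// => i _; rewrite /= c0 scale0r.
  rewrite l0 add0r in Wc.
  move=> i; rewrite -[i]fintype.splitK; case: (fintype.split i) => j //=.
  exact: (tf _ Wc).
- move=> u /ss[c /ts[c' h]]; exists (fcat c c').
  by rewrite lcomb_cat opprD addrA.
Qed.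

Lemma rdim_addSr U X W : subsp U -> subsp X -> subsp W -> X `<=` W ->
  fdim U -> fdim X -> rdim (addS U X) W = rdim U W.
Proof.
move=> sU sX sW XW fU fX; have [s [Us sf ss]] := relbasis_ex sW fU.
apply: (rdimE (s := s)) => //; split=> //; first by move=> i; apply: addSl.
move=> _ [u [x [/ss[c hc] /XW Wx ->]]]; exists c.
by rewrite addrAC; apply: subspD.
Qed.

Lemma rdim_addS_le U U' W : subsp U -> subsp U' -> subsp W -> fdim U -> fdim U' ->
  (rdim (addS U U') W <= rdim U W + rdim U' W)%N.
Proof.
move=> sU sU' sW fU fU'; have [s [_ _ ss]] := relbasis_ex sW fU.
have [t [_ _ tt]] := relbasis_ex sW fU'.
apply: (rdim_le_span (t := fcat s t)) => //; first exact: fdim_addS.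
move=> _ [u [w [/ss[c h] /tt[c' h'] ->]]]; exists (fcat c c').
by rewrite lcomb_cat opprD addrACA; apply: subspD.
Qed.

(** The dimension of [C i] modulo [W] grows at each strict inclusion. Together with [rdim_chain_ex]
    this identifies [rdim] with a length defined by chains. *)
Lemma rdim_chain U W n (C : nat -> set V) : subsp W -> fdim U ->
  (forall i, (i <= n)%N -> [/\ subsp (C i), W `<=` C i & C i `<=` U]) ->
  (forall i, (i < n)%N -> C i `<` C i.+1) -> (n <= rdim U W)%N.
Proof.
move=> sW fU hC hlt.
have fC i : (i <= n)%N -> fdim (C i) by move=> /hC[_ _ h]; apply: fdim_sub h fU.
suff h i : (i <= n)%N -> (i <= rdim (C i) W)%N.
  by rewrite (leq_trans (h n _))// rdim_subl//; have [] := hC n (leqnn _).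
elim: i => // i IH lt_in; have le_in := ltnW lt_in.
have [sC WC _] := hC _ le_in; have [sC' WC' _] := hC _ lt_in.
have [CC' CC'N] := hlt _ lt_in.
rewrite (rdim_trans sC' sC sW)//; last exact: fC.
rewrite -add1n leq_add ?IH// lt0n; apply/eqP => /rdim_eq0_sub h.
by apply: CC'N; apply: h => //; apply: fC.
Qed.

Lemma rdim_chain_ex U W : subsp U -> subsp W -> W `<=` U -> fdim U ->
  exists C : nat -> set V,
  (forall i, (i <= rdim U W)%N -> [/\ subsp (C i), W `<=` C i & C i `<=` U]) /\
  (forall i, (i < rdim U W)%N -> C i `<` C i.+1).
Proof.
move=> sU sW WU fU; have [s [Us sf _]] := relbasis_ex sW fU.
set n := rdim U W in s Us sf *.
(* [C i] is [W] plus the span of the first i vectors of a basis modulo [W]. *)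
pose C i := [set v | exists c : 'I_n -> k,
  (forall j : 'I_n, (i <= j)%N -> c j = 0) /\ W (v - lcomb c s)].
exists C; split=> i le_in; last first.
  split.
    by move=> v [c [hc Wc]]; exists c; split=> // j ij; apply: hc; apply: ltnW.
  pose i' := Ordinal le_in.
  have Es : lcomb (fun j => (j == i')%:R) s = s i'.
    rewrite /lcomb (bigD1 i')//= eqxx scale1r big1 ?addr0// => j /negPf ->.
    by rewrite scale0r.
  move=> /(_ (s i')) []; last first.
    move=> c [hc /=]; rewrite -Es lcombN lcombD => /sf/(_ i').
    by rewrite eqxx hc// subr0 => /eqP; rewrite oner_eq0.
  exists (fun j => (j == i')%:R); split; last by rewrite Es subrr; apply: subsp0.
  by move=> j; case: eqP => // ->; rewrite ltnn.
split.
- split; first exists (fun=> 0).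
    split=> //; rewrite /lcomb big1 ?subr0; first exact: subsp0.
    by move=> j _; rewrite scale0r.
  move=> a u v [c [hc Wc]] [c' [hc' Wc']]; exists (fun j => a * c j + c' j); split.
    by move=> j ij; rewrite hc// hc'// mulr0 addr0.
  by rewrite -lcombD -lcombZ opprD addrACA -scalerBr; apply: subspZD.
- move=> w Ww; exists (fun=> 0); split=> //.
  by rewrite /lcomb big1 ?subr0// => j _; rewrite scale0r.
- move=> v [c [_ /WU h]]; rewrite -[v](subrK (lcomb c s)).
  by apply: subspD => //; apply: subsp_lcomb.
Qed.

End RelativeDimension.

Section Semilinear.
Context {k : fieldType} {V V' : lmodType k}.

(* Surjectivity of [sigma] is where perfectness of the ground field enters. *)
Lemma rdim_semilinear (sigma : k -> k) (phi : V -> V') (U W : set V) (W' : set V') :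
  sigma 0 = 0 -> (forall c, exists b, sigma b = c) ->
  (forall u v, phi (u + v) = phi u + phi v) ->
  (forall c v, phi (c *: v) = sigma c *: phi v) ->
  subsp U -> subsp W -> subsp W' -> fdim U ->
  (forall u, U u -> (W u <-> W' (phi u))) ->
  rdim (phi @` U) W' = rdim U W.
Proof.
move=> s0 ssurj phiD phiZ sU sW sW' fU hW.
have phi0 : phi 0 = 0 by apply: (addrI (phi 0)); rewrite -phiD !addr0.
have phi_lcomb n (c : 'I_n -> k) t : phi (lcomb c t) = lcomb (sigma \o c) (phi \o t).
  rewrite /lcomb; elim/big_rec2: _ => // i y1 y2 _ <-.
  by rewrite phiD phiZ.
have phiN v : phi (- v) = - phi v.
  by apply: (addrI (phi v)); rewrite -phiD !subrr.
have [t [Ut tf ts]] := relbasis_ex sW fU.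
apply: (rdimE (s := phi \o t)) => //; split.
- by move=> i; exists (t i).
- move=> c; have [b hb] := choice (fun i => ssurj (c i)).
  rewrite (_ : c = sigma \o b) -?phi_lcomb; last by apply/funext => i /=; rewrite hb.
  move/hW => h i; rewrite /= (tf b) ?s0//; apply: h; exact: subsp_lcomb.
- move=> _ [u Uu <-]; have [c hc] := ts _ Uu; exists (sigma \o c).
  rewrite -phi_lcomb -phiN -phiD; apply/hW => //.
  by apply: subspB => //; apply: subsp_lcomb.
Qed.

Lemma subsp_semilinear (sigma : k -> k) (phi : V -> V') (U : set V) :
  (forall c, exists b, sigma b = c) ->
  (forall u v, phi (u + v) = phi u + phi v) ->
  (forall c v, phi (c *: v) = sigma c *: phi v) ->
  subsp U -> subsp (phi @` U).
Proof.
move=> ssurj phiD phiZ sU; split.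
  by exists 0; [apply: subsp0|apply: (addrI (phi 0)); rewrite -phiD !addr0].
move=> c _ _ [u Uu <-] [v Uv <-]; have [b <-] := ssurj c.
by exists (b *: u + v); rewrite ?phiD ?phiZ//; apply: subspZD.
Qed.

Lemma fdim_semilinear (sigma : k -> k) (phi : V -> V') (U : set V) :
  (forall u v, phi (u + v) = phi u + phi v) ->
  (forall c v, phi (c *: v) = sigma c *: phi v) ->
  fdim U -> fdim (phi @` U).
Proof.
move=> phiD phiZ [n [s hs]]; exists n, (phi \o s) => _ [u /hs[c ->] <-].
exists (sigma \o c); rewrite /lcomb; elim/big_rec2: _ => [|i y1 y2 _ <-].
  by apply: (addrI (phi 0)); rewrite -phiD !addr0.
by rewrite phiD phiZ.
Qed.

Lemma subsp_preimage (sigma : k -> k) (phi : V -> V') (W : set V') :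
  (forall u v, phi (u + v) = phi u + phi v) ->
  (forall c v, phi (c *: v) = sigma c *: phi v) ->
  subsp W -> subsp (phi @^-1` W).
Proof.
move=> phiD phiZ sW; split.
  by rewrite /= (_ : phi 0 = 0); [apply: subsp0|apply: (addrI (phi 0)); rewrite -phiD !addr0].
by move=> c u v /= Wu Wv; rewrite phiD phiZ; apply: subspZD.
Qed.

End Semilinear.

(** * Eventually polynomial functions *)

Section EventuallyPolynomial.
Implicit Types (F G : nat -> nat) (p : {poly rat}).

(* The degree is less than [h], so that [h = 0] means eventually zero. *)
Definition evpoly (h : nat) F := exists p, (size p <= h)%N /\
  exists N, forall m, (N <= m)%N -> (F m)%:R = p.[m%:R].

Lemma evpoly_ext h F G :
  (exists N, forall m, (N <= m)%N -> F m = G m) -> evpoly h F -> evpoly h G.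
Proof.
move=> [N FG] [p [sp [N' Fp]]]; exists p; split=> //; exists (maxn N N') => m.
by rewrite geq_max => /andP[/FG <- /Fp].
Qed.

Lemma evpoly0 h F : (exists N, forall m, (N <= m)%N -> F m = 0%N) -> evpoly h F.
Proof.
move=> [N h0]; exists 0; rewrite size_poly0; split=> //; exists N => m /h0 ->.
by rewrite horner0.
Qed.

Lemma evpolyD h F G : evpoly h F -> evpoly h G -> evpoly h (fun m => F m + G m)%N.
Proof.
move=> [p [sp [N Fp]]] [q [sq [N' Gq]]]; exists (p + q); split.
  by rewrite (leq_trans (size_polyD _ _))// geq_max sp.
exists (maxn N N') => m; rewrite geq_max => /andP[/Fp hF /Gq hG].
by rewrite natrD hF hG hornerD.
Qed.

Lemma evpoly_shift h e F : evpoly h F -> evpoly h (fun m => F (m - e)%N).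
Proof.
move=> [p [sp [N Fp]]]; exists (p \Po ('X - e%:R%:P)); split.
  by rewrite size_comp_poly2// size_XsubC.
exists (N + e)%N => m hm; rewrite Fp ?leq_subRL//; last 2 first.
- by rewrite addnC.
- by rewrite (leq_trans _ hm)// leq_addl.
by rewrite horner_comp !hornerE natrB// (leq_trans _ hm)// leq_addl.
Qed.

(** By the factorization of a difference of i-th powers, each X^i - (X - c)^i is c times a sum of
    products of degree i - 1. *)
Lemma size_poly_diff c p :
  (size (p - (p \Po ('X - c%:P)))%R <= (size p).-1)%N.
Proof.
have pE : \sum_(i < size p) p`_i *: 'X^i = p by rewrite -poly_def coefK.
have -> : p - (p \Po ('X - c%:P)) = \sum_(i < size p) p`_i *: ('X^i - ('X - c%:P) ^+ i).
  rewrite comp_polyE; under [RHS]eq_bigr do rewrite scalerBr.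
  by rewrite [RHS]sumrB pE.
apply: (leq_trans (size_sum _ _ _)); apply/bigmax_leqP => i _.
apply: (leq_trans (size_scale_leq _ _)).
rewrite subrXX opprB addrC subrK mul_polyC.
apply: (leq_trans (size_scale_leq _ _)).
apply: (leq_trans (size_sum _ _ _)); apply/bigmax_leqP => j _.
rewrite size_monicM ?monicXn ?monic_neq0 ?monic_exp ?monicXsubC//.
rewrite size_polyXn size_exp_XsubC; case: i j => i /= ilt [j /= jlt]; lia.
Qed.

(** Induction on the degree: a multiple of X^(h+1) accounts for the leading term of p and leaves a
    remainder of lower degree. *)
Lemma poly_antidiff h p : (size p <= h)%N ->
  exists q : {poly rat}, (size q <= h.+1)%N /\ (q \Po ('X + 1)) - q = p.
Proof.
elim: h p => [|h IH] p sp.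
  exists 0; rewrite size_poly0 comp_poly0 subr0; split=> //.
  by apply/esym/eqP; rewrite -size_poly_eq0 -leqn0.
(* The forward difference of X^(h+1) has leading term (h + 1) X^h; the division is possible over the
   rationals. *)
pose c := p`_h / h.+1%:R.
pose r := c *: 'X^(h.+1) : {poly rat}.
pose dr := \sum_(i < h) (c *+ 'C(h.+1, i)) *: 'X^i : {poly rat}.
have rE : (r \Po ('X + 1)) - r = dr + p`_h *: 'X^h.
  rewrite comp_polyZ comp_Xn_poly -scalerBr [_ + 1]addrC.
  rewrite exprDn !big_ord_recr /= subnn expr0 mul1r binn mulr1n addrK.
  rewrite (_ : (h.+1 - h = 1)%N) ?expr1 ?mul1r; last lia.
  rewrite scalerDr; congr (_ + _).
    rewrite scaler_sumr; apply: eq_bigr => i _.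
    by rewrite expr1n mul1r -scalerMnr scalerMnl.
  by rewrite binSn -scalerMnr scalerMnl -mulr_natr /c divfK// pnatr_eq0.
have : (size (p - (dr + p`_h *: 'X^h))%R <= h)%N.
  apply/leq_sizeP => j hj; rewrite coefB coefD coefZ coefXn coef_sum big1 ?add0r.
    move: hj; rewrite leq_eqVlt => /orP[/eqP <-|hj]; first by rewrite eqxx mulr1 subrr.
    by rewrite gtn_eqF// mulr0 subr0 nth_default// (leq_trans sp).
  by move=> i _; rewrite coefZ coefXn gtn_eqF ?mulr0// (leq_trans _ hj).
move=> /IH[q [sq qE]]; exists (q + r); split.
  rewrite (leq_trans (size_polyD _ _))// geq_max (leq_trans sq)//=.
  by rewrite (leq_trans (size_scale_leq _ _))// size_polyXn.
by rewrite comp_polyD opprD addrACA qE rE subrK.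
Qed.

(** F has the same increments as a polynomial antidifference of D, so that both differ by a constant
    from some point on. *)
Lemma evpoly_sum h F D : evpoly h D ->
  (exists N, forall m, (N <= m)%N -> F m.+1 = (F m + D m.+1)%N) -> evpoly h.+1 F.
Proof.
move=> [p [sp [N Dp]]] [N' FD].
have [q [sq qE]] := poly_antidiff sp.
pose q' := q \Po ('X + 1).
pose N0 := maxn N N'; pose c := (F N0)%:R - q'.[N0%:R].
have hm m : (F (N0 + m)%N)%:R = q'.[(N0 + m)%N%:R] + c.
  elim: m => [|m IH]; first by rewrite addn0 /c [RHS]addrC subrK.
  rewrite addnS FD; last by rewrite (leq_trans (leq_maxr N N'))// leq_addr.
  rewrite natrD IH Dp; last by rewrite (leq_trans (leq_maxl N N'))// (leq_trans (leq_addr m _)).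
  have q'E x : q'.[x] = q.[x + 1] by rewrite horner_comp !hornerE.
  have -> : p.[(N0 + m).+1%:R] = q'.[(N0 + m).+1%:R] - q'.[(N0 + m)%N%:R].
    by rewrite -qE hornerD hornerN [X in _ = _ - X]q'E natr1.
  by rewrite addrC addrA subrK.
exists (q' + c%:P); split.
  rewrite (leq_trans (size_polyD _ _))// geq_max size_comp_poly2 ?sq; last first.
    by rewrite (_ : 'X + 1 = 'X - (- 1)%:P) ?size_XsubC// polyCN opprK.
  by rewrite /= (leq_trans (size_polyC_leq1 _)).
exists N0 => m hm'; rewrite -(subnKC hm') hm !hornerE //.
Qed.

Lemma leq_exp2 e m n : (m <= n)%N -> (m ^ e <= n ^ e)%N.
Proof. by case: e => // e; rewrite leq_exp2r. Qed.

Lemma leq_mul_exp C e m n : (m <= n)%N -> (C * m.+1 ^ e <= C * n.+1 ^ e)%N.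
Proof. by move=> mn; rewrite leq_mul2l leq_exp2 ?orbT. Qed.

Lemma horner_bound h p : (size p <= h.+1)%N ->
  exists C : nat, forall m : nat, `|p.[m%:R]| <= (C * m.+1 ^ h)%:R.
Proof.
move=> sp; exists (Num.truncn (\sum_(i < size p) `|p`_i|)).+1 => m.
rewrite natrM; apply: (le_trans (y := (\sum_(i < size p) `|p`_i|) * (m.+1 ^ h)%:R)).
  rewrite horner_coef (le_trans (ler_norm_sum _ _ _))// mulr_suml ler_sum// => i _.
  rewrite normrM ler_wpM2l// ger0_norm ?exprn_ge0// -natrX ler_nat.
  apply: (leq_trans (leq_exp2 i (leqnSn m))); rewrite leq_pexp2l//.
  by case: i => i /= ilt; rewrite -ltnS (leq_trans ilt).
rewrite ler_wpM2r// ltW// truncnS_gt//.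
Qed.

Lemma evpoly_bound h F : evpoly h.+1 F ->
  exists C, forall m, (F m <= C * m.+1 ^ h)%N.
Proof.
move=> [p [sp [N Fp]]]; have [C hC] := horner_bound sp.
exists (C + \sum_(i < N) F i)%N => m; case: (leqP N m) => hm.
  have := hC m; rewrite -Fp// normr_nat ler_nat => /leq_trans; apply.
  by rewrite leq_mul2r leq_addr orbT.
rewrite (leq_trans (n := (\sum_(i < N) F i)%N))//.
  by rewrite (bigD1 (Ordinal hm))//= leq_addr.
by rewrite (leq_trans (leq_addl C _))// leq_pmulr// expn_gt0.
Qed.

(** A nonzero coefficient of degree h + 1 would outgrow every multiple of m^h. *)
Lemma poly_bound_size h p C N : (size p <= h.+2)%N ->
  (forall m, (N <= m)%N -> `|p.[m%:R]| <= (C * m.+1 ^ h)%:R) -> (size p <= h.+1)%N.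
Proof.
move=> sp hp; suff c0 : p`_h.+1 = 0.
  apply/leq_sizeP => j; rewrite leq_eqVlt => /orP[/eqP <- //|hj].
  by rewrite nth_default// (leq_trans sp).
pose r := p - p`_h.+1 *: 'X^(h.+1).
have sr : (size r <= h.+1)%N.
  apply/leq_sizeP => j; rewrite /r coefB coefZ coefXn leq_eqVlt => /orP[/eqP <-|hj].
    by rewrite eqxx mulr1 subrr.
  by rewrite gtn_eqF// mulr0 subr0 nth_default// (leq_trans sp).
have [C' hC'] := horner_bound sr.
case: (eqVneq p`_h.+1 0) => // c0; exfalso.
have c1 : 0 < `|p`_h.+1| by rewrite normr_gt0.
(* Beyond [K] the leading term exceeds the given bound and the contribution of the lower terms
   together; 2^h comes from m + 1 <= 2 m. *)
pose K := ((C + C') * 2 ^ h)%N%:R / `|p`_h.+1| : rat.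
pose m := (maxn N (Num.truncn K)).+1.
have hm : K < m%:R.
  by apply: (lt_le_trans (truncnS_gt _)); rewrite ler_nat /m ltnS leq_maxr.
have : `|p`_h.+1| * m%:R ^+ h.+1 <= ((C + C') * m.+1 ^ h)%:R.
  have -> : `|p`_h.+1| * m%:R ^+ h.+1 = `|p.[m%:R] - r.[m%:R]|.
    rewrite /r !hornerE opprB addrC subrK normrM normrX normr_nat //.
  rewrite mulnDl natrD (le_trans (ler_normB _ _))// lerD// hp//.
  by rewrite /m leqW// leq_maxl.
rewrite leNgt => /negP; apply.
apply: (le_lt_trans (y := ((C + C') * 2 ^ h)%:R * m%:R ^+ h)).
  rewrite -natrX -natrM ler_nat -mulnA leq_mul2l -expnMn.
  by rewrite leq_exp2 ?orbT//; lia.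
rewrite exprS mulrA ltr_pM2r ?exprn_gt0// mulrC -ltr_pdivrMr//.
Qed.

Lemma evpoly_diff h e F D : evpoly h.+1 F ->
  (exists N, forall m, (N <= m)%N -> F m = (F (m - e) + D m)%N) -> evpoly h D.
Proof.
move=> [p [sp [N Fp]]] [N' FD].
exists (p - (p \Po ('X - e%:R%:P))); split.
  by rewrite (leq_trans (size_poly_diff _ _))//; case: (size p) sp.
exists (N + N' + e)%N => m hm.
have -> : (D m)%:R = (F m)%:R - (F (m - e)%N)%:R :> rat.
  by rewrite (FD m) ?natrD 1?addrC ?addKr//; lia.
rewrite !Fp; [|lia..]; rewrite hornerD hornerN horner_comp !hornerE natrB//; lia.
Qed.

(** The coefficient of degree h + 1 in p(q X) - r p(X) is that of p times q^(h+1) - r. It vanishes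
    because the difference is O(m^h), while [Fbig] ensures that p has degree h + 1. *)
Lemma evpoly_scale h F q r C : (0 < q)%N -> evpoly h.+2 F ->
  (forall C', exists m, (C' * m.+1 ^ h < F m)%N) ->
  (forall m, F (q * m)%N <= r * F m + C * m.+1 ^ h)%N ->
  (forall m, r * F m <= F (q * m)%N + C * m.+1 ^ h)%N -> r = (q ^ h.+1)%N.
Proof.
move=> q0 [p [sp [N Fp]]] Fbig h1 h2.
have c0 : p`_h.+1 != 0.
  apply/eqP => c0; have [|C' hC'] := @evpoly_bound h F.
    exists p; split; last by exists N.
    apply/leq_sizeP => j; rewrite leq_eqVlt => /orP[/eqP <- //|hj].
    by rewrite nth_default// (leq_trans sp).
  by have [m] := Fbig C'; rewrite ltnNge hC'.
pose s := (p \Po (q%:R *: 'X)) - r%:R *: p.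
have sE i : s`_i = p`_i * (q%:R ^+ i - r%:R).
  rewrite /s coefB coefZ comp_polyE coef_sum mulrBr [r%:R * _]mulrC; congr (_ - _).
  under eq_bigr do rewrite exprZn scalerA coefZ coefXn.
  case: (ltnP i (size p)) => hi.
    rewrite (bigD1 (Ordinal hi))//= eqxx mulr1 big1 ?addr0// => j /eqP ji.
    by rewrite (_ : (i == j) = false) ?mulr0//; apply/eqP => ij; apply: ji; apply: val_inj.
  rewrite nth_default// mul0r big1// => j _.
  by rewrite gtn_eqF ?mulr0// (leq_trans (ltn_ord j)).
have ss : (size s <= h.+2)%N.
  by apply/leq_sizeP => j hj; rewrite sE nth_default ?mul0r// (leq_trans sp).
have /leq_sizeP/(_ _ (leqnn _)) : (size s <= h.+1)%N.
  apply: (poly_bound_size (C := C) (N := N) ss) => m hm.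
  have -> : s.[m%:R] = (F (q * m)%N)%:R - (r * F m)%N%:R.
    rewrite natrM !Fp//; last by rewrite (leq_trans hm)// leq_pmull.
    by rewrite /s hornerD hornerN hornerZ horner_comp hornerZ hornerX natrM.
  rewrite ler_norml lerBlDl -natrD ler_nat h1 andbT lerNl opprB lerBlDl -natrD.
  by rewrite ler_nat h2.
rewrite sE => /eqP; rewrite mulf_eq0 (negPf c0)/= subr_eq0 -natrX.
by rewrite eqr_nat => /eqP ->.
Qed.

End EventuallyPolynomial.

(** * Hilbert functions of homogeneous ideals *)

Section GradedFamilies.
Context {k : fieldType} {A : comAlgType k} (GA : nat -> set A).

Definition ksub (M : lmodType A) (U : set M) := subsp (U : set (restr_scalars M)).
Definition kdim (M : lmodType A) (U W : set M) :=
  rdim (U : set (restr_scalars M)) (W : set (restr_scalars M)).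
Definition kfin (M : lmodType A) (U : set M) := fdim (U : set (restr_scalars M)).
Definition ksum (M : lmodType A) (U W : set M) : set M :=
  addS (U : set (restr_scalars M)) (W : set (restr_scalars M)).

(* A graded submodule, given by its homogeneous components. *)
Definition gmod (M : lmodType A) (G : nat -> set M) :=
  (forall i, ksub (G i)) /\
  (forall i j a v, GA i a -> G j v -> G (i + j)%N (a *: v)).

Definition gsub (T : Type) (J K : nat -> set T) := forall i, J i `<=` K i.
Definition gproper (T : Type) (J K : nat -> set T) := gsub J K /\ ~ gsub K J.

Definition gideal (J : nat -> set A) := gmod (J : nat -> set A^o) /\ gsub J GA.

Definition hprime (P : nat -> set A) := [/\ gideal P, ~ P 0%N 1 &
  forall i j a b, GA i a -> GA j b -> P (i + j)%N (a * b) -> P i a \/ P j b].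

Definition gcolon (J : nat -> set A) e x : nat -> set A :=
  fun i => [set a | GA i a /\ J (i + e)%N (a * x)].

Definition gprincipal e x : nat -> set A :=
  fun i => [set a | a = 0 \/ exists l b, [/\ (l + e)%N = i, GA l b & a = b * x]].

Definition gadjoin (J : nat -> set A) e x : nat -> set A :=
  fun i => ksum (J i : set A^o) (gprincipal e x i).

Definition hilb (J : nat -> set A) m := kdim (GA m : set A^o) (J m).

(* What is used about the ring, in terms of homogeneous components only:
   [ga_noeth] is Noetherian induction on homogeneous ideals, and [ga_dim] bounds
   chains of homogeneous primes only. *)
Record graded_facts (d : nat) : Prop := GradedFacts {
  ga_sub : forall i, ksub (GA i : set A^o);
  ga_mul : forall i j a b, GA i a -> GA j b -> GA (i + j)%N (a * b);
  ga_one : GA 0%N 1;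
  ga_zero : forall a, GA 0%N a -> exists c : k, a = c%:A;
  ga_gen : exists s (X : 'I_s -> A), (forall j, GA 1%N (X j)) /\
    forall m a, GA m.+1 a ->
      exists b : 'I_s -> A, (forall j, GA m (b j)) /\ a = \sum_j b j * X j;
  ga_noeth : forall Q : (nat -> set A) -> Prop,
    (forall J, gideal J ->
       (forall J', gideal J' -> gproper J J' -> Q J') -> Q J) ->
    forall J, gideal J -> Q J;
  ga_dim : forall n (P : nat -> nat -> set A),
    (forall i, (i <= n)%N -> hprime (P i)) ->
    (forall i, (i < n)%N -> gproper (P i) (P i.+1)) -> (n <= d)%N }.

End GradedFamilies.

Arguments ksub {k A M} U.
Arguments kdim {k A M} U W.
Arguments kfin {k A M} U.
Arguments ksum {k A M} U W.
Arguments gideal {k A} GA J.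
Arguments hprime {k A} GA P.
Arguments hilb {k A} GA J m.

Section GradedRing.
Context {k : fieldType} {A : comAlgType k} (GA : nat -> set A) (d : nat).
Context (F : graded_facts GA d).
Implicit Types (J K P : nat -> set A) (a b x : A).

Lemma gaS i : ksub (GA i : set A^o). Proof. by case: F. Qed.

Lemma gaM i j a b : GA i a -> GA j b -> GA (i + j)%N (a * b).
Proof. by case: F => _ h _ _ _ _ _; apply: h. Qed.

Lemma ga1 : GA 0%N 1. Proof. by case: F. Qed.

Lemma ksub0 (M : lmodType A) (U : set M) : ksub U -> U 0.
Proof. by case. Qed.

Lemma ksubD (M : lmodType A) (U : set M) u v : ksub U -> U u -> U v -> U (u + v).
Proof. exact: (@subspD k (restr_scalars M)). Qed.

Lemma ksubB (M : lmodType A) (U : set M) u v : ksub U -> U u -> U v -> U (u - v).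
Proof. exact: (@subspB k (restr_scalars M)). Qed.

Lemma ksubZ (M : lmodType A) (U : set M) (c : k) u : ksub U -> U u -> U (c%:A *: u).
Proof. exact: (@subspZ k (restr_scalars M)). Qed.

Lemma ksub_sum (M : lmodType A) (U : set M) (I : Type) (r : seq I) (P : pred I) (E : I -> M) :
  ksub U -> (forall i, P i -> U (E i)) -> U (\sum_(i <- r | P i) E i).
Proof. exact: (@subsp_sum k (restr_scalars M)). Qed.

Lemma ksubP (M : lmodType A) (U : set M) : U 0 ->
  (forall u v, U u -> U v -> U (u + v)) -> (forall (c : k) u, U u -> U (c%:A *: u)) ->
  ksub U.
Proof. by move=> U0 UD UZ; split=> // c u v Uu Uv; apply: UD => //; apply: UZ. Qed.

Lemma scal_GA0 (c : k) : GA 0%N c%:A.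
Proof.
have := ksubZ c (gaS 0%N) (ga1).
by rewrite /GRing.scale/= mulr1.
Qed.

Lemma gmod_eq (T : Type) (G : nat -> set T) i j v : i = j -> G i v -> G j v.
Proof. by move=> ->. Qed.

Lemma ga_exp i a n : GA i a -> GA (i * n)%N (a ^+ n).
Proof.
move=> h; elim: n => [|n IH]; first by rewrite muln0; apply: ga1.
by rewrite mulnS exprS; apply: gaM h IH.
Qed.

Lemma gmod_GA : gmod GA (GA : nat -> set A^o).
Proof. by split=> [i|i j a b]; [apply: gaS|apply: gaM]. Qed.

Lemma gideal_GA : gideal GA GA.
Proof. by split; [apply: gmod_GA|move=> i a]. Qed.

Lemma gideal_ksub J i : gideal GA J -> ksub (J i : set A^o).
Proof. by case=> -[]. Qed.

Lemma gideal_sub J i a : gideal GA J -> J i a -> GA i a.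
Proof. by case=> _ h; apply: h. Qed.

Lemma gideal_mul J i j a b : gideal GA J -> GA i a -> J j b -> J (i + j)%N (a * b).
Proof. by case=> -[_ h] _; apply: h. Qed.

Lemma gideal_mulr J i j a b : gideal GA J -> GA i a -> J j b -> J (j + i)%N (b * a).
Proof. by rewrite mulrC addnC; apply: gideal_mul. Qed.

Lemma gideal_exp J i a n : (0 < n)%N -> gideal GA J -> J i a -> J (i * n)%N (a ^+ n).
Proof.
move=> n0 gJ Ja; rewrite -(prednK n0) mulnS exprS; apply: gideal_mulr => //.
exact/ga_exp/(gideal_sub gJ).
Qed.

Lemma gideal_colon J e x : gideal GA J -> GA e x -> gideal GA (gcolon GA J e x).
Proof.
move=> gJ xe; split=> [|i a []//]; split=> [i|i j a b ai [bj Jb]].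
  apply: ksubP.
  - by split; [apply: ksub0 (gaS i)|rewrite mul0r; apply: ksub0 (gideal_ksub _ gJ)].
  - move=> u v [ui Ju] [vi Jv]; split; first exact: ksubD (gaS i) ui vi.
    by rewrite mulrDl; apply: ksubD (gideal_ksub _ gJ) Ju Jv.
  - move=> c u [ui Ju]; split; first exact: ksubZ (gaS i) ui.
    rewrite -mulrA; exact: (ksubZ c (gideal_ksub _ gJ) Ju).
split; first exact: gaM ai bj.
by rewrite -addnA -mulrA; apply: gideal_mul.
Qed.

Lemma gideal_principal e x : GA e x -> gideal GA (gprincipal GA e x).
Proof.
move=> xe; split; last first.
  move=> i a [->|[l [b [<- bl ->]]]]; first exact: ksub0 (gaS i).
  exact: gaM bl xe.
split=> [i|i j a b ai [->|[l [b' [<- bl ->]]]]].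
- apply: ksubP; first by left.
    move=> u v [->|[l [b [el bl ->]]]]; first by rewrite add0r.
    move=> [->|[l' [b' [el' bl' ->]]]]; rewrite ?addr0.
      by right; exists l, b.
    right; exists l, (b + b'); split; rewrite ?mulrDl//.
    by apply: ksubD (gaS l) bl _; apply: gmod_eq bl'; lia.
  move=> c u [->|[l [b [el bl ->]]]]; first by left; rewrite scaler0.
  right; exists l, (c%:A * b); split; [by []| |exact: mulrA].
  exact: (ksubZ c (gaS l) bl).
- by left; rewrite scaler0.
- right; exists (i + l)%N, (a * b'); split; [by rewrite addnA| |exact: mulrA].
  exact: gaM ai bl.
Qed.

Lemma gideal_add J K : gideal GA J -> gideal GA K ->
  gideal GA (fun i => ksum (J i : set A^o) (K i)).
Proof.
move=> gJ gK; split; last first.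
  move=> i; apply: (@addS_sub k (restr_scalars A^o)); first exact: gaS i.
    by move=> a; apply: gideal_sub gJ.
  by move=> a; apply: gideal_sub gK.
split=> [i|i j a _ ai [u [w [Ju Kw ->]]]].
  by apply: subsp_addS; [apply: gideal_ksub gJ|apply: gideal_ksub gK].
exists (a * u), (a * w); split; first exact: gideal_mul.
  exact: gideal_mul.
exact: mulrDr.
Qed.

Lemma gideal_adjoin J e x : gideal GA J -> GA e x -> gideal GA (gadjoin GA J e x).
Proof. by move=> gJ xe; apply: gideal_add => //; apply: gideal_principal. Qed.

Lemma gadjoin_sub J e x : gideal GA J -> GA e x -> gsub J (gadjoin GA J e x).
Proof.
move=> gJ xe i; apply: (@addSl k (restr_scalars A^o)).
exact: gideal_ksub (gideal_principal xe).
Qed.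

Lemma gadjoin_mem J e x : gideal GA J -> GA e x -> gadjoin GA J e x e x.
Proof.
move=> gJ xe; apply: (@addSr k (restr_scalars A^o)); first exact: gideal_ksub gJ.
by right; exists 0%N, 1; rewrite mul1r; split=> //; apply: ga1.
Qed.

Lemma gcolon_sub J e x : gideal GA J -> GA e x -> gsub J (gcolon GA J e x).
Proof.
move=> gJ xe i a Ja; split; first exact: gideal_sub Ja.
exact: gideal_mulr.
Qed.

Lemma gadjoin_proper J e x : gideal GA J -> GA e x -> ~ J e x ->
  gproper J (gadjoin GA J e x).
Proof.
move=> gJ xe Jx; split; first exact: gadjoin_sub.
by move=> h; apply: Jx; apply: h; apply: gadjoin_mem.
Qed.

Lemma gadjoin_min J K e x : gideal GA K -> gsub J K -> K e x ->
  gsub (gadjoin GA J e x) K.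
Proof.
move=> gK JK Kx i; apply: (@addS_sub k (restr_scalars A^o)); first exact: gideal_ksub gK.
  exact: JK.
move=> _ [->|[l [b [<- bl ->]]]]; first exact: ksub0 (gideal_ksub _ gK).
exact: gideal_mul.
Qed.

Lemma gproper_ex (T : Type) (J K : nat -> set T) : gproper J K ->
  exists i z, K i z /\ ~ J i z.
Proof.
move=> [_ h]; apply: contrapT => h'; apply: h => i x Kx; apply: contrapT => Jx.
by apply: h'; exists i, x.
Qed.

Lemma gsub_trans (T : Type) (J K L : nat -> set T) : gsub J K -> gsub K L -> gsub J L.
Proof. by move=> h h' i x /h /h'. Qed.

Lemma gsub_anti (T : Type) (J K : nat -> set T) : gsub J K -> gsub K J -> J = K.
Proof. by move=> h h'; apply/funext => i; apply/seteqP; split. Qed.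

Lemma gsub_proper (T : Type) (J K : nat -> set T) : gsub J K -> J <> K -> gproper J K.
Proof. by move=> JK ne; split=> // KJ; apply: ne; apply: gsub_anti. Qed.

Lemma hprimeN J : gideal GA J -> ~ hprime GA J -> ~ J 0%N 1 ->
  exists i j a b, [/\ GA i a, GA j b, J (i + j)%N (a * b), ~ J i a & ~ J j b].
Proof.
move=> gJ nP J1; apply: contrapT => h; apply: nP; split=> // i j a b ai bj Jab.
apply: contrapT => /not_orP[Ja Jb]; apply: h.
by exists i, j, a, b.
Qed.

Lemma gideal1 J : gideal GA J -> J 0%N 1 -> J = GA.
Proof.
move=> gJ J1; apply: gsub_anti => i a; first exact: gideal_sub.
by move=> ai; rewrite -[a]mulr1 -[i]addn0; apply: gideal_mul.
Qed.

Lemma kfin_ga m : kfin (GA m : set A^o).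
Proof.
have [s [X [X1 XS]]] := ga_gen F; elim: m => [|m [n [t ht]]].
  exists 1%N, (fun=> (1 : A)) => a /(ga_zero F)[c ->]; exists (fun=> c).
  by rewrite /lcomb big_ord1; apply: (esym (mulr1 _)).
have fX j : kfin ([set b * X j | b in GA m] : set A^o).
  exists n, (fun i => (t i : A) * X j) => _ [b /ht[c ->] <-]; exists c.
  rewrite /lcomb mulr_suml; apply: eq_bigr => i _.
  exact: (esym (mulrA _ _ _)).
have fs (r : seq 'I_s) : kfin ([set a | exists b : 'I_s -> A,
    (forall j, GA m (b j)) /\ a = \sum_(j <- r) b j * X j] : set A^o).
  elim: r => [|j r IH].
    exists 0%N, (fun=> 0) => _ [b [_ ->]]; exists (fun=> 0).
    by rewrite big_nil /lcomb big_ord0.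
  apply: fdim_sub (fdim_addS (fX j) IH) => _ [b [hb ->]].
  rewrite big_cons; exists (b j * X j), (\sum_(i <- r) b i * X i); split=> //.
    by exists (b j).
  by exists b.
by apply: fdim_sub (fs (index_enum _)) => a /XS.
Qed.

Lemma gprincipal_img m e x : GA e x ->
  gprincipal GA e x (m + e)%N = [set a * x | a in GA m].
Proof.
move=> xe; apply/seteqP; split=> a.
  move=> [->|[l [b [/addIn <- bl ->]]]]; last by exists b.
  by exists 0; rewrite ?mul0r//; apply: ksub0 (gaS _).
by move=> [b bm <-]; right; exists m, b.
Qed.

Lemma gprincipal_low m e x : (m < e)%N -> gprincipal GA e x m = [set 0].
Proof.
move=> me; apply/seteqP; split=> a; last by move=> ->; left.
by move=> [->//|[l [b [h _ _]]]]; move: me; rewrite -h ltnNge leq_addl.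
Qed.

(** Dimension count in the exact sequence 0 -> (R/(J : x))(-e) -> R/J -> R/(J + xR) -> 0, whose
    first map is multiplication by x. *)
Lemma hilb_colon J e x m : gideal GA J -> GA e x ->
  hilb GA J (m + e)%N =
    (hilb GA (gadjoin GA J e x) (m + e)%N + hilb GA (gcolon GA J e x) m)%N.
Proof.
move=> gJ xe; rewrite /hilb.
have gJx := gideal_adjoin gJ xe.
have sX := gideal_ksub (m + e)%N (gideal_principal xe).
rewrite /kdim (@rdim_trans _ _ _ (gadjoin GA J e x (m + e)%N : set (restr_scalars A^o)));
  [|exact: gaS|exact: gideal_ksub gJx|exact: gideal_ksub gJ|exact: gadjoin_sub
   |by move=> a; apply: gideal_sub gJx|exact: kfin_ga].
congr (_ + _)%N; rewrite /gadjoin /ksum addSC.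
have Jf : kfin (J (m + e)%N : set A^o).
  by apply: fdim_sub (kfin_ga (m + e)) => a; apply: gideal_sub gJ.
have pf : kfin (gprincipal GA e x (m + e)%N : set A^o).
  by apply: fdim_sub (kfin_ga (m + e)) => a; apply: gideal_sub (gideal_principal xe).
rewrite rdim_addSr//; try exact: gideal_ksub gJ.
rewrite gprincipal_img//.
rewrite (rdim_semilinear (V := restr_scalars A^o) (V' := restr_scalars A^o)
  (sigma := id) (phi := fun a : A => a * x) (W := gcolon GA J e x m))//.
- by move=> c; exists c.
- by move=> u v; rewrite mulrDl.
- by move=> c v; apply: (esym (mulrA _ _ _)).
- exact: gaS.
- exact: (gideal_ksub m (gideal_colon gJ xe)).
- exact: gideal_ksub gJ.
- exact: kfin_ga.
- by move=> u um; split=> [[]|].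
Qed.

Lemma hilb_adjoin_low J e x m : gideal GA J -> GA e x -> (m < e)%N ->
  hilb GA J m = hilb GA (gadjoin GA J e x) m.
Proof.
move=> gJ xe me; rewrite /hilb /gadjoin gprincipal_low//; congr kdim.
apply/seteqP; split=> [|_ [u [_ [Ju -> ->]]]]; last by rewrite addr0.
exact: (@addSl k (restr_scalars A^o)) subsp_set0.
Qed.

Lemma gcolon_prime P e x : hprime GA P -> GA e x -> ~ P e x -> gcolon GA P e x = P.
Proof.
move=> [gP P1 hP] xe Px; apply: gsub_anti; last exact: gcolon_sub.
by move=> i a [ai /(hP _ _ _ _ ai xe)[]].
Qed.

Lemma hprime_gideal P : hprime GA P -> gideal GA P.
Proof. by case. Qed.

Lemma gideal_GA1 J : gideal GA J -> (forall a, GA 1%N a -> J 1%N a) ->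
  forall m a, GA m.+1 a -> J m.+1 a.
Proof.
move=> gJ h m a; have [s [X [X1 XS]]] := ga_gen F.
move=> /XS[b [bm ->]]; apply: (ksub_sum (U := J m.+1 : set A^o)).
  exact: gideal_ksub.
by move=> j _; rewrite -[m.+1]addn1; apply: gideal_mul => //; apply: h.
Qed.

Lemma gideal_scal J (c : k) : gideal GA J -> c != 0 -> J 0%N c%:A -> J 0%N 1.
Proof.
move=> gJ c0 Jc; have := gideal_mul gJ (scal_GA0 c^-1) Jc.
by rewrite -scalerAl mul1r scalerA mulVf// scale1r.
Qed.

(** The homogeneous maximal ideal. It lies strictly above every homogeneous prime that misses a
    linear form and so supplies one more link of a chain. *)
Definition girrelevant : nat -> set A := fun i => if i is 0%N then [set 0] else GA i.

Lemma hprime_irrelevant : hprime GA girrelevant.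
Proof.
have irr_sub : gsub girrelevant GA by move=> [|i] a //= ->; apply: ksub0 (gaS 0).
have irr0 i : girrelevant i 0 by case: i => //= i; apply: ksub0 (gaS _).
split.
- split=> //; split=> [[|i]|i j a b ai bj].
  + exact: (@subsp_set0 k (restr_scalars A^o)).
  + exact: gaS.
  + case: i j ai bj => [|i] [|j] ai bj.
    * by rewrite bj scaler0.
    * exact: (gaM ai bj).
    * by rewrite bj scaler0.
    * exact: (gaM ai bj).
- by move=> /= /eqP; rewrite oner_eq0.
- move=> [|i] [|j] a b ai bj /= h; rewrite /=; [|by right|by left|by left].
  have [c ec] := ga_zero F ai.
  have [c0|c0] := eqVneq c 0; first by left; rewrite ec c0 scale0r.
  right; have : c^-1%:A * (a * b) = 0 by rewrite h mulr0.
  by rewrite ec mulrA -scalerAl mul1r scalerA mulVf// scale1r mul1r.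
Qed.

(** This says that R/J has dimension at most h, tested on homogeneous primes only. *)
Definition chain_bound h J := forall n (P : nat -> nat -> set A),
  (forall i, (i <= n)%N -> hprime GA (P i)) ->
  (forall i, (i < n)%N -> gproper (P i) (P i.+1)) -> gsub J (P 0%N) -> (n <= h)%N.

Lemma chain_bound_sub h J K : gsub J K -> chain_bound h J -> chain_bound h K.
Proof. by move=> JK hJ n P P1 P2 KP; apply: hJ P1 P2 _; apply: gsub_trans KP. Qed.

Lemma chain_bound_prime h P0 K : hprime GA P0 -> gproper P0 K ->
  chain_bound h.+1 P0 -> chain_bound h K.
Proof.
move=> pP0 [PK PK'] hP n P P1 P2 KP; rewrite -ltnS.
apply: (hP _ (fun i => if i is i'.+1 then P i' else P0)) => //.
- by case=> // i; apply: P1.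
- case=> [_|i]; last exact: P2.
  by split; [apply: gsub_trans KP|move=> h'; apply: PK'; apply: gsub_trans h'].
- by move=> i z.
Qed.

(** Induction on h and, inside it, Noetherian induction on J. If a b lies in J but neither factor
    does, the colon sequence for a reduces J to two larger ideals. If J is prime and misses a linear
    form x, then (J : x) = J, and the increments of the Hilbert function are the Hilbert function of
    R/(J + xR), which has smaller dimension. *)
Lemma hilb_evpoly h J : gideal GA J -> chain_bound h J -> evpoly h (hilb GA J).
Proof.
move: J; elim: h => [|h IHh]; apply: (ga_noeth F) => J gJ IHJ cJ.
all: have [J1|J1] := pselect (J 0%N 1).
1, 3: apply: evpoly0; exists 0%N => m _; rewrite (gideal1 gJ J1);
  by apply: rdim_eq0 => //; apply: gaS.
all: have [pJ|/hprimeN-/(_ gJ J1)] := pselect (hprime GA J); last first.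
1, 3: move=> [i [j [a [b [ai bj Jab Ja Jb]]]]].
1, 2: have /IHJ hadj := gideal_adjoin gJ ai; have /IHJ hcol := gideal_colon gJ ai.
1, 2: apply: (@evpoly_ext _ (fun m => hilb GA (gadjoin GA J i a) m +
         hilb GA (gcolon GA J i a) (m - i))%N);
  [exists i => m im; by rewrite -{1 3}(subnK im) (hilb_colon _ gJ ai)|].
1, 2: apply: evpolyD; last apply: evpoly_shift.
1, 3: by apply: hadj; [apply: gadjoin_proper|apply: chain_bound_sub cJ; apply: gadjoin_sub].
1, 2: apply: hcol; last (by apply: chain_bound_sub cJ; apply: gcolon_sub);
  split; [exact: gcolon_sub|move=> h'; apply: Jb; apply: h'; split=> //];
  by rewrite addnC mulrC.
(* A prime that contains all linear forms leaves a quotient concentrated in degree 0. *)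
all: have [hx|/existsNP[x /not_implyP[x1 Jx]]] := pselect (forall a, GA 1%N a -> J 1%N a).
1, 3: apply: evpoly0; exists 1%N => -[//|m] _;
  by apply: rdim_eq0; [exact: gideal_ksub|move=> a; apply: gideal_GA1].
(* For h = 0 the chain formed by [J] and the irrelevant ideal is already too long. *)
- suff : (1 <= 0)%N by [].
  apply: (cJ _ (fun i => if i is 0%N then J else girrelevant)); last by move=> i z.
    by case=> // i _; apply: hprime_irrelevant.
  case=> // _; split; last by move=> h; apply/Jx/h.
  case=> [|i] a //=; last exact: gideal_sub.
  move=> Ja; have [c ec] := ga_zero F (gideal_sub gJ Ja).
  have [c0|c0] := eqVneq c 0; first by rewrite ec c0 scale0r.
  by case: J1; apply: (gideal_scal gJ c0); rewrite -ec.
- have gJx := gideal_adjoin gJ x1.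
  have : evpoly h (hilb GA (gadjoin GA J 1 x)).
    by apply: IHh => //; apply: (chain_bound_prime pJ) => //; apply: gadjoin_proper.
  move=> /evpoly_sum; apply; exists 0%N => m _.
  by rewrite -addn1 (hilb_colon _ gJ x1) gcolon_prime// addnC.
Qed.

Lemma hilb_evpoly_dim J : gideal GA J -> evpoly d (hilb GA J).
Proof.
move=> gJ; apply: hilb_evpoly => // n P P1 P2 _.
exact: ga_dim F _ _ P1 P2.
Qed.

End GradedRing.

(** * Primes of maximal dimension *)

Section BigPrimes.
Context {k : fieldType} {A : comAlgType k} (GA : nat -> set A) (D : nat).
Context (F : graded_facts GA D.+2).
Implicit Types (J K P Q : nat -> set A) (a b x : A).

(* As [D.+2] is the dimension of the ring, [big] primes are those of maximal
   dimension. *)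
Definition small J := exists C, forall m, (hilb GA J m <= C * m.+1 ^ D)%N.
Definition big P := hprime GA P /\ ~ small P.

Lemma hilb_le J K m : gideal GA J -> gideal GA K -> gsub J K ->
  (hilb GA K m <= hilb GA J m)%N.
Proof.
move=> gJ gK JK; apply: rdim_subr => //; [exact: gideal_ksub gJ|exact: gideal_ksub gK|].
exact: kfin_ga F m.
Qed.

Lemma small_sub J K : gideal GA J -> gideal GA K -> gsub J K -> small J -> small K.
Proof.
move=> gJ gK JK [C hC]; exists C => m.
by apply: leq_trans (hC m); apply: hilb_le.
Qed.

Lemma small_GA : small GA.
Proof. by exists 0%N => m; rewrite /hilb /kdim rdim_eq0//; apply: gaS F m. Qed.

Lemma small_colon J e x : gideal GA J -> GA e x -> small (gadjoin GA J e x) ->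
  small (gcolon GA J e x) -> small J.
Proof.
move=> gJ xe [C hC] [C' hC']; exists (C + C')%N => m; rewrite mulnDl.
case: (leqP e m) => em; last first.
  by rewrite (hilb_adjoin_low gJ xe em) (leq_trans (hC _))// leq_addr.
rewrite -(subnK em) (hilb_colon F _ gJ xe) leq_add//.
by rewrite (leq_trans (hC' _))// leq_mul2l leq_exp2 ?orbT//; lia.
Qed.

(** For x in K outside P one has (P : x) = P, so the Hilbert function of R/(P + xR) is a difference
    of that of R/P and its polynomial loses a degree. *)
Lemma small_proper P K : hprime GA P -> gideal GA K -> gproper P K -> small K.
Proof.
move=> pP gK PK; have gP := hprime_gideal pP.
have [e [x [Kx Px]]] := gproper_ex PK.
have xe := gideal_sub gK Kx.
apply: (small_sub (gideal_adjoin F gP xe)) => //.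
  by apply: gadjoin_min => //; case: PK.
apply: evpoly_bound; apply: (evpoly_diff (e := e) (hilb_evpoly_dim F gP)).
exists e => m em; rewrite -{1 3}(subnK em) (hilb_colon F _ gP xe) addnC.
by rewrite (gcolon_prime pP xe Px).
Qed.

Lemma big_prime_sub P Q : big Q -> hprime GA P -> gsub P Q -> P = Q.
Proof.
move=> [pQ nQ] pP PQ; apply: contrapT => ne; apply: nQ.
by apply: (small_proper pP (hprime_gideal pQ)); apply: gsub_proper.
Qed.

Lemma hprime_exp P i a n : hprime GA P -> GA i a -> ~ P i a -> ~ P (i * n)%N (a ^+ n).
Proof.
move=> [gP P1 hP] ai Pa; elim: n => [|n IH]; first by rewrite muln0.
rewrite mulnS exprS => /(hP _ _ _ _ ai (ga_exp F n ai))[]//.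
Qed.

(** Otherwise the Hilbert function of R/P would vanish in positive degrees. *)
Lemma big_GA1 P : big P -> exists x, GA 1%N x /\ ~ P 1%N x.
Proof.
move=> [pP nP]; apply: contrapT => h; apply: nP.
exists (hilb GA P 0%N) => -[|m]; first by rewrite leq_pmulr// expn_gt0.
rewrite [X in (X <= _)%N](_ : _ = 0%N)//; apply: rdim_eq0.
  exact: gideal_ksub (hprime_gideal pP).
move=> a; apply: (gideal_GA1 F (hprime_gideal pP)) => {}a a1.
by apply: contrapT => Pa; apply: h; exists a.
Qed.

(** A quotient of maximal dimension has an associated prime of maximal dimension. If a b lies in J
    and neither factor does, then either (J : a) is not small and the induction applies to it, or J
    + aR is not small. In the latter case a big colon Q of J + aR by r becomes one of J when r is
    multiplied by an element c of (J : a) outside Q, because c carries J + aR into J. *)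
Lemma big_colon J : gideal GA J -> ~ small J ->
  exists e r, GA e r /\ big (gcolon GA J e r).
Proof.
move: J; apply: (ga_noeth F) => J gJ IH nJ.
have [J1|J1] := pselect (J 0%N 1).
  by case: nJ; rewrite (gideal1 gJ J1); apply: small_GA.
have [pJ|/hprimeN-/(_ gJ J1)] := pselect (hprime GA J).
  exists 0%N, 1; split; first exact: ga1 F.
  rewrite (_ : gcolon _ _ _ _ = J)//; apply: gcolon_prime => //; exact: ga1 F.
move=> [i [j [a [b [ai bj Jab Ja Jb]]]]].
have gcol := gideal_colon F gJ ai; have gadj := gideal_adjoin F gJ ai.
have [scol|ncol] := pselect (small (gcolon GA J i a)); last first.
  have pcol : gproper J (gcolon GA J i a).
    split; first exact: gcolon_sub.
    by move=> h; apply: Jb; apply: h; split=> //; rewrite addnC mulrC.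
  have [e [r [re bQ]]] := IH _ gcol pcol ncol.
  exists (e + i)%N, (r * a); split; first exact: (gaM F re ai).
  rewrite (_ : gcolon _ _ _ _ = gcolon GA (gcolon GA J i a) e r)//.
  apply/funext => l; apply/seteqP; split=> c [cl h]; split=> //.
    by split; [apply: (gaM F cl re)|rewrite -addnA -mulrA].
  by case: h => _; rewrite -addnA -mulrA.
have nadj : ~ small (gadjoin GA J i a) by move=> h; apply: nJ; apply: small_colon h scol.
have [e [r [re bQ]]] := IH _ gadj (gadjoin_proper F gJ ai Ja) nadj.
have [pQ nQ] := bQ; set Q := gcolon _ _ _ _ in bQ pQ nQ.
have [t [c [[ct Jca] Qc]]] : exists t c, gcolon GA J i a t c /\ ~ Q t c.
  apply: contrapT => h; apply: nQ; apply: small_sub scol => //.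
    exact: hprime_gideal.
  by move=> t c hc; apply: contrapT => Qc; apply: h; exists t, c.
exists (t + e)%N, (c * r); split; first exact: (gaM F ct re).
rewrite (_ : gcolon _ _ _ _ = Q)//; apply: gsub_anti => l s [sl hs].
  have : Q (l + t)%N (s * c).
    split; first exact: (gaM F sl ct).
    by apply: (gadjoin_sub F gJ ai); rewrite -addnA -mulrA.
  by case: pQ => _ _ hQ /(hQ _ _ _ _ sl ct)[].
split=> //; case: hs => u [w [Ju hw e1]].
rewrite mulrCA e1 mulrDr (_ : (l + (t + e) = t + (l + e))%N); last lia.
apply: ksubD (gideal_ksub _ gJ) _ _; first exact: gideal_mul ct Ju.
case: hw => [->|[l' [b' [el b'l ->]]]].
  by rewrite mulr0; apply: ksub0 (gideal_ksub _ gJ).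
rewrite mulrCA -el (_ : (t + (l' + i) = l' + (t + i))%N); last lia.
exact: (gideal_mul gJ b'l Jca).
Qed.

(** If a b lies in J, every prime above J lies above J + aR or J + bR. *)
Lemma primes_finite J : gideal GA J -> exists n (L : 'I_n -> nat -> set A),
  (forall i, hprime GA (L i)) /\
  forall Q, hprime GA Q -> gsub J Q -> exists i, gsub (L i) Q.
Proof.
move: J; apply: (ga_noeth F) => J gJ IH.
have [J1|J1] := pselect (J 0%N 1).
  exists 0%N, (fun=> J); split=> [[]//|Q [_ Q1 _] /(_ _ _ J1)//].
have [pJ|/hprimeN-/(_ gJ J1)] := pselect (hprime GA J).
  by exists 1%N, (fun=> J); split=> // Q _ JQ; exists ord0.
move=> [i [j [a [b [ai bj Jab Ja Jb]]]]].
have [n [L [pL hL]]] := IH _ (gideal_adjoin F gJ ai) (gadjoin_proper F gJ ai Ja).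
have [m [L' [pL' hL']]] := IH _ (gideal_adjoin F gJ bj) (gadjoin_proper F gJ bj Jb).
exists (n + m)%N, (fcat L L'); split.
  by move=> l; rewrite /fcat; case: (fintype.split l).
move=> Q pQ JQ; have [gQ _ hQ] := pQ.
have [Qa|Qb] := hQ _ _ _ _ ai bj (JQ _ _ Jab).
  have [l hl] := hL _ pQ (gadjoin_min gQ JQ Qa).
  by exists (lshift _ l); rewrite fcatl.
have [l hl] := hL' _ pQ (gadjoin_min gQ JQ Qb).
by exists (rshift _ l); rewrite fcatr.
Qed.

Lemma prime_not_inter n (L : 'I_n -> nat -> set A) P : hprime GA P ->
  (forall i, gideal GA (L i) /\ ~ gsub (L i) P) ->
  exists t z, [/\ GA t z, ~ P t z & forall i, L i t z].
Proof.
move=> pP; have [gP P1 hP] := pP.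
elim: n L => [|n IH] L hL.
  by exists 0%N, 1; split=> [||[]//]; first exact: ga1 F.
have [t [z [zt Pz Lz]]] := IH (fun i => L (lift ord0 i)) (fun i => hL _).
have [g0 n0] := hL ord0.
have [t' [z' [Lz' Pz']]] : exists t' z', L ord0 t' z' /\ ~ P t' z'.
  apply: contrapT => h; apply: n0 => t' z' hz; apply: contrapT => hz'.
  by apply: h; exists t', z'.
have zt' := gideal_sub g0 Lz'.
exists (t + t')%N, (z * z'); split; first exact: (gaM F zt zt').
  by move=> /(hP _ _ _ _ zt zt')[].
move=> i; case: (unliftP ord0 i) => [i'|] ->; last exact: (gideal_mul g0 zt Lz').
by apply: (gideal_mulr (hL (lift ord0 i')).1 zt' (Lz i')).
Qed.

(** Prime avoidance in every large degree, over a field of any size. If y falls into the additional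
    prime, it is corrected by z x^(e - t), where z, of degree t, lies in the other big primes but
    not in this one and x is a linear form outside it. Such a z exists because distinct big primes
    are incomparable. *)
Lemma big_avoid n (L : 'I_n -> nat -> set A) : exists N, forall e, (N <= e)%N ->
  exists y, GA e y /\ forall i, big (L i) -> ~ L i e y.
Proof.
elim: n L => [|n IH] L.
  exists 0%N => e _; exists 0; split=> [|[]//].
  exact: ksub0 (gaS F e).
have [N hN] := IH (fun i => L (lift ord0 i)).
have [b0|nb0] := pselect (big (L ord0)); last first.
  exists N => e /hN[y [ye hy]]; exists y; split=> // i.
  by case: (unliftP ord0 i) => [i'|] -> //; apply: hy.
have [[i0 e0]|ne0] := pselect (exists i, L (lift ord0 i) = L ord0).
  exists N => e /hN[y [ye hy]]; exists y; split=> // i.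
  case: (unliftP ord0 i) => [i'|] ->; first exact: hy.
  by rewrite -e0; apply: hy.
(* Primes that are not big need not be avoided and are replaced by the whole ring. *)
pose L' i := if `[< big (L (lift ord0 i)) >] then L (lift ord0 i) else GA.
have [p0 n0] := b0; have [g0 P1 hP] := p0.
have [t [z [zt Pz Lz]]] : exists t z, [/\ GA t z, ~ L ord0 t z & forall i, L' i t z].
  apply: prime_not_inter => // i; rewrite /L'; case: asboolP => bi; last first.
    split; first exact: gideal_GA F.
    by move=> h; apply: P1; apply: h; apply: ga1 F.
  split; first by case: bi => /hprime_gideal.
  by move=> h; apply: ne0; exists i; apply: big_prime_sub => //; case: bi.
have [x [x1 Px]] := big_GA1 b0.
exists (N + t)%N => e hNe; have [|y [ye hy]] := hN e; first lia.
have [Py|Py] := pselect (L ord0 e y); last first.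
  exists y; split=> // i.
  by case: (unliftP ord0 i) => [i'|] -> //; apply: hy.
pose w := z * x ^+ (e - t).
have ee : e = (t + 1 * (e - t))%N by lia.
have we : GA e w.
  by rewrite /w {1}ee; apply: (gaM F zt (ga_exp F _ x1)).
exists (y + w); split; first exact: ksubD (gaS F e) ye we.
move=> i; case: (unliftP ord0 i) => [i'|] -> bi hyw; last first.
  have := ksubB (gideal_ksub e g0) hyw Py; rewrite addrAC subrr add0r.
  rewrite /w {1}ee.
  move=> /(hP _ _ _ _ zt (ga_exp F _ x1))[//|].
  exact: hprime_exp.
have gi := hprime_gideal bi.1.
apply: (hy i' bi); rewrite -(addrK w y).
apply: (ksubB (gideal_ksub e gi) hyw).
have := Lz i'; rewrite /L' asboolT// => Lzi.
rewrite /w {1}ee.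
exact: (gideal_mulr gi (ga_exp F _ x1) Lzi).
Qed.

Lemma gideal0 : gideal GA (fun=> [set 0]).
Proof.
split=> [|i _ ->]; last exact: ksub0 (gaS F i).
split=> [i|i j a _ _ ->]; first exact: (@subsp_set0 k (restr_scalars A^o)).
by rewrite scaler0.
Qed.

(** Big primes are minimal, hence all occur in a finite list of primes above the zero ideal. *)
Lemma big_avoid_all : exists N, forall e, (N <= e)%N ->
  exists y, GA e y /\ forall Q, big Q -> ~ Q e y.
Proof.
have [n [L [pL hL]]] := primes_finite gideal0.
have [N hN] := big_avoid L; exists N => e /hN[y [ye hy]].
exists y; split=> // Q bQ; have [i LQ] : exists i, gsub (L i) Q.
  apply: hL; first by case: bQ.
  by move=> i _ ->; apply: ksub0 (gideal_ksub _ (hprime_gideal bQ.1)).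
by rewrite -(big_prime_sub bQ (pL i) LQ); apply: hy; rewrite (big_prime_sub bQ (pL i) LQ).
Qed.

(** Localized at a big prime Q, which is minimal, R/J is zero or has a nilpotent maximal ideal; c is
    the denominator. The exponent N depends on J only, so that one power of Frobenius will serve all
    Q. *)
Lemma big_nilpotent J : gideal GA J -> exists N, forall Q, big Q ->
  exists t c, [/\ GA t c, ~ Q t c & forall i b, Q i b -> J (t + i * N)%N (c * b ^+ N)].
Proof.
move: J; apply: (ga_noeth F) => J gJ IH.
have [J1|J1] := pselect (J 0%N 1).
  exists 0%N => Q [[gQ Q1 _] _]; exists 0%N, 1; split=> //; first exact: ga1 F.
  by move=> i b _; rewrite muln0 mul1r expr0.
have [pJ|/hprimeN-/(_ gJ J1)] := pselect (hprime GA J).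
  exists 1%N => Q bQ; have [[gQ Q1 _] _] := bQ.
  have [JQ|JQ] := pselect (gsub J Q).
    exists 0%N, 1; split=> //; first exact: ga1 F.
    by move=> i b; rewrite (big_prime_sub bQ pJ JQ) muln1 mul1r.
  have [t [c [Jc Qc]]] : exists t c, J t c /\ ~ Q t c.
    apply: contrapT => h; apply: JQ => t c Jc; apply: contrapT => Qc.
    by apply: h; exists t, c.
  exists t, c; split=> //; first exact: gideal_sub Jc.
  by move=> i b /(gideal_sub gQ) bi; rewrite muln1; apply: (gideal_mulr gJ).
move=> [i [j [a [b [ai bj Jab Ja Jb]]]]].
have [N hN] := IH _ (gideal_adjoin F gJ ai) (gadjoin_proper F gJ ai Ja).
have [|N' hN'] := IH _ (gideal_colon F gJ ai).
  split; first exact: gcolon_sub.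
  by move=> h; apply: Jb; apply: h; split=> //; rewrite addnC mulrC.
exists (N + N')%N => Q bQ; have [[gQ Q1 hQ] _] := bQ.
have [t [c [ct Qc hc]]] := hN Q bQ; have [t' [c' [ct' Qc' hc']]] := hN' Q bQ.
exists (t + t')%N, (c * c'); split; first exact: (gaM F ct ct').
  by move=> /(hQ _ _ _ _ ct ct')[].
move=> l x Qx; have xl := gideal_sub gQ Qx.
rewrite exprD mulrACA (_ : _ + _ = (t + l * N) + (t' + l * N'))%N; last by lia.
have [u [w [Ju hw ->]]] := hc _ _ Qx.
rewrite mulrDl; apply: ksubD (gideal_ksub _ gJ) _ _.
  apply: (gideal_mulr gJ) => //.
  exact: (gaM F ct' (ga_exp F _ xl)).
case: hw => [->|[l' [b' [<- b'l ->]]]].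
  by rewrite mul0r; apply: ksub0 (gideal_ksub _ gJ).
rewrite -mulrA -addnA; apply: (gideal_mul gJ) => //.
by rewrite addnC mulrC; have [] := hc' _ _ Qx.
Qed.

End BigPrimes.

(** * Elements of high degree as combinations of powers of linear forms *)

Section FrobeniusGenerators.
Context {k : fieldType} {A : comAlgType k} (GA : nat -> set A) (d : nat).
Context (F : graded_facts GA d).

Lemma ga_prod (s : nat) (X : 'I_s -> A) (b : 'I_s -> nat) :
  (forall j, GA 1%N (X j)) -> GA (\sum_j b j)%N (\prod_j X j ^+ b j).
Proof.
move=> X1; elim/big_rec2: _ => [|j m x _ h]; first exact: ga1 F.
by have := gaM F (ga_exp F (b j) (X1 j)) h; rewrite mul1n.
Qed.

(* A monomial of degree > s N in s variables is divisible by the N-th power of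
   one of them. *)
Lemma ga_pigeonhole : exists s (X : 'I_s -> A), (forall j, GA 1%N (X j)) /\
  forall N m a, (s * N < m)%N -> GA m a ->
    exists b : 'I_s -> A, (forall j, GA (m - N)%N (b j)) /\ a = \sum_j b j * X j ^+ N.
Proof.
have [s [X [X1 XS]]] := ga_gen F; exists s, X; split=> // N m0 a0 sN am0.
pose T n := [set v | exists b : 'I_s -> A,
  (forall j, GA (n - N)%N (b j)) /\ v = \sum_j b j * X j ^+ N].
have TD n u v : T n u -> T n v -> T n (u + v).
  move=> [b [hb ->]] [c [hc ->]]; exists (fun j => b j + c j); split.
    by move=> j; apply: (ksubD (gaS F _)).
  by rewrite -big_split; apply: eq_bigr => j _; rewrite mulrDl.
have T0 n : T n 0.
  exists (fun=> 0); split; first by move=> j; apply: ksub0 (gaS F _).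
  by rewrite big1// => j _; rewrite mul0r.
(* The claim is generalized to an element times a monomial: linear factors move into the monomial
   one at a time, until the element has degree 0. *)
suff H m a (b : 'I_s -> nat) : GA m a -> (s * N < \sum_j b j + m)%N ->
    T (\sum_j b j + m)%N (a * \prod_j X j ^+ b j).
  have := H m0 a0 (fun=> 0%N) am0; rewrite big1// add0n => /(_ sN).
  by rewrite big1 ?mulr1.
elim: m a b => [|m IH] a b.
  move=> a_0; rewrite addn0 => hb.
  have [j Nb] : exists j, (N <= b j)%N.
    apply: contrapT => /forallNP h; move: hb; rewrite ltnNge => /negP; apply.
    rewrite -[s in (s * _)%N]card_ord -sum_nat_const; apply: leq_sum => j _.
    by case: leqP (h j) => // /ltnW.
  pose b' i := if i == j then (b j - N)%N else b i.
  have sb : (\sum_i b i - N = \sum_i b' i)%N.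
    rewrite (bigD1 j)//= [RHS](bigD1 j)//= {1}/b' eqxx -addnBAC//; congr addn.
    by apply: eq_bigr => i /negPf ij; rewrite /b' ij.
  have pb : \prod_i X i ^+ b i = (\prod_i X i ^+ b' i) * X j ^+ N.
    rewrite (bigD1 j)//= [X in _ = X * _](bigD1 j)//= {1}/b' eqxx mulrAC -exprD subnK//.
    by congr (_ * _); apply: eq_bigr => i /negPf ij; rewrite /b' ij.
  exists (fun i => if i == j then a * \prod_i X i ^+ b' i else 0); split.
    move=> i; case: eqP => _; last exact: ksub0 (gaS F _).
    by rewrite sb -[X in GA X]add0n; apply: (gaM F a_0 (ga_prod b' X1)).
  rewrite pb mulrA [RHS](bigD1 j)//= eqxx [X in _ = _ + X]big1 ?addr0// => i /negPf ->.
  by rewrite mul0r.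
move=> /XS[c [cm ->]] hb; rewrite mulr_suml.
apply: (big_ind (T _)) => [||j _]; [exact: T0|exact: TD|].
pose b' i := (b i + (i == j))%N.
have sb : (\sum_i b i + m.+1 = \sum_i b' i + m)%N.
  have s1 : (\sum_i (i == j : nat) = 1)%N.
    by rewrite (bigD1 j)//= eqxx big1// => i /negPf ->.
  by rewrite /b' big_split /= s1 addn1 addSnnS.
rewrite sb -mulrA (_ : X j * _ = \prod_i X i ^+ b' i).
  by apply: IH => //; rewrite -sb.
rewrite /b'; under [RHS]eq_bigr do rewrite exprD.
rewrite big_split /= mulrC; congr (_ * _).
by rewrite [RHS](bigD1 j)//= eqxx big1 ?mulr1// => i /negPf ->.
Qed.

End FrobeniusGenerators.

(** * Dimensions modulo Frobenius powers *)

Section FrobeniusSums.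
Context {k : fieldType} {A : comAlgType k} (GA : nat -> set A).
Implicit Types (fs : seq (nat * A)).

(* Degree [m] component of [f ^ n G], where [f = fn.2] has degree [fn.1]. *)
Definition shiftmul (M : lmodType A) (G : nat -> set M) (fn : nat * A) n m : set M :=
  [set v | v = 0 \/ exists l w, [/\ (l + fn.1 * n)%N = m, G l w & v = fn.2 ^+ n *: w]].

(** When G is M, n is q and [fs] generates I, this is the degree m part of I^[q]M. Summing over a
    list lets the number of generators enter the estimates. *)
Definition fsum (M : lmodType A) (G : nat -> set M) fs n m : set M :=
  foldr (fun fn U => ksum (shiftmul G fn n m) U) [set 0] fs.

(** The module under study is G / N0; carrying the relations [N0] along avoids forming quotients. *)
Definition hdim (M : lmodType A) (G N0 : nat -> set M) fs n m : nat :=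
  kdim (G m) (ksum (N0 m) (fsum G fs n m)).

Definition homog fs := forall fn, fn \in fs -> GA fn.1 fn.2.

Lemma homog_cons fn fs : homog (fn :: fs) -> GA fn.1 fn.2 /\ homog fs.
Proof.
move=> h; split; first by apply: h; rewrite mem_head.
by move=> gn gfs; apply: h; rewrite in_cons gfs orbT.
Qed.

Context (d : nat) (F : graded_facts GA d) (M : lmodType A).
Implicit Types (G W : nat -> set M).

Lemma kscaleA (a : A) (c : k) (v : M) : a *: (c%:A *: v) = c%:A *: (a *: v).
Proof. by rewrite !scalerA mulrC. Qed.

Lemma ksub_ksum (U W : set M) : ksub U -> ksub W -> ksub (ksum U W).
Proof. exact: (@subsp_addS k (restr_scalars M)). Qed.

Lemma ksub_set0 : ksub [set (0 : M)].
Proof. exact: (@subsp_set0 k (restr_scalars M)). Qed.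

Lemma ksum_sub (U W X : set M) : ksub X -> U `<=` X -> W `<=` X -> ksum U W `<=` X.
Proof. exact: (@addS_sub k (restr_scalars M)). Qed.

Lemma ksuml (U W : set M) : ksub W -> U `<=` ksum U W.
Proof. exact: (@addSl k (restr_scalars M)). Qed.

Lemma ksumr (U W : set M) : ksub U -> W `<=` ksum U W.
Proof. exact: (@addSr k (restr_scalars M)). Qed.

Lemma kfin_sub (U W : set M) : U `<=` W -> kfin W -> kfin U.
Proof. exact: (@fdim_sub k (restr_scalars M)). Qed.

Lemma ksum_mono (U U' W W' : set M) : U `<=` U' -> W `<=` W' -> ksum U W `<=` ksum U' W'.
Proof. exact: (@addS_mono k (restr_scalars M)). Qed.

Lemma kfin_set0 : kfin [set (0 : M)].
Proof. exact: (@fdim_set0 k (restr_scalars M)). Qed.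

Lemma kfin_ksum (U W : set M) : kfin U -> kfin W -> kfin (ksum U W).
Proof. exact: (@fdim_addS k (restr_scalars M)). Qed.

Lemma ksub_shiftmul G fn n m : (forall i, ksub (G i)) -> ksub (shiftmul G fn n m).
Proof.
move=> sG; apply: ksubP; first by left.
  move=> u v [->|[l [w [lm Gw ->]]]]; first by rewrite add0r.
  move=> [->|[l' [w' [lm' Gw' ->]]]]; rewrite ?addr0.
    by right; exists l, w.
  right; exists l, (w + w'); split; rewrite ?scalerDr//.
  by apply: ksubD (sG l) Gw _; apply: gmod_eq Gw'; lia.
move=> c u [->|[l [w [lm Gw ->]]]]; first by left; rewrite scaler0.
right; exists l, (c%:A *: w); split; rewrite ?kscaleA//.
exact: ksubZ.
Qed.

Lemma ksub_fsum G fs n m : (forall i, ksub (G i)) -> ksub (fsum G fs n m).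
Proof.
move=> sG; elim: fs => [|fn fs IH] /=; first exact: ksub_set0.
by apply: ksub_ksum => //; apply: ksub_shiftmul.
Qed.

Lemma shiftmul_mono G W fn n m : gsub W G -> shiftmul W fn n m `<=` shiftmul G fn n m.
Proof.
move=> WG v [->|[l [w [lm Gw ->]]]]; first by left.
by right; exists l, w; split=> //; apply: WG.
Qed.

Lemma fsum_mono G W fs n m : gsub W G -> fsum W fs n m `<=` fsum G fs n m.
Proof.
move=> WG; elim: fs => //= fn fs IH.
by apply: ksum_mono => //; apply: shiftmul_mono.
Qed.

Lemma shiftmul_add G W fn n m :
  (forall i, ksub (G i)) -> (forall i, ksub (W i)) ->
  shiftmul (fun i => ksum (G i) (W i)) fn n m = ksum (shiftmul G fn n m) (shiftmul W fn n m).
Proof.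
move=> sG sW; apply/seteqP; split=> v.
  move=> [->|[l [_ [lm [u [w [Gu Ww ->]]] ->]]]].
    exact: ksub0 (ksub_ksum (ksub_shiftmul _ _ _ sG) (ksub_shiftmul _ _ _ sW)).
  exists (fn.2 ^+ n *: u), (fn.2 ^+ n *: w); split; rewrite ?scalerDr//.
    by right; exists l, u.
  by right; exists l, w.
apply: ksum_sub.
- by apply: ksub_shiftmul => i; apply: ksub_ksum.
- by apply: shiftmul_mono => i; apply: ksuml.
- by apply: shiftmul_mono => i; apply: ksumr.
Qed.

Lemma fsum_add G W fs n m : (forall i, ksub (G i)) -> (forall i, ksub (W i)) ->
  fsum (fun i => ksum (G i) (W i)) fs n m = ksum (fsum G fs n m) (fsum W fs n m).
Proof.
move=> sG sW; elim: fs => [|fn fs IH] /=.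
  apply/seteqP; split=> [|_ [u [w [-> -> ->]]]]; last by rewrite addr0.
  by apply: ksuml; apply: ksub_set0.
rewrite IH shiftmul_add//; exact: (@addSACA k (restr_scalars M)).
Qed.

Lemma kdim_trans (U X W : set M) : ksub U -> ksub X -> ksub W -> W `<=` X -> X `<=` U ->
  kfin U -> kdim U W = (kdim U X + kdim X W)%N.
Proof. exact: (@rdim_trans k (restr_scalars M)). Qed.

Lemma kdim_subl (U U' W : set M) : ksub W -> kfin U' -> U `<=` U' ->
  (kdim U W <= kdim U' W)%N.
Proof. exact: (@rdim_subl k (restr_scalars M)). Qed.

Lemma kdim_subr (U W W' : set M) : ksub W -> ksub W' -> kfin U -> W `<=` W' ->
  (kdim U W' <= kdim U W)%N.
Proof. exact: (@rdim_subr k (restr_scalars M)). Qed.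

Lemma kdim_ksum_le (U U' W : set M) : ksub U -> ksub U' -> ksub W -> kfin U -> kfin U' ->
  (kdim (ksum U U') W <= kdim U W + kdim U' W)%N.
Proof. exact: (@rdim_addS_le k (restr_scalars M)). Qed.

Lemma kdim_ksumr (U X W : set M) : ksub U -> ksub X -> ksub W -> X `<=` W ->
  kfin U -> kfin X -> kdim (ksum U X) W = kdim U W.
Proof. exact: (@rdim_addSr k (restr_scalars M)). Qed.

Lemma kdim_eq0 (U W : set M) : ksub W -> U `<=` W -> kdim U W = 0%N.
Proof. exact: (@rdim_eq0 k (restr_scalars M)). Qed.

Lemma kdim_eq_ext (U W W' : set M) : (forall u, U u -> (W u <-> W' u)) -> ksub U ->
  kdim U W = kdim U W'.
Proof. exact: (@rdim_eq_ext k (restr_scalars M)). Qed.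

Lemma shiftmul_img G fn n l :
  ksub (G l) -> shiftmul G fn n (l + fn.1 * n)%N = [set fn.2 ^+ n *: w | w in G l].
Proof.
move=> sG; apply/seteqP; split=> v.
  move=> [->|[l' [w [/addIn e Gw ->]]]].
    by exists 0; rewrite ?scaler0//; apply: ksub0.
  by exists w => //; rewrite -e.
by move=> [w Gw <-]; right; exists l, w.
Qed.

Lemma shiftmul_low G fn n m : (m < fn.1 * n)%N -> shiftmul G fn n m = [set 0].
Proof.
move=> hm; apply/seteqP; split=> v; last by move=> ->; left.
by move=> [->//|[l [w [e _ _]]]]; move: hm; rewrite -e ltnNge leq_addl.
Qed.

Lemma kfin_img (a : A) (U : set M) : kfin U -> kfin [set a *: w | w in U].
Proof.
apply: (@fdim_semilinear k (restr_scalars M) (restr_scalars M) id) => [u v|c v].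
  exact: (@scalerDr A M a u v).
exact: (kscaleA a c v).
Qed.

Lemma kdim_img (a : A) (U W : set M) : ksub U -> ksub W -> kfin U ->
  (kdim [set a *: w | w in U] [set a *: w | w in W] <= kdim U W)%N.
Proof.
move=> sU sW fU.
have hD : forall u v : restr_scalars M, a *: (u + v : M) = a *: (u : M) + a *: (v : M).
  by move=> u v; apply: (@scalerDr A M a u v).
have hZ : forall (c : k) (v : restr_scalars M),
    a *: (c *: v : restr_scalars M) = c *: (a *: (v : M) : restr_scalars M) :> M.
  by move=> c v; apply: (kscaleA a c v).
have sI : ksub [set a *: w | w in W].
  by apply: (@subsp_semilinear k (restr_scalars M) (restr_scalars M) id _ W _ hD hZ sW) => c; exists c.
rewrite /kdim.
rewrite (@rdim_semilinear k (restr_scalars M) (restr_scalars M) id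
   (fun w : M => a *: w) U ((fun w : M => a *: w) @^-1` [set a *: w | w in W]))//.
- apply: (@rdim_subr k (restr_scalars M)) => //.
    exact: (@subsp_preimage k (restr_scalars M) (restr_scalars M) id _ _ hD hZ sI).
  by move=> w Ww; exists w.
- by move=> c; exists c.
- exact: (@subsp_preimage k (restr_scalars M) (restr_scalars M) id _ _ hD hZ sI).
Qed.

Lemma kfin_shiftmul G fn n m : (forall i, ksub (G i)) -> (forall i, kfin (G i)) ->
  kfin (shiftmul G fn n m).
Proof.
move=> sG fG; case: (leqP (fn.1 * n) m) => hm; last first.
  by rewrite shiftmul_low//; apply: kfin_set0.
by rewrite -(subnK hm) shiftmul_img//; apply: kfin_img.
Qed.

Lemma kfin_fsum G fs n m : (forall i, ksub (G i)) -> (forall i, kfin (G i)) ->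
  kfin (fsum G fs n m).
Proof.
move=> sG fG; elim: fs => [|fn fs IH] /=; first exact: kfin_set0.
by apply: kfin_ksum => //; apply: kfin_shiftmul.
Qed.

(** Each generator contributes at most the dimension of G / W in a single degree, since
    multiplication by f^n cannot increase dimensions. The exponent does not enter the bound, and the
    uniformity in n of all later errors rests on this. *)
Lemma kdim_fsum_le G W fs n m E : (forall i, ksub (G i)) -> (forall i, ksub (W i)) ->
  gsub W G -> (forall i, kfin (G i)) ->
  (forall l, (l <= m)%N -> (kdim (G l) (W l) <= E)%N) ->
  (kdim (fsum G fs n m) (fsum W fs n m) <= size fs * E)%N.
Proof.
move=> sG sW WG fG hE; elim: fs => [|fn fs IH].
  by rewrite kdim_eq0//; apply: ksub_set0.
have sWf := ksub_fsum fs n m sW; have sWs := ksub_shiftmul fn n m sW.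
rewrite /= (leq_trans (kdim_ksum_le _ _ _ _ _))//.
- exact: ksub_shiftmul.
- exact: ksub_fsum.
- exact: ksub_ksum.
- exact: kfin_shiftmul.
- exact: kfin_fsum.
rewrite mulSn leq_add//.
  rewrite (leq_trans (kdim_subr sWs _ (kfin_shiftmul _ _ _ sG fG) (ksuml sWf)))//.
    exact: ksub_ksum.
  case: (leqP (fn.1 * n) m) => hm; last by rewrite shiftmul_low// kdim_eq0// => _ ->; left.
  rewrite -(subnK hm) !shiftmul_img// (leq_trans (kdim_img _ _ _ _))//.
  by apply: hE; rewrite leq_subr.
rewrite (leq_trans (kdim_subr sWf _ (kfin_fsum _ _ _ sG fG) (ksumr sWs)))//.
exact: ksub_ksum.
Qed.

(* [W] need not be a submodule: stability under the operators [f ^ n] suffices. *)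
Lemma hdim_compare G W N0 fs n m E :
  (forall i, ksub (G i)) -> (forall i, ksub (W i)) -> (forall i, ksub (N0 i)) ->
  gsub W G -> gsub N0 W -> (forall i, kfin (G i)) ->
  fsum G fs n m `<=` G m -> fsum W fs n m `<=` W m ->
  (forall l, (l <= m)%N -> (kdim (G l) (W l) <= E)%N) ->
  (hdim G N0 fs n m <= hdim W N0 fs n m + E)%N /\
  (hdim W N0 fs n m <= hdim G N0 fs n m + size fs * E)%N.
Proof.
move=> sG sW s0 WG NW fG fsG fsW hE.
have NG := gsub_trans NW WG.
have sWf := ksub_fsum fs n m sW; have sGf := ksub_fsum fs n m sG.
have fGf := kfin_fsum fs n m sG fG.
have fN i : kfin (N0 i) by apply: kfin_sub (fG i); apply: NG.
set XG := ksum (N0 m) (fsum G fs n m); set XW := ksum (N0 m) (fsum W fs n m).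
have sXG : ksub XG by apply: ksub_ksum.
have sXW : ksub XW by apply: ksub_ksum.
(* The dimension of [G m] modulo [XW] is computed twice, through [XG] and through [W m]. *)
have e1 : kdim (G m) XW = (kdim (G m) XG + kdim XG XW)%N.
  apply: kdim_trans => //; last by apply: ksum_sub => //; apply: NG.
  by apply: ksum_mono => //; apply: fsum_mono.
have e2 : kdim (G m) XW = (kdim (G m) (W m) + hdim W N0 fs n m)%N.
  by apply: kdim_trans => //; apply: ksum_sub => //; apply: NW.
have e3 : (kdim XG XW <= size fs * E)%N.
  rewrite (leq_trans (kdim_ksum_le _ _ _ _ _))//.
  rewrite [X in (X + _)%N]kdim_eq0//; last exact: ksuml.
  rewrite add0n (leq_trans (kdim_subr sWf _ _ (ksumr _)))//.
  exact: kdim_fsum_le.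
have e4 := hE m (leqnn m).
by rewrite /hdim -/XG -/XW in e2 *; lia.
Qed.

End FrobeniusSums.

(** * Filtrations of Frobenius pushforwards *)

Section TwistedSubmodules.
Context {k : fieldType} {A : comAlgType k} (GA : nat -> set A) (D : nat).
Context (F : graded_facts GA D.+2).
Context (q : nat) (q_gt0 : (0 < q)%N).
Context (frobD : forall a b : A, (a + b) ^+ q = a ^+ q + b ^+ q).
Context (frob_surj : forall c : k, exists b, b ^+ q = c).
Context (tau : nat) (y : A).
Let delta := (tau * q + 1)%N.
Context (y_delta : GA delta y).
Context (M : lmodType A) (G N0 : nat -> set M).
Context (gG : gmod GA G) (gN : gmod GA N0) (NG : gsub N0 G) (fG : forall i, kfin (G i)).
Implicit Types (W : nat -> set M) (v w : M) (fs : seq (nat * A)).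

(* Submodules for the action of [A] through the [q]-th power map, which are
   moreover stable under multiplication by [y]. *)
Definition twisted W := [/\ forall i, ksub (W i), gsub N0 W, gsub W G,
  forall i j a v, GA i a -> W j v -> W (i * q + j)%N (a ^+ q *: v)
  & forall j v, W j v -> W (delta + j)%N (y *: v)].

(** The annihilator of v in G / W for the twisted action. *)
Definition tann W a v : nat -> set A :=
  fun l => [set r | GA l r /\ W (l * q + a)%N (r ^+ q *: v)].

Definition tmul i w (r : A) : M := r ^+ q *: (y ^+ i *: w).

(* Since [delta] is 1 modulo [q], the degree determines [i], so that each degree
   of a block is a copy of a single component of the ring. *)
Definition block a w : nat -> set M := fun m =>
  [set v | v = 0 \/ exists i l r, [/\ (i < q)%N, (a + i * delta + l * q)%N = m,
     GA l r & v = tmul i w r]].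

Lemma tmulD i w r s : tmul i w (r + s) = tmul i w r + tmul i w s.
Proof. by rewrite /tmul frobD scalerDl. Qed.

Lemma scalX (c : k) n : (c%:A : A) ^+ n = (c ^+ n)%:A.
Proof. by rewrite exprZn expr1n. Qed.

Lemma tmulZ i w (c : k) (r : A) : tmul i w (c%:A * r) = (c ^+ q)%:A *: tmul i w r.
Proof. by rewrite /tmul exprMn scalX -scalerA. Qed.

Lemma tmul0 i w : tmul i w 0 = 0.
Proof. by rewrite /tmul expr0n eqn0Ngt q_gt0 mulr0n scale0r. Qed.

Lemma tmulM i w r s : tmul i w (s * r) = s ^+ q *: tmul i w r.
Proof. by rewrite /tmul exprMn -scalerA. Qed.

Lemma tmulB i w r s : tmul i w (r - s) = tmul i w r - tmul i w s.
Proof. by apply: (addIr (tmul i w s)); rewrite -tmulD !subrK. Qed.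

Lemma kdim_tmul i w (U W : set A) (W' : set M) :
  ksub (U : set A^o) -> ksub (W : set A^o) -> ksub W' -> kfin (U : set A^o) ->
  (forall u, U u -> (W u <-> W' (tmul i w u))) ->
  kdim (tmul i w @` U) W' = kdim (U : set A^o) W.
Proof.
move=> sU sW sW' fU h.
apply: (@rdim_semilinear k (restr_scalars A^o) (restr_scalars M) (fun c => c ^+ q)) => //.
- by rewrite expr0n eqn0Ngt q_gt0.
- exact: tmulD.
- exact: tmulZ.
Qed.

Lemma ksub_tmul i w (U : set A) : ksub (U : set A^o) -> ksub (tmul i w @` U).
Proof.
apply: (@subsp_semilinear k (restr_scalars A^o) (restr_scalars M) (fun c => c ^+ q)) => //.
- exact: tmulD.
- exact: tmulZ.
Qed.

Lemma kfin_tmul i w (U : set A) : kfin (U : set A^o) -> kfin (tmul i w @` U).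
Proof.
apply: (@fdim_semilinear k (restr_scalars A^o) (restr_scalars M) (fun c => c ^+ q)) => //.
- exact: tmulD.
- exact: tmulZ.
Qed.

Lemma gideal_tann W a v : (forall i, ksub (W i)) ->
  (forall i j a v, GA i a -> W j v -> W (i * q + j)%N (a ^+ q *: v)) ->
  gideal GA (tann W a v).
Proof.
move=> sW tW; split=> [|l r []//]; split=> [l|i j r s ri [sj Ws]].
  apply: ksubP.
  - split; first exact: ksub0 (gaS F l).
    by rewrite expr0n eqn0Ngt q_gt0 mulr0n scale0r; apply: ksub0.
  - move=> r s [rl Wr] [sl Ws]; split; first exact: (ksubD (gaS F l)).
    by rewrite frobD scalerDl; apply: ksubD.
  - move=> c r [rl Wr]; split; first exact: (ksubZ c (gaS F l) rl).
    by rewrite exprMn scalX -scalerA; apply: ksubZ.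
split; first exact: (gaM F ri sj).
by rewrite exprMn -scalerA mulnDl -addnA; apply: tW.
Qed.

(** Modulo q the degree is a + i; this determines i, and then l. *)
Lemma block_index_uniq a i i' l l' : (i < q)%N -> (i' < q)%N ->
  (a + i * delta + l * q)%N = (a + i' * delta + l' * q)%N -> i = i' /\ l = l'.
Proof.
move=> iq i'q; rewrite -!addnA => /addnI.
have E j u : (j * delta + u * q = (j * tau + u) * q + j)%N.
  by rewrite /delta mulnDr muln1 mulnA mulnDl; lia.
rewrite !E => h.
have ii : i = i'.
  by have := congr1 (modn^~ q) h; rewrite !modnMDl !modn_small.
split=> //; subst i'; move/addIn/eqP: h; rewrite eqn_pmul2r// => /eqP.
by move/addnI.
Qed.

Lemma block_rep a w i l : (i < q)%N ->
  block a w (a + i * delta + l * q)%N = tmul i w @` GA l.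
Proof.
move=> iq; apply/seteqP; split=> v.
  move=> [->|[i' [l' [r [i'q e rl ->]]]]].
    by exists 0; rewrite ?tmul0//; apply: ksub0 (gaS F l).
  by have [<- <-] := block_index_uniq i'q iq e; exists r.
by move=> [r rl <-]; right; exists i, l, r.
Qed.

Lemma block_norep a w m : (forall i l, (i < q)%N -> (a + i * delta + l * q)%N <> m) ->
  block a w m = [set 0].
Proof.
move=> h; apply/seteqP; split=> v; last by move=> ->; left.
by move=> [->//|[i [l [r [iq /(h _ _ iq)]]]]].
Qed.

Lemma ksub_block a w m : ksub (block a w m).
Proof.
have [[i [l [iq <-]]]|h] :=
    pselect (exists i l, (i < q)%N /\ (a + i * delta + l * q)%N = m).
  by rewrite block_rep//; apply: (ksub_tmul i w (gaS F l)).
rewrite block_norep; first exact: ksub_set0.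
by move=> i l iq e; apply: h; exists i, l.
Qed.

Lemma kfin_block a w m : kfin (block a w m).
Proof.
have [[i [l [iq <-]]]|h] :=
    pselect (exists i l, (i < q)%N /\ (a + i * delta + l * q)%N = m).
  by rewrite block_rep//; apply: (kfin_tmul i w (kfin_ga F l)).
rewrite block_norep; first exact: kfin_set0.
by move=> i l iq e; apply: h; exists i, l.
Qed.

(** As f^(n q) is the q-th power of f^n, multiplying a block by it amounts to multiplying the
    coefficient r by f^n. *)
Lemma shiftmul_block a w fn n i l : GA fn.1 fn.2 -> (i < q)%N ->
  shiftmul (block a w) fn (n * q) (a + i * delta + l * q)%N =
  tmul i w @` shiftmul (GA : nat -> set A^o) fn n l.
Proof.
move=> hf iq; apply/seteqP; split=> v.
  move=> [->|[m [_ [e [->|[i' [l' [r [i'q e' rl ->]]]]] ->]]]].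
  - by exists 0; rewrite ?tmul0//; left.
  - by exists 0; rewrite ?tmul0 ?scaler0//; left.
  have e1 : (a + i' * delta + (l' + fn.1 * n) * q)%N = (a + i * delta + l * q)%N.
    by rewrite -e -e' mulnDl -mulnA; lia.
  have [<- <-] := block_index_uniq i'q iq e1.
  exists (fn.2 ^+ n * r); first by right; exists l', r.
  by rewrite tmulM exprM.
move=> [_ [->|[l' [r [<- rl ->]]]] <-]; first by left; rewrite tmul0.
right; exists (a + i * delta + l' * q)%N, (tmul i w r); split.
- by rewrite mulnDl -mulnA; lia.
- by right; exists i, l', r.
- by rewrite exprM; apply: tmulM.
Qed.

Lemma fsum_block a w fs n i l : homog GA fs -> (i < q)%N ->
  fsum (block a w) fs (n * q) (a + i * delta + l * q)%N =
  tmul i w @` fsum (GA : nat -> set A^o) fs n l.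
Proof.
move=> hfs iq; elim: fs hfs => [|fn fs IH] hfs /=.
  apply/seteqP; split=> v; first by move=> ->; exists 0; rewrite ?tmul0.
  by move=> [_ -> <-]; apply: tmul0.
have [hf hfs'] := homog_cons hfs.
rewrite IH// shiftmul_block//; apply/seteqP; split=> v.
  move=> [_ [_ [[r hr <-] [s hs <-] ->]]].
  by exists (r + s); [exists r, s|apply: tmulD].
move=> [_ [r [s [hr hs ->]]] <-].
by exists (tmul i w r), (tmul i w s); split; [exists r|exists s|apply: tmulD].
Qed.

Lemma fsum_block_norep a w fs n m : homog GA fs ->
  (forall i l, (i < q)%N -> (a + i * delta + l * q)%N <> m) ->
  fsum (block a w) fs (n * q) m = [set 0].
Proof.
move=> hfs h; elim: fs hfs => //= fn fs IH hfs.
have [hf hfs'] := homog_cons hfs; rewrite IH//.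
have -> : shiftmul (block a w) fn (n * q) m = [set 0].
  apply/seteqP; split=> v; last by move=> ->; left.
  move=> [->//|[l [_ [e [->|[i [l' [r [iq e' rl ->]]]]] ->]]]]; first exact: scaler0.
  case: (h i (l' + fn.1 * n)%N iq); rewrite -e -e' mulnDl -mulnA; lia.
apply/seteqP; split=> [v [_ [_ [-> -> ->]]]|v ->]; first by rewrite addr0.
by exists 0, 0; rewrite addr0.
Qed.

Lemma fsum_GA fs n l : homog GA fs ->
  fsum (GA : nat -> set A^o) fs n l `<=` GA l.
Proof.
elim: fs => [_ v ->|fn fs IH /homog_cons[hf hfs]] /=; first exact: ksub0 (gaS F l).
apply: (@ksum_sub k A A^o); [exact: gaS F l| |exact: IH].
move=> _ [->|[l' [r [<- rl ->]]]]; first exact: ksub0 (gaS F l).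
by rewrite addnC; apply: (gaM F (ga_exp F n hf) rl).
Qed.

Definition add_block W a w : nat -> set M := fun m => ksum (W m) (block a w m).

Lemma tmul_G a w i l r : G a w -> GA l r -> G (a + i * delta + l * q)%N (tmul i w r).
Proof.
move=> Gw rl; have h1 := gG.2 _ _ _ _ (ga_exp F i y_delta) Gw.
by apply: gmod_eq (gG.2 _ _ _ _ (ga_exp F q rl) h1); lia.
Qed.

(** Stability under y is the delicate point: y raises i by one, and from i = q - 1 the resulting y^q
    is the twisted action of y, which is absorbed by the coefficient r. *)
Lemma twisted_add_block W a w : twisted W -> G a w -> twisted (add_block W a w).
Proof.
move=> [sW NW WG tW yW] Gw; split.
- by move=> i; apply: ksub_ksum => //; apply: ksub_block.
- by move=> i v /NW; apply: ksuml; apply: ksub_block.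
- move=> m; apply: ksum_sub; [exact: gG.1|exact: WG|].
  move=> _ [->|[i [l [r [iq <- rl ->]]]]]; first exact: ksub0 (gG.1 m).
  exact: tmul_G.
- move=> i j s _ si [u [b [Wu Bb ->]]].
  exists (s ^+ q *: u), (s ^+ q *: b); split; [exact: tW| |exact: (@scalerDr A M _ u b)].
  case: Bb => [->|[i' [l [r [iq <- rl ->]]]]]; first by left; rewrite scaler0.
  right; exists i', (i + l)%N, (s * r); split=> //; last by rewrite tmulM.
    by rewrite mulnDl; lia.
  exact: (gaM F si rl).
- move=> j _ [u [b [Wu Bb ->]]].
  exists (y *: u), (y *: b); split; [exact: yW| |exact: (@scalerDr A M _ u b)].
  case: Bb => [->|[i [l [r [iq <- rl ->]]]]]; first by left; rewrite scaler0.
  right; case: (ltnP i.+1 q) => iq'.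
    exists i.+1, l, r; split=> //; first by rewrite mulSn; lia.
    by rewrite /tmul exprS !scalerA; congr (_ *: _); rewrite mulrCA mulrA.
  exists 0%N, (delta + l)%N, (y * r); split=> //.
  - have -> : (i = q.-1)%N by lia.
    rewrite mul0n addn0 mulnDl addnA -(prednK q_gt0) mulnS; lia.
  - exact: (gaM F y_delta rl).
  - rewrite /tmul expr0 scale1r exprMn !scalerA; congr (_ *: _).
    have -> : y ^+ q = y * y ^+ i by rewrite -exprS; congr (_ ^+ _); lia.
    ring.
Qed.

Lemma fsum_twisted W fs n m : twisted W -> homog GA fs ->
  fsum W fs (n * q) m `<=` W m.
Proof.
move=> [sW NW WG tW yW]; elim: fs => [_ v ->|fn fs IH /homog_cons[hf hfs]] /=.
  exact: ksub0.
apply: ksum_sub => //; last exact: IH.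
move=> _ [->|[l [w [<- Ww ->]]]]; first exact: ksub0.
rewrite exprM addnC mulnA; apply: tW => //.
exact: (ga_exp F n hf).
Qed.

Section BlockDimension.
Context (W : nat -> set M) (a : nat) (w : M) (P : nat -> set A).
Context (tW : twisted W) (Gw : G a w) (gP : gideal GA P).
Context (annW : forall i l r, (i < q)%N -> GA l r ->
  W (a + i * delta + l * q)%N (tmul i w r) -> P l r).
Context (annN : forall i l r, (i < q)%N -> P l r ->
  N0 (a + i * delta + l * q)%N (tmul i w r)).

(** By [annW] and [annN], an element of the block that lies in W already lies in N0. Between W +
    block and its relations one inserts W plus the multiples of the block by the f^(n q). The upper
    quotient is then R modulo P and the f^n, in degree l, and the lower one is the quotient of W.
    Nothing is lost, whatever n is. *)
Lemma hdim_add_block fs n i l : homog GA fs -> (i < q)%N ->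
  hdim (add_block W a w) N0 fs (n * q) (a + i * delta + l * q)%N =
  (hdim (GA : nat -> set A^o) P fs n l +
   hdim W N0 fs (n * q) (a + i * delta + l * q)%N)%N.
Proof.
move=> hfs iq; have [sW NW WG tW1 yW] := tW.
have sB := ksub_block a w.
rewrite /hdim /add_block fsum_add//.
set m := (a + i * delta + l * q)%N.
have fW : kfin (W m) by apply: kfin_sub (fG m); apply: WG.
have sJW := ksub_fsum fs (n * q) m sW; have sJB := ksub_fsum fs (n * q) m sB.
set JW := fsum W fs (n * q) m in sJW *; set JB := fsum (block a w) fs (n * q) m in sJB *.
have sJ : ksub (fsum (GA : nat -> set A^o) fs n l).
  by apply: ksub_fsum => j; apply: gaS F j.
have sN := gN.1 m.
have JBB : JB `<=` block a w m.
  rewrite /JB /m fsum_block// block_rep//; apply: image_subset.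
  exact: fsum_GA.
have JWW : JW `<=` W m by apply: fsum_twisted.
have fJB : kfin JB by apply: kfin_sub (kfin_block a w m).
have sXW : ksub (ksum (N0 m) JW) by apply: ksub_ksum.
have -> : ksum (N0 m) (ksum JW JB) = ksum (ksum (N0 m) JW) JB.
  exact: (@addSA k (restr_scalars M)).
have sX : ksub (ksum (ksum (N0 m) JW) JB) by apply: ksub_ksum.
have XWW : ksum (N0 m) JW `<=` W m by apply: ksum_sub => //; apply: NW.
have sWJ : ksub (ksum (W m) JB) by apply: ksub_ksum.
have fWB : kfin (ksum (W m) (block a w m)).
  by apply: kfin_ksum => //; apply: kfin_block.
rewrite (@kdim_trans _ _ _ _ (ksum (W m) JB))//.
- congr (_ + _)%N.
  + rewrite {1}/ksum (@addSC k (restr_scalars M)).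
    rewrite (kdim_ksumr (sB m) (sW m) sWJ (ksuml sJB) (kfin_block a w m) fW).
    rewrite {1}/m block_rep//; apply: kdim_tmul => //; [exact: gaS F l| |exact: kfin_ga F l|].
      by apply: ksub_ksum => //; apply: gideal_ksub gP.
    move=> r rl; split.
      move=> [p [j [Pp Jj e]]]; rewrite [X in tmul i w X]e tmulD.
      exists (tmul i w p), (tmul i w j); split=> //; first exact/NW/annN.
      by rewrite /JB /m fsum_block//; exists j.
    move=> [u [v [Wu hv e]]]; move: hv; rewrite /JB /m fsum_block// => -[j Jj ej].
    exists (r - j), j; split=> //; last by rewrite subrK.
    have jl := fsum_GA hfs Jj.
    apply: (annW iq); first exact: (ksubB (gaS F l)).
    by rewrite tmulB e -ej addrK.
  + rewrite kdim_ksumr//; last exact: ksumr.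
    apply: kdim_eq_ext => // u Wu; split; last by apply: ksuml.
    move=> [x [v [Xx hv e]]]; move: hv; rewrite /JB /m fsum_block// => -[j Jj ej].
    rewrite e; apply: ksubD => //; apply: ksuml => //; rewrite -ej.
    apply: annN => //; apply: (annW iq); first exact: (fsum_GA hfs Jj).
    have -> : tmul i w j = u - x by rewrite e -ej addrAC subrr add0r.
    by apply: ksubB => //; apply: XWW.
- apply: ksub_ksum => //.
- by apply: ksum_mono.
- by apply: ksum_mono.
Qed.

End BlockDimension.

Lemma ksum_set0 (U : set M) : ksum U [set 0] = U.
Proof.
apply/seteqP; split=> v; first by move=> [u [_ [Uu -> ->]]]; rewrite addr0.
by move=> Uv; exists v, 0; rewrite addr0.
Qed.

Lemma hdim_add_block_norep W a w fs n m : twisted W -> homog GA fs ->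
  (forall i l, (i < q)%N -> (a + i * delta + l * q)%N <> m) ->
  hdim (add_block W a w) N0 fs (n * q) m = hdim W N0 fs (n * q) m.
Proof.
move=> [sW _ _ _ _] hfs h; rewrite /hdim /add_block fsum_add//; last exact: ksub_block.
by rewrite fsum_block_norep// block_norep// !ksum_set0.
Qed.

Lemma twisted_N : (forall j v, N0 j v -> N0 (delta + j)%N (y *: v)) -> twisted N0.
Proof.
move=> yN; split; [exact: gN.1|by move=> i v|by []| |by []].
by move=> i j a v ai; apply: gN.2; apply: (ga_exp F q ai).
Qed.

Lemma twisted_expy W j v i : twisted W -> W j v -> W (i * delta + j)%N (y ^+ i *: v).
Proof.
move=> [_ _ _ _ yW] Wv; elim: i => [|i IH]; first by rewrite scale1r.
by rewrite exprS -scalerA mulSn -addnA; apply: yW.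
Qed.

Lemma tann_mono W W' a v : gsub W W' -> gsub (tann W a v) (tann W' a v).
Proof. by move=> WW' l r [rl Wr]; split=> //; apply: WW'. Qed.

Definition tspan a v m : set M :=
  [set u | u = 0 \/ exists l r, [/\ (l * q + a)%N = m, GA l r & u = r ^+ q *: v]].

Lemma tspan_img a v l : tspan a v (l * q + a)%N = tmul 0 v @` GA l.
Proof.
apply/seteqP; split=> u.
  move=> [->|[l' [r [/addIn/eqP + rl ->]]]].
    by exists 0; rewrite ?tmul0//; apply: ksub0 (gaS F l).
  rewrite eqn_pmul2r// => /eqP el.
  by exists r; rewrite -?el// /tmul scale1r.
by move=> [r rl <-]; right; exists l, r; rewrite /tmul scale1r.
Qed.

Lemma tspan_trivial a v m : (forall l, (l * q + a)%N <> m) -> tspan a v m = [set 0].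
Proof.
move=> h; apply/seteqP; split=> u; last by move=> ->; left.
by move=> [->//|[l [r [/h]]]].
Qed.

Lemma tspan_subspace a v m : ksub (tspan a v m) /\ kfin (tspan a v m).
Proof.
have [[l <-]|h] := pselect (exists l, (l * q + a)%N = m).
  by rewrite tspan_img; split;
    [apply: (ksub_tmul 0 v (gaS F l))|apply: (kfin_tmul 0 v (kfin_ga F l))].
rewrite tspan_trivial; first by split; [exact: ksub_set0|exact: kfin_set0].
by move=> l e; apply: h; exists l.
Qed.

(** Modulo W, the twisted span of v is a semilinear copy of R modulo [tann], placed in the degrees l
    q + a. *)
Lemma kdim_tspan W a v m C : twisted W ->
  (forall l, (hilb GA (tann W a v) l <= C * l.+1 ^ D)%N) ->
  (kdim (tspan a v m) (W m) <= C * m.+1 ^ D)%N.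
Proof.
move=> [sW _ _ tW _] hC.
have [[l <-]|h] := pselect (exists l, (l * q + a)%N = m); last first.
  rewrite tspan_trivial; last by move=> l e; apply: h; exists l.
  by rewrite kdim_eq0// => _ ->; apply: ksub0.
rewrite tspan_img; apply: (@leq_trans (C * l.+1 ^ D)); last first.
  by apply: leq_mul_exp; rewrite (leq_trans _ (leq_addr _ _))// leq_pmulr.
apply: leq_trans (hC l); rewrite (@kdim_tmul _ _ _ (tann W a v l))//.
- exact: gaS F l.
- exact: gideal_ksub (gideal_tann a v sW tW).
- exact: kfin_ga F l.
- by move=> r rl; rewrite /tmul scale1r; split=> [[]|].
Qed.

Section Finder.
(* Locally at [Q], the twisted action of [Q] on [G / N0] is zero. *)
Context (star : forall Q, big GA D Q -> exists t c, [/\ GA t c, ~ Q t c &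
  forall i b j u, Q i b -> G j u -> N0 ((t + i) * q + j)%N ((c * b) ^+ q *: u)]).
Context (y_big : forall Q, big GA D Q -> ~ Q delta y).

(** Let Q = ([tann] : r) be big and c as in [star]; the block is generated by (c r)^q v. The factor
    c makes Q carry it into N0. Conversely, if s carries y^i (c r)^q v into W, then s y c lies in Q,
    hence so does s, as neither y nor c is in Q. *)
Lemma find_block W a v : twisted W -> G a v -> ~ small GA D (tann W a v) ->
  exists Q e r, [/\ big GA D Q, GA e r, ~ tann W a v e r,
    forall i l s, (i < q)%N -> GA l s ->
      W (e * q + a + i * delta + l * q)%N (tmul i (r ^+ q *: v) s) -> Q l s
  & forall i l s, (i < q)%N -> Q l s ->
      N0 (e * q + a + i * delta + l * q)%N (tmul i (r ^+ q *: v) s)].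
Proof.
move=> tW Gv nW; have [sW _ _ tW1 yW] := tW.
have gA := gideal_tann a v sW tW1.
have [e [r [re bQ]]] := big_colon F gA nW.
set Q := gcolon _ _ _ _ in bQ; have [pQ nQ] := bQ; have [gQ _ hQ] := pQ.
have [t [c [ct Qc hc]]] := star bQ; have yQ := y_big bQ.
exists Q, (t + e)%N, (c * r); split=> //.
- exact: (gaM F ct re).
- by move=> [_ h]; apply: Qc; split=> //; split=> //; apply: (gaM F ct re).
- move=> i l s iq sl Wu.
  have syc : Q (l + delta + t)%N (s * y * c).
    split; first exact: (gaM F (gaM F sl y_delta) ct).
    split; first exact: (gaM F (gaM F (gaM F sl y_delta) ct) re).
    (* Completing y^i to y^q turns the power of y into a twisted coefficient, which can be compared
       with [tann]. *)
    have := twisted_expy (q - i) tW Wu.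
    rewrite /tmul !scalerA (_ : _ + _ = (l + delta + t + e) * q + a)%N; last first.
      have : ((q - i) * delta + i * delta = q * delta)%N.
        by rewrite -mulnDl subnK// ltnW.
      by rewrite /=; move: (delta) => del; rewrite !mulnDl; lia.
    congr (W _ (_ *: _)); rewrite !exprMn.
    rewrite (_ : y ^+ q = y ^+ (q - i) * y ^+ i); first ring.
    by rewrite -exprD subnK// ltnW.
  have [|//] := hQ _ _ _ _ (gaM F sl y_delta) ct syc.
  by move=> /(hQ _ _ _ _ sl y_delta)[].
- move=> i l s iq Qs.
  have Gu : G (e * q + (i * delta + a))%N (r ^+ q *: (y ^+ i *: v)).
    apply: gG.2; first exact: (ga_exp F q re).
    by apply: gG.2 => //; rewrite mulnC; apply: (ga_exp F i y_delta).
  have := hc _ _ _ _ Qs Gu.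
  rewrite (_ : _ + _ = (t + e) * q + a + i * delta + l * q)%N; last lia.
  by rewrite /tmul !scalerA; congr (N0 _ (_ *: _)); rewrite !exprMn; ring.
Qed.

End Finder.
End TwistedSubmodules.

(** * Agreement of functions up to O(m^D), uniformly in n *)

Section Approximation.
Context (D : nat).
Implicit Types (f g h : nat -> nat -> nat).

Definition capx f g := exists C, forall n m,
  (f n m <= g n m + C * m.+1 ^ D)%N /\ (g n m <= f n m + C * m.+1 ^ D)%N.

Lemma capx_refl f : capx f f.
Proof. by exists 0%N => n m; rewrite !leq_addr. Qed.

Lemma capx_sym f g : capx f g -> capx g f.
Proof. by move=> [C h]; exists C => n m; have [] := h n m. Qed.

Lemma capx_trans g f h : capx f g -> capx g h -> capx f h.
Proof.
move=> [C H] [C' H']; exists (C + C')%N => n m.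
by have [? ?] := H n m; have [? ?] := H' n m; rewrite mulnDl; split; lia.
Qed.

Lemma capx_add f f' g g' : capx f g -> capx f' g' ->
  capx (fun n m => f n m + f' n m)%N (fun n m => g n m + g' n m)%N.
Proof.
move=> [C H] [C' H']; exists (C + C')%N => n m.
by have [? ?] := H n m; have [? ?] := H' n m; rewrite mulnDl; split; lia.
Qed.

(** Uniformity allows any substitution in n; a substitution in m must not increase it, or the error
    term would grow. *)
Lemma capx_reindex f g (phi : nat -> nat) (psi : nat -> nat) : (forall m, (psi m <= m)%N) ->
  capx f g -> capx (fun n m => f (phi n) (psi m)) (fun n m => g (phi n) (psi m)).
Proof.
move=> hpsi [C H]; exists C => n m; have [h1 h2] := H (phi n) (psi m).
have h3 := leq_mul_exp C D (hpsi m).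
by split; lia.
Qed.

Lemma capx_ext f f' g g' : (forall n m, f n m = f' n m) -> (forall n m, g n m = g' n m) ->
  capx f g -> capx f' g'.
Proof. by move=> e e' [C h]; exists C => n m; rewrite -e -e'. Qed.

Lemma capx_sum (I : Type) (r : seq I) (f g : I -> nat -> nat -> nat) :
  List.Forall (fun i => capx (f i) (g i)) r ->
  capx (fun n m => \sum_(i <- r) f i n m)%N (fun n m => \sum_(i <- r) g i n m)%N.
Proof.
elim=> [|i s hi _ IH].
  by apply: capx_ext (capx_refl (fun _ _ => 0%N)) => n m; rewrite big_nil.
by apply: capx_ext (capx_add hi IH) => n m; rewrite big_cons.
Qed.

Lemma capx_mul c f g : capx f g ->
  capx (fun n m => c * f n m)%N (fun n m => c * g n m)%N.
Proof.
move=> [C h]; exists (c * C)%N => n m; have [? ?] := h n m.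
by split; rewrite -[(c * C * _)%N]mulnA -mulnDr leq_mul2l; apply/orP; right.
Qed.

End Approximation.

(** * Quotients of R/P by powers of the generators, for a big prime P *)

Section PrimeCase.
Context {k : fieldType} {A : comAlgType k} (GA : nat -> set A) (D : nat).
Context (F : graded_facts GA D.+2).
Implicit Types (P Q : nat -> set A) (fs : seq (nat * A)).

Definition udim P fs n m := hdim (GA : nat -> set A^o) P fs n m.

Lemma udim_le P fs n m : gideal GA P -> (udim P fs n m <= hilb GA P m)%N.
Proof.
move=> gP; have sf := @ksub_fsum k A A^o (GA : nat -> set A^o) fs n m (gaS F).
apply: kdim_subr; [exact: gideal_ksub gP| |exact: kfin_ga F m|exact: ksuml].
by apply: ksub_ksum => //; apply: gideal_ksub gP.
Qed.

(* The exact sequence [0 -> (R/P)(-1) -> R/P -> R/(P + xR) -> 0], whose kernel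
   term is a block for [q = 1] and [y = 0]. *)
Lemma udim_step P fs : big GA D P -> homog GA fs -> exists C, forall n m,
  (udim P fs n m.+1 <= udim P fs n m + C * m.+2 ^ D)%N /\
  (udim P fs n m <= udim P fs n m.+1 + C * m.+2 ^ D)%N.
Proof.
move=> bP hfs; have [pP nP] := bP; have gP := hprime_gideal pP.
have [x [x1 Px]] := big_GA1 F bP.
have [C hC] := small_proper F pP (gideal_adjoin F gP x1) (gadjoin_proper F gP x1 Px).
have q1 : (0 < 1)%N by [].
have frobD (a b : A) : (a + b) ^+ 1 = a ^+ 1 + b ^+ 1 by rewrite !expr1.
have frob_surj (c : k) : exists b, b ^+ 1 = c by exists c; rewrite expr1.
have y1 : GA (0 * 1 + 1)%N 0 by apply: ksub0 (gaS F _).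
have [gmP _] := gP.
have tP : twisted GA 1 0 0 (GA : nat -> set A^o) P P.
  apply: (@twisted_N k A GA D F 1 0 0 A^o GA P gP.1 gP.2).
  by move=> j v _; rewrite scale0r; apply: ksub0 (gideal_ksub _ gP).
set W := @add_block k A GA 1 0 0 A^o P 1 x.
have tW : @twisted k A GA 1 0 0 A^o GA P W.
  exact: (twisted_add_block F q1 frobD frob_surj y1 (gmod_GA F) tP x1).
have [sW NW WG _ _] := tW.
(* In degree m + 1 the block is a copy of R/P in degree m, and P modulo itself contributes
   nothing. *)
have hW n m : @hdim k A A^o W P fs n m.+1 = udim P fs n m.
  have -> : (m.+1 = 1 + 0 * (0 * 1 + 1) + m * 1)%N by lia.
  rewrite -[n]muln1.
  rewrite (@hdim_add_block k A GA D F 1 q1 frobD frob_surj 0 0 A^o GA P gP.1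
    (kfin_ga F) P 1 x P tP gP)//.
  - rewrite -[RHS]addn0 muln1; congr (_ + _)%N.
    have sf j := @ksub_fsum k A A^o P fs n j (fun i => gideal_ksub i gP).
    apply: kdim_eq0; last by apply: ksuml; apply: sf.
    by apply: ksub_ksum; [apply: gideal_ksub gP|apply: sf].
  - move=> i l r; rewrite ltnS leqn0 => /eqP -> rl.
    rewrite /tmul expr1 scale1r mul0n addn0 muln1 addnC => h.
    by have [_ _ hP] := pP; case: (hP _ _ _ _ rl x1 h).
  - move=> i l r; rewrite ltnS leqn0 => /eqP -> rl.
    rewrite /tmul expr1 scale1r mul0n addn0 muln1 addnC.
    exact: (gideal_mulr gP x1 rl).
(* [W] contains P + xR, whose quotient is small. *)
have hE m l : (l <= m)%N -> (kdim (GA l : set A^o) (W l) <= C * m.+1 ^ D)%N.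
  move=> lm; apply: leq_trans (leq_mul_exp C D lm); apply: leq_trans (hC l).
  apply: kdim_subr => //; [exact: gideal_ksub (gideal_adjoin F gP x1)|exact: kfin_ga F l|].
  apply: (@addS_mono k (restr_scalars A^o)) => // _ [->|[l' [b [<- bl ->]]]]; first by left.
  right; exists 0%N, l', b; split=> //; first by lia.
  by rewrite /tmul expr1 scale1r.
exists (C + size fs * C)%N => n m.
have := @hdim_compare k A A^o GA W P fs n m.+1 (C * m.+2 ^ D).
rewrite hW => -[].
- exact: gaS F.
- exact: sW.
- by move=> i; apply: gideal_ksub gP.
- exact: WG.
- exact: NW.
- exact: kfin_ga F.
- exact: (fsum_GA F).
- by rewrite -[n]muln1; apply: (fsum_twisted F tW hfs).
- by move=> l; apply: hE.
rewrite /udim mulnDl -!mulnA => h1 h2; split.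
  by apply: (leq_trans h1); rewrite leq_add2l leq_addr.
by apply: (leq_trans h2); rewrite leq_add2l leq_addl.
Qed.

Lemma udim_near P fs : big GA D P -> homog GA fs -> exists C, forall n m e,
  (udim P fs n (m + e) <= udim P fs n m + e * C * (m + e).+1 ^ D)%N /\
  (udim P fs n m <= udim P fs n (m + e) + e * C * (m + e).+1 ^ D)%N.
Proof.
move=> bP hfs; have [C hC] := udim_step bP hfs; exists C => n m.
elim=> [|e [IH1 IH2]]; first by rewrite addn0 !leq_addr.
have [h1 h2] := hC n (m + e)%N; rewrite addnS.
have h3 := leq_mul_exp (e * C) D (leqnSn (m + e)).
by rewrite mulSn mulnDl; split; lia.
Qed.

End PrimeCase.

(** * Exhausting a module by blocks, up to a small remainder *)

Section Decomposition.
Context {k : fieldType} {A : comAlgType k} (GA : nat -> set A) (D : nat).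
Context (F : graded_facts GA D.+2).
Context (q : nat) (q_gt0 : (0 < q)%N).
Context (frobD : forall a b : A, (a + b) ^+ q = a ^+ q + b ^+ q).
Context (frob_surj : forall c : k, exists b, b ^+ q = c).
Context (tau : nat) (y : A).
Let delta := (tau * q + 1)%N.
Context (y_delta : GA delta y).
Context (y_big : forall Q, big GA D Q -> ~ Q delta y).
Context (M : lmodType A) (G N0 : nat -> set M).
Context (gG : gmod GA G) (gN : gmod GA N0) (NG : gsub N0 G) (fG : forall i, kfin (G i)).
Context (star : forall Q, big GA D Q -> exists t c, [/\ GA t c, ~ Q t c &
  forall i b j u, Q i b -> G j u -> N0 ((t + i) * q + j)%N ((c * b) ^+ q *: u)]).
Implicit Types (W : nat -> set M) (v w : M) (fs : seq (nat * A)) (L : seq (nat -> set A)).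

Let tw := twisted GA q tau y G N0.

(** The exponent n q on the left corresponds to n on the right, and degree m to degree m/q, as on a
    single block. *)
Definition decomp W L := forall fs, homog GA fs ->
  capx D (fun n m => hdim W N0 fs (n * q) m)
         (fun n m => \sum_(P <- L) udim GA P fs n (m %/ q))%N.

(* Big primes containing the annihilator of [G / N0] for the twisted action. *)
Definition block_prime Q := big GA D Q /\ forall i b, GA i b ->
  (forall j u, G j u -> N0 (i * q + j)%N (b ^+ q *: u)) -> Q i b.

(** The exact formula of [hdim_add_block] involves the degree l with e + i delta + l q = m, which
    differs from m/q by a bounded amount; [udim_near] controls the resulting error. *)
Lemma decomp_add_block W L Q e (w : M) : tw W -> G e w -> big GA D Q ->
  (forall i l s, (i < q)%N -> GA l s ->
      W (e + i * delta + l * q)%N (tmul q y i w s) -> Q l s) ->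
  (forall i l s, (i < q)%N -> Q l s ->
      N0 (e + i * delta + l * q)%N (tmul q y i w s)) ->
  decomp W L -> decomp (add_block GA q tau y W e w) (Q :: L).
Proof.
move=> tW Gw bQ hW hN dW fs hfs; have [pQ nQ] := bQ; have gQ := hprime_gideal pQ.
have [C hC] := udim_near F bQ hfs.
(* From degree c on the block has a component in every degree, and l stays within c of m/q. *)
pose c := (e + q * delta)%N.
(* Covers the finitely many degrees below c in which the block may be absent. *)
pose C2 := (\sum_(l < c) hilb GA Q l)%N.
suff h : capx D (fun n m => hdim (add_block GA q tau y W e w) N0 fs (n * q) m)
    (fun n m => udim GA Q fs n (m %/ q) + hdim W N0 fs (n * q) m)%N.
  apply: capx_trans h _.
  apply: (capx_ext (f := fun n m => (udim GA Q fs n (m %/ q) + hdim W N0 fs (n * q) m)%N) _ _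
    (capx_add (capx_refl _ _) (dW fs hfs))) => // n m.
  by rewrite big_cons.
exists (c * C + C2)%N => n m.
have [[i [l [iq em]]]|hm] :=
    pselect (exists i l, (i < q)%N /\ (e + i * delta + l * q)%N = m).
  rewrite -em (hdim_add_block F q_gt0 frobD frob_surj gN fG tW gQ hW hN n l hfs iq).
  rewrite em -/(udim _ _ _ _ _).
  have dle : (delta * i <= delta * q)%N by rewrite leq_mul2l (ltnW iq) orbT.
  have lm : (l <= m %/ q)%N by rewrite leq_divRL// -em leq_addl.
  have mlc : (m %/ q - l <= c)%N.
    rewrite leq_subLR -em [(_ + l * q)%N]addnC divnMDl//.
    rewrite leq_add2l (leq_trans (leq_div _ _))// /c; lia.
  have [h1 h2] := hC n l (m %/ q - l)%N; rewrite subnKC// in h1 h2.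
  have h3 : ((m %/ q - l) * C * (m %/ q).+1 ^ D <= c * C * m.+1 ^ D)%N.
    rewrite leq_mul// ?leq_mul2r ?mlc ?orbT// leq_exp2// ltnS leq_div//.
  by rewrite mulnDl; split; lia.
have norep i l : (i < q)%N -> (e + i * delta + l * q)%N <> m.
  by move=> iq em; apply: hm; exists i, l.
rewrite (hdim_add_block_norep F q_gt0 frobD frob_surj w n tW hfs norep).
have mc : (m < c)%N.
  rewrite ltnNge; apply/negP => cm.
  pose i := ((m - e) %% q)%N.
  have iq : (i < q)%N by rewrite ltn_mod.
  have ilt : (i * delta <= q * delta)%N by rewrite leq_mul2r (ltnW iq) orbT.
  apply: (norep i (((m - e) %/ q) - i * tau)%N iq).
  have e1 := divn_eq (m - e) q; rewrite -/i in e1.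
  have e2 : (i * delta = i * tau * q + i)%N by rewrite /delta mulnDr muln1 mulnA.
  have e3 : (i * tau * q <= (m - e) %/ q * q)%N.
    move: cm ilt; rewrite /c e2; lia.
  rewrite mulnBl; move: cm; rewrite /c; lia.
have h1 : (udim GA Q fs n (m %/ q) <= C2)%N.
  rewrite (leq_trans (udim_le F _ _ _ gQ))//.
  have lt : (m %/ q < c)%N by rewrite (leq_ltn_trans (leq_div _ _)).
  by rewrite /C2 (bigD1 (Ordinal lt))//= leq_addr.
have h2 : (C2 <= C2 * m.+1 ^ D)%N by rewrite leq_pmulr// expn_gt0.
by rewrite mulnDl; split; lia.
Qed.

(** Noetherian induction on the annihilator of v modulo W: while it is not small, a block generated
    by some r^q v can be added, after which r joins the annihilator. *)
Lemma exhaust_generator a v : G a v -> forall W L, tw W -> List.Forall block_prime L ->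
  decomp W L -> exists W' L', [/\ tw W', gsub W W', List.Forall block_prime L',
    decomp W' L' & small GA D (tann GA q W' a v)].
Proof.
move=> Gv W L tW.
have gT W1 : tw W1 -> gideal GA (tann GA q W1 a v).
  by move=> [sW1 _ _ tW1 _]; apply: (gideal_tann F q_gt0 frobD).
have [J eJ] : exists J, tann GA q W a v = J by exists (tann GA q W a v).
have gJ : gideal GA J by rewrite -eJ; apply: gT.
move: J gJ W L tW eJ; apply: (ga_noeth F) => J gJ IH W L tW eJ bL dW.
have [sJ|nJ] := pselect (small GA D J).
  by exists W, L; rewrite eJ; split=> // i u.
rewrite -eJ in nJ.
have [Q [e [r [bQ re nr hW hN]]]] :=
  find_block F q_gt0 frobD y_delta gG star y_big tW Gv nJ.
have Gw : G (e * q + a)%N (r ^+ q *: v) by apply: gG.2 => //; apply: (ga_exp F q re).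
pose W1 := add_block GA q tau y W (e * q + a) (r ^+ q *: v).
have tW1 : tw W1 by apply: (twisted_add_block F) => //.
have WW1 : gsub W W1.
  by move=> m; apply: ksuml; apply: (ksub_block F q_gt0 frobD frob_surj).
have [W' [L' [tW' W1W' bL' dW' sW']]] : exists W' L', [/\ tw W', gsub W1 W',
    List.Forall block_prime L', decomp W' L' & small GA D (tann GA q W' a v)].
  apply: (IH _ (gT _ tW1) _ W1 (Q :: L) tW1 erefl) => //.
  - rewrite -eJ; split; first exact: tann_mono.
    move=> h; apply: nr; apply: h; split=> //.
    apply: ksumr; first by case: tW.
    right; exists 0%N, 0%N, 1; split=> //; first by rewrite !addn0.
      exact: ga1 F.
    by rewrite /tmul expr1n !scale1r.
  - apply: List.Forall_cons => //; split=> // i b bi hb.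
    apply: (hW 0%N _ _ q_gt0 bi); rewrite /tmul scale1r mul0n addn0 addnC.
    by case: tW => _ NW _ _ _; apply/NW/hb.
  - exact: decomp_add_block.
by exists W', L'; split=> //; apply: gsub_trans W1W'.
Qed.

(** The generators can be treated one after another: W only grows, and an ideal containing a small
    one is small. *)
Lemma exhaust_generators r (a : 'I_r -> nat) (v : 'I_r -> M) :
  (forall j, G (a j) (v j)) -> (forall j x, N0 j x -> N0 (delta + j)%N (y *: x)) ->
  exists W L, [/\ tw W, List.Forall block_prime L, decomp W L &
    forall j, small GA D (tann GA q W (a j) (v j))].
Proof.
move=> + yN; elim: r a v => [|r IH] a v Gv.
  exists N0, [::]; split=> [||fs hfs|[]//]; [|exact: List.Forall_nil|].
    exact: (twisted_N F gN NG yN).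
  exists 0%N => n m; rewrite big_nil /hdim kdim_eq0//.
    by apply: ksub_ksum; [exact: gN.1|apply: ksub_fsum; exact: gN.1].
  by apply: ksuml; apply: ksub_fsum; exact: gN.1.
have [W [L [tW bL dW sW]]] := IH (fun j => a (lift ord0 j)) (fun j => v (lift ord0 j))
  (fun j => Gv _).
have [W' [L' [tW' WW' bL' dW' sW']]] := exhaust_generator (Gv ord0) tW bL dW.
exists W', L'; split=> // j; case: (unliftP ord0 j) => [j'|] -> //.
apply: small_sub (sW j') => //.
- by case: tW => sW1 _ _ tW1 _; apply: (gideal_tann F q_gt0 frobD).
- by case: tW' => sW1 _ _ tW1 _; apply: (gideal_tann F q_gt0 frobD).
- exact: tann_mono.
Qed.

(** G / W is spanned by the twisted spans of finitely many [v j] whose annihilators modulo W are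
    small. Its dimension is therefore O(m^D), and [hdim_compare] carries the decomposition from W to
    G. *)
Lemma hdim_decomp r (a : 'I_r -> nat) (v : 'I_r -> M) :
  (forall j, G (a j) (v j)) ->
  (forall m u, G m u -> exists w : 'I_r -> M,
     (forall j, tspan GA q (a j) (v j) m (w j)) /\ u = \sum_j w j) ->
  exists L, List.Forall block_prime L /\ decomp G L.
Proof.
move=> Gv hG.
have yN j x : N0 j x -> N0 (delta + j)%N (y *: x) by apply: gN.2.
have [W [L [tW bL dW sW]]] := exhaust_generators Gv yN.
exists L; split=> // fs hfs; apply: capx_trans (dW fs hfs).
have [sWk NW WG tW1 yW] := tW.
have [C hC] := choice sW.
pose CC := (\sum_j C j)%N.
have st j m : ksub (tspan GA q (a j) (v j) m) /\ kfin (tspan GA q (a j) (v j) m).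
  exact: (tspan_subspace F q_gt0 frobD frob_surj).
pose U m (s : seq 'I_r) := foldr (fun j X => ksum (tspan GA q (a j) (v j) m) X) [set 0] s.
have hU m s : [/\ ksub (U m s), kfin (U m s)
    & (kdim (U m s) (W m) <= \sum_(j <- s) C j * m.+1 ^ D)%N].
  elim: s => [|j s [sU fU IH]]; rewrite /U /= -?/(U m s).
    split; [exact: ksub_set0|exact: kfin_set0|].
    by rewrite kdim_eq0// => _ ->; apply: ksub0 (sWk m).
  have [s1 f1] := st j m; split; first exact: ksub_ksum.
    exact: kfin_ksum.
  rewrite (leq_trans (kdim_ksum_le s1 sU (sWk m) f1 fU))// big_cons leq_add//.
  exact: (kdim_tspan F q_gt0 frobD frob_surj m tW (hC j)).
have hE m l : (l <= m)%N -> (kdim (G l) (W l) <= CC * m.+1 ^ D)%N.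
  move=> lm; apply: leq_trans (leq_mul_exp _ _ lm).
  have [sU fU] := hU l (index_enum _); rewrite -big_distrl /=.
  apply: leq_trans; apply: kdim_subl => // u /hG[w [hw ->]].
  elim: (index_enum _) => [|j s IH]; first by rewrite big_nil.
  by rewrite big_cons; exists (w j), (\sum_(i <- s) w i).
exists (CC + size fs * CC)%N => n m.
have [] := @hdim_compare k A M G W N0 fs (n * q) m (CC * m.+1 ^ D).
- exact: gG.1.
- exact: sWk.
- exact: gN.1.
- exact: WG.
- exact: NW.
- exact: fG.
- suff tG : tw G by apply: (fsum_twisted F tG hfs).
  split; [exact: gG.1|exact: NG|by move=> i u| |].
    by move=> i j b x bi; apply: gG.2; apply: (ga_exp F q bi).
  by move=> j x; apply: gG.2.
- exact: (fsum_twisted F tW hfs).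
- by move=> l; apply: hE.
rewrite mulnDl -!mulnA => h1 h2; split.
  by apply: (leq_trans h1); rewrite leq_add2l leq_addr.
by apply: (leq_trans h2); rewrite leq_add2l leq_addl.
Qed.

End Decomposition.

(** * Finite generation for the action through Frobenius *)

Section TwistedGeneration.
Context {k : fieldType} {A : comAlgType k} (GA : nat -> set A) (D : nat).
Context (F : graded_facts GA D.+2).

Definition tspans q (M : lmodType A) (Y : seq (nat * M)) m : set M :=
  foldr (fun av X => ksum (tspan GA q av.1 av.2 m) X) [set 0] Y.

(** The case q = 1 is ordinary generation by homogeneous elements. *)
Definition generates q (M : lmodType A) (G : nat -> set M) (Y : seq (nat * M)) :=
  (forall av, av \in Y -> G av.1 av.2) /\ forall m, G m `<=` tspans q Y m.

Section Fixed.
Context (q : nat) (q_gt0 : (0 < q)%N).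
Context (frobD : forall a b : A, (a + b) ^+ q = a ^+ q + b ^+ q).
Context (frob_surj : forall c : k, exists b, b ^+ q = c).

Lemma tspans_subspace (M : lmodType A) (Y : seq (nat * M)) m :
  ksub (tspans q Y m) /\ kfin (tspans q Y m).
Proof.
elim: Y => [|[a v] Y [sY fY]] /=.
  by split; [exact: ksub_set0|exact: kfin_set0].
have [s f] := tspan_subspace F q_gt0 frobD frob_surj 0 a v m.
by split; [exact: ksub_ksum|exact: kfin_ksum].
Qed.

Lemma tspans_mem (M : lmodType A) (Y : seq (nat * M)) m a v u :
  (a, v) \in Y -> tspan GA q a v m u -> tspans q Y m u.
Proof.
elim: Y => // -[a' v'] Y IH; rewrite in_cons => /orP[/eqP[-> ->]|aY] hu /=.
  by apply: ksuml hu; case: (tspans_subspace Y m).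
apply: ksumr; last exact: IH.
by case: (tspan_subspace F q_gt0 frobD frob_surj 0 a' v' m).
Qed.

Lemma tspans_sub (M : lmodType A) (Y : seq (nat * M)) m (U : set M) : ksub U ->
  (forall a v, (a, v) \in Y -> tspan GA q a v m `<=` U) -> tspans q Y m `<=` U.
Proof.
move=> sU; elim: Y => [_ u ->|[a v] Y IH hU] /=; first exact: ksub0.
apply: ksum_sub => //; first by apply: hU; rewrite mem_head.
by apply: IH => a' v' h; apply: hU; rewrite in_cons h orbT.
Qed.

Lemma tspans_mono (M : lmodType A) (Y Y' : seq (nat * M)) m :
  {subset Y <= Y'} -> tspans q Y m `<=` tspans q Y' m.
Proof.
move=> YY'; apply: tspans_sub; first by case: (tspans_subspace Y' m).
by move=> a v /YY' h u; apply: tspans_mem h.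
Qed.

Lemma tspans_mul (M : lmodType A) (Y : seq (nat * M)) m i r u :
  GA i r -> tspans q Y m u -> tspans q Y (i * q + m)%N (r ^+ q *: u).
Proof.
move=> ri; elim: Y u => [_ ->|[a v] Y IH _ [u [w [hu hw ->]]]] /=; first exact: scaler0.
rewrite (@scalerDr A M); exists (r ^+ q *: u), (r ^+ q *: w); split=> //; last exact: IH.
case: hu => [->|[l [s [<- sl ->]]]]; first by left; apply: (@scaler0 A M).
right; exists (i + l)%N, (r * s); split.
- by rewrite mulnDl addnA.
- exact: (gaM F ri sl).
- by rewrite exprMn; apply: (@scalerA A M).
Qed.

Lemma tspans_ord (M : lmodType A) (Y : seq (nat * M)) m u : tspans q Y m u ->
  exists w : 'I_(size Y) -> M,
    (forall j : 'I_(size Y), tspan GA q (nth (0%N, 0) Y j).1 (nth (0%N, 0) Y j).2 m (w j)) /\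
    u = \sum_j w j.
Proof.
elim: Y u => [_ ->|[a v] Y IH _ [u [w [hu /IH[f [hf ->]] ->]]]] /=.
  by exists (fun=> 0); split; [case|rewrite big_ord0].
exists (fun j => if unlift ord0 j is Some i then f i else u); split.
  by move=> j; case: unliftP => [i ->|->]; [rewrite lift0; apply: hf|].
rewrite big_ord_recl unlift_none; congr (_ + _).
by apply: eq_bigr => i _; rewrite liftK.
Qed.

Lemma generates_ring_low n : exists Y : seq (nat * A^o),
  (forall av, av \in Y -> GA av.1 av.2) /\
  forall m, (m < n)%N -> GA m `<=` tspans q Y m.
Proof.
elim: n => [|n [Y [YG hY]]]; first by exists [::].
have [s [Us _ ss]] := relbasis_ex (U := GA n : set (restr_scalars A^o)) (@subsp_set0 _ _) (kfin_ga F n).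
pose Z : seq (nat * A^o) := [seq (n, s i : A^o) | i <- enum 'I_(rdim (GA n : set (restr_scalars A^o)) [set 0])].
exists (Y ++ Z); split.
  move=> av; rewrite mem_cat => /orP[/YG//|/mapP[i _ ->]]; exact: Us.
move=> m; rewrite ltnS leq_eqVlt => /orP[/eqP -> u un|/hY h u /h]; last first.
  by apply: tspans_mono => x xY; rewrite mem_cat xY.
have [c /eqP] := ss _ un; rewrite subr_eq0 => /eqP ->.
apply: (@ksub_sum k A A^o); first by case: (tspans_subspace (Y ++ Z) n).
move=> i _; apply: (@tspans_mem _ _ _ n (s i)).
  by rewrite mem_cat; apply/orP; right; apply/mapP; exists i; rewrite ?mem_enum.
(* A twisted scalar acts by its q-th power, so [c i] has to be a q-th power; perfectness enters
   here. *)
have [b bc] := frob_surj (c i); right; exists 0%N, b%:A; split=> //.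
  exact: scal_GA0 F b.
by rewrite scalX bc.
Qed.

(** Above degree s q every element is a combination of q-th powers of linear forms with coefficients
    of lower degree, so bases of the components up to degree s q suffice. *)
Lemma generates_ring : exists Y : seq (nat * A^o), generates q (GA : nat -> set A^o) Y.
Proof.
have [s [X [X1 hX]]] := ga_pigeonhole F.
have [Y [YG hY]] := generates_ring_low (s * q).+1; exists Y; split=> // m.
elim/ltn_ind: m => m IH; case: (ltnP m (s * q).+1) => [/hY//|sqm] u um.
have [b [hb ->]] := hX _ _ _ sqm um.
apply: (@ksub_sum k A A^o); first by case: (tspans_subspace Y m).
move=> j _; have qm : (q <= m)%N.
  by case: (s) j sqm => [[]//|s' _]; rewrite mulSn => /ltnW; apply: leq_trans; rewrite leq_addr.
rewrite -(subnKC qm) mulrC -[q in (q + _)%N]mul1n.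
apply: (@tspans_mul A^o) => //; apply: IH => //.
by rewrite ltn_subrL q_gt0 (leq_trans _ qm).
Qed.

End Fixed.

Lemma frob1D (a b : A) : (a + b) ^+ 1 = a ^+ 1 + b ^+ 1.
Proof. by rewrite !expr1. Qed.

Lemma frob1_surj (c : k) : exists b, b ^+ 1 = c.
Proof. by exists c; rewrite expr1. Qed.

(** Products of twisted generators of the ring and ordinary generators of the module do. *)
Lemma generates_frob q (M : lmodType A) (G : nat -> set M) V : (0 < q)%N ->
  (forall a b : A, (a + b) ^+ q = a ^+ q + b ^+ q) ->
  (forall c : k, exists b, b ^+ q = c) ->
  gmod GA G -> generates 1 G V -> exists Y, generates q G Y.
Proof.
move=> q0 qD qs gG [VG hV]; have [Y [YG hY]] := generates_ring q0 qD qs.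
pose Z := [seq (y.1 + v.1, (y.2 : A) *: v.2)%N | y <- Y, v <- V].
exists Z; split=> [av /allpairsP[[y v] /= [/YG yG /VG vG ->]]|m u /hV].
  exact: gG.2.
have sZ := (tspans_subspace q0 qD qs Z m).1.
apply: (tspans_sub (q := 1)) => // a v vV _ [->|[l [r [<- rl ->]]]].
  by apply: ksub0; case: (tspans_subspace q0 qD qs Z m).
rewrite expr1 muln1; have sU := (tspans_subspace q0 qD qs Z (l + a)).1.
pose U : set A^o := [set r : A | tspans q Z (l + a)%N (r *: v)].
have sU' : ksub U.
  apply: ksubP => [|r1 r2 /= h1 h2|c r1 /= h1]; rewrite /U /=.
  - by rewrite scale0r; apply: ksub0.
  - by rewrite scalerDl; apply: ksubD.
  - by have := ksubZ c sU h1; rewrite scalerA.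
suff YU : tspans q Y l `<=` U by apply: YU; apply: hY.
apply: (tspans_sub sU') => b y yY _ [->|[i [s [el si ->]]]]; rewrite /U /=.
  by rewrite scale0r; apply: ksub0.
apply: (tspans_mem q0 qD qs (a := b + a) (v := (y : A) *: v)).
  by apply/allpairsP; exists ((b, y), (a, v)).
by right; exists i, s; split; [rewrite addnA el|by []|rewrite scalerA].
Qed.

End TwistedGeneration.

(** * Comparison of consecutive Frobenius powers *)

Section Characteristic.
Context {k : fieldType} {A : comAlgType k} (GA : nat -> set A) (D : nat).
Context (F : graded_facts GA D.+2).
Context (p : nat) (p_char : p \in [pchar k]).
Context (k_perfect : forall a : k, exists b, b ^+ p = a).

Let p_prime : prime p. Proof. exact: pcharf_prime p_char. Qed.

Lemma frob_expD e (a b : A) : (a + b) ^+ (p ^ e) = a ^+ (p ^ e) + b ^+ (p ^ e).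
Proof.
apply: exprDn_pchar; apply/pnatP => [|x px]; first by rewrite expn_gt0 prime_gt0.
rewrite Euclid_dvdX// => /andP[xp _]; rewrite pchar_lalg.
by move: xp; rewrite dvdn_prime2// => /eqP ->.
Qed.

Lemma frob_exp_surj e (c : k) : exists b, b ^+ (p ^ e) = c.
Proof.
elim: e c => [|e IH] c; first by exists c; rewrite expr1.
have [b <-] := k_perfect c; have [a <-] := IH b.
by exists a; rewrite expnSr exprM.
Qed.

Lemma frob_gt0 e : (0 < p ^ e)%N.
Proof. by rewrite expn_gt0 prime_gt0. Qed.

Lemma frob_decomp e (M : lmodType A) (G N0 : nat -> set M) V :
  gmod GA G -> gmod GA N0 -> gsub N0 G -> generates GA 1 G V ->
  (forall Q, big GA D Q -> exists t c, [/\ GA t c, ~ Q t c &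
    forall i b j u, Q i b -> G j u ->
      N0 ((t + i) * p ^ e + j)%N ((c * b) ^+ (p ^ e) *: u)]) ->
  exists L, List.Forall (block_prime GA D (p ^ e) G N0) L /\
    decomp GA D (p ^ e) N0 G L.
Proof.
move=> gG gN NG gV star.
have fG m : kfin (G m).
  apply: kfin_sub (gV.2 m) _.
  by case: (tspans_subspace F (ltn0Sn 0) frob1D frob1_surj V m).
have [N hN] := big_avoid_all F.
(* This degree is 1 modulo p^e and at least [N], so a suitable y exists in it; [tau] is [N]. *)
have [|y [yd ybig]] := hN (N * p ^ e + 1)%N.
  by rewrite (leq_trans _ (leq_addr _ _))// leq_pmulr// frob_gt0.
have [Y [YG hY]] := generates_frob F (frob_gt0 e) (frob_expD e) (frob_exp_surj e) gG gV.
apply: (hdim_decomp F (frob_gt0 e) (frob_expD e) (frob_exp_surj e) yd ybig gG gN NG fG star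
  (a := fun j : 'I_(size Y) => (nth (0%N, 0) Y j).1)
  (v := fun j : 'I_(size Y) => (nth (0%N, 0) Y j).2)).
  by move=> j; apply: YG; rewrite mem_nth.
by move=> m u /hY /tspans_ord.
Qed.

(** Block primes contain P, which annihilates the module, hence equal P by minimality. The list of
    blocks does not depend on [fs], so its size can be found from [fs = [::]], where [udim] is the
    Hilbert function of R/P. *)
Lemma udim_frob P fs : big GA D P -> homog GA fs ->
  capx D (fun n m => udim GA P fs (n * p) m)
         (fun n m => p ^ D.+1 * udim GA P fs n (m %/ p))%N.
Proof.
move=> bP hfs; have [pP nP] := bP; have [gP P1 hP] := pP.
have [Y gY] := generates_ring F (ltn0Sn 0) frob1D frob1_surj.
have [|L [bL dL]] := @frob_decomp 1 A^o GA P Y (gmod_GA F) gP.1 gP.2 gY.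
  (* If Q = P, then c = 1 serves, as p-th powers of elements of P are in P; otherwise c is taken in
     P outside Q. *)
  move=> Q bQ; have [[gQ Q1 hQ] _] := bQ; rewrite expn1.
  have [PQ|PQ] := pselect (gsub P Q).
    have eQ := big_prime_sub F bQ pP PQ.
    exists 0%N, 1; split=> // [|i b j u Qb uj]; first exact: ga1 F.
    rewrite mul1r add0n; apply: (gideal_mulr gP uj); rewrite eQ.
    apply: (gideal_exp F) => //; exact: prime_gt0.
  have [t [c [Pc Qc]]] : exists t c, P t c /\ ~ Q t c.
    apply: contrapT => h; apply: PQ => t c Pc; apply: contrapT => Qc.
    by apply: h; exists t, c.
  exists t, c; split=> // [|i b j u Qb uj]; first exact: gideal_sub Pc.
  apply: (gideal_mulr gP uj); apply: (gideal_exp F); [exact: prime_gt0|by []|].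
  exact: (gideal_mulr gP (gideal_sub gQ Qb) Pc).
have eL n m fs' : (\sum_(Q <- L) udim GA Q fs' n m = size L * udim GA P fs' n m)%N.
  elim: L bL {dL} => [|Q L IH] hL; first by rewrite big_nil.
  inversion hL as [|Q' L' [bQ hQ] hL']; subst.
  rewrite big_cons IH//= mulSn; congr (udim _ _ _ _ _ + _)%N.
  apply/esym/(big_prime_sub F bQ pP) => i b Pb; apply: hQ; first exact: gideal_sub Pb.
  move=> j u uj; apply: (gideal_mulr gP uj); apply: (gideal_exp F) => //.
  by rewrite expn1 prime_gt0.
have hnil' n m : udim GA P [::] n m = hilb GA P m.
  by rewrite /udim /hdim /= ksum_set0.
(* The growth of the Hilbert function of [R/P] determines the number of blocks. *)
suff sL : size L = (p ^ D.+1)%N.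
  apply: capx_ext (dL fs hfs) => n m; first by rewrite expn1.
  by rewrite eL sL expn1.
have [C hC] : capx D (fun n m => hilb GA P m) (fun n m => size L * hilb GA P (m %/ p))%N.
  apply: capx_ext (dL [::] _) => // n m.
  by rewrite eL hnil' expn1.
have p0 := prime_gt0 p_prime.
have hpm m : (C * (p * m).+1 ^ D <= C * p ^ D * m.+1 ^ D)%N.
  by rewrite -mulnA leq_mul2l -expnMn leq_exp2 ?orbT// mulnS; lia.
apply: (evpoly_scale (F := hilb GA P) (C := (C * p ^ D)%N) p0).
- exact: hilb_evpoly_dim F _ gP.
- move=> C'; apply: contrapT => h; apply: nP; exists C' => m.
  by rewrite leqNgt; apply/negP => hm; apply: h; exists m.
- move=> m; have [+ _] := hC 0%N (p * m)%N; rewrite mulKn// => /leq_trans; apply.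
  by rewrite leq_add2l.
- move=> m; have [_ +] := hC 0%N (p * m)%N; rewrite mulKn// => /leq_trans; apply.
  by rewrite leq_add2l.
Qed.

Section Module.
Context (M : lmodType A) (G : nat -> set M) (V : seq (nat * M)).
Context (gG : gmod GA G) (gV : generates GA 1 G V).
Let N0 : nat -> set M := fun=> [set 0].

(* Big primes kill nilpotently after localization, hence they kill once the
   Frobenius twist is iterated often enough. *)
Lemma hdim_frob_decomp : exists e L, List.Forall (big GA D) L /\
  decomp GA D (p ^ e) N0 G L.
Proof.
have gN : gmod GA N0.
  by split=> [i|i j a v _ ->]; [exact: ksub_set0|rewrite scaler0].
have NG : gsub N0 G by move=> i v ->; apply: ksub0 (gG.1 i).
have [N hN] := big_nilpotent F (gideal0 F).
have [|L [bL dL]] := @frob_decomp N M G N0 V gG gN NG gV.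
  move=> Q bQ; have [t [c [ct Qc hc]]] := hN Q bQ.
  exists t, c; split=> // i b j u Qb uj; rewrite /N0 /=.
  have Np : (N <= p ^ N)%N by rewrite ltnW// ltn_expl// prime_gt1.
  have e0 : c * b ^+ N = 0 := hc _ _ Qb.
  have ec : c ^+ (p ^ N) = c ^+ (p ^ N).-1 * c by rewrite -exprSr (prednK (frob_gt0 N)).
  have eb : b ^+ (p ^ N) = b ^+ (p ^ N - N) * b ^+ N by rewrite -exprD subnK.
  by rewrite exprMn ec eb mulrACA e0 mulr0 scale0r.
exists N, L; split=> //; elim: bL => [|Q L' [bQ _] _ IH]; first exact: List.Forall_nil.
exact: List.Forall_cons.
Qed.

(** The decomposition concerns exponents divisible by p^e, hence the shift n + e. Both estimates
    pass through the sum over the blocks: the first applies [udim_frob] to each block and uses that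
    the divisions by p and by p^e commute, the second applies [udim_step], as m/p^e grows by at most
    one. *)
Lemma hdim_estimates fs : homog GA fs -> exists e,
  capx D (fun n m => hdim G N0 fs (p ^ (n + e).+1) m)
         (fun n m => p ^ D.+1 * hdim G N0 fs (p ^ (n + e)) (m %/ p))%N /\
  capx D (fun n m => hdim G N0 fs (p ^ (n + e)) m.+1)
         (fun n m => hdim G N0 fs (p ^ (n + e)) m).
Proof.
move=> hfs; have [e [L [bL dL]]] := hdim_frob_decomp; exists e.
have d1 := dL fs hfs; set q := (p ^ e)%N in d1.
have eq n : (p ^ (n + e) = p ^ n * q)%N by rewrite expnD.
have eq' n : (p ^ (n + e).+1 = p ^ n * p * q)%N by rewrite expnS eq; lia.
split.
  have r1 := @capx_reindex D _ _ (fun n => (p ^ n * p)%N) (id) (@leqnn) d1.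
  have r2 := @capx_reindex D _ _ (fun n => (p ^ n)%N) (fun m => (m %/ p)%N)
    (fun m => leq_div m p) d1.
  have rs : capx D (fun n m => \sum_(P <- L) udim GA P fs (p ^ n * p) (m %/ q))%N
      (fun n m => \sum_(P <- L) p ^ D.+1 * udim GA P fs (p ^ n) (m %/ q %/ p))%N.
    apply: (@capx_sum D _ L (fun P n m => udim GA P fs (p ^ n * p) (m %/ q))
      (fun P n m => p ^ D.+1 * udim GA P fs (p ^ n) (m %/ q %/ p))%N).
    elim: bL => [|P L' bP _ IH]; first exact: List.Forall_nil.
    apply: List.Forall_cons => //.
    exact: (@capx_reindex D _ _ (fun n => (p ^ n)%N) (fun m => (m %/ q)%N)
      (fun m => leq_div m q) (udim_frob bP hfs)).
  have r3 := capx_mul (p ^ D.+1) (capx_sym r2).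
  have r4 := capx_trans r1 rs.
  have e3 n m : (\sum_(P <- L) p ^ D.+1 * udim GA P fs (p ^ n) (m %/ q %/ p) =
      p ^ D.+1 * \sum_(P <- L) udim GA P fs (p ^ n) (m %/ p %/ q))%N.
    by rewrite big_distrr /=; apply: eq_bigr => P _; rewrite -!divnMA [(q * p)%N]mulnC.
  have r5 := capx_trans (capx_ext (fun _ _ => erefl) e3 r4) r3.
  apply: capx_ext r5 => n m /=; last by rewrite eq.
  by rewrite eq'.
have r1 := @capx_reindex D _ _ (fun n => (p ^ n)%N) (id) (@leqnn) d1.
have r2 : capx D (fun n m => hdim G N0 fs (p ^ n * q) m.+1)
    (fun n m => \sum_(P <- L) udim GA P fs (p ^ n) (m.+1 %/ q))%N.
  (* The factor 2^D pays for replacing m + 2 by m + 1 in the error. *)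
  have [C hC] := r1; exists (C * 2 ^ D)%N => n m; have [h1 h2] := hC n m.+1.
  have h3 : (C * m.+2 ^ D <= C * 2 ^ D * m.+1 ^ D)%N.
    by rewrite -mulnA leq_mul2l -expnMn leq_exp2 ?orbT//; lia.
  split; [apply: (leq_trans h1)|apply: (leq_trans h2)]; rewrite leq_add2l//.
have rs : capx D (fun n m => \sum_(P <- L) udim GA P fs (p ^ n) (m.+1 %/ q))%N
    (fun n m => \sum_(P <- L) udim GA P fs (p ^ n) (m %/ q))%N; last first.
  by apply: capx_ext (capx_trans r2 (capx_trans rs (capx_sym r1))) => n m /=; rewrite eq.
apply: (@capx_sum D _ L (fun P n m => udim GA P fs (p ^ n) (m.+1 %/ q))
      (fun P n m => udim GA P fs (p ^ n) (m %/ q))%N).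
elim: bL => [|P L' bP _ IH]; first exact: List.Forall_nil.
apply: List.Forall_cons => //.
have [C hC] := udim_step F bP hfs; exists (C * 2 ^ D)%N => n m.
have q0 : (0 < q)%N by apply: frob_gt0.
have [->|->] : (m.+1 %/ q)%N = (m %/ q)%N \/ (m.+1 %/ q)%N = (m %/ q).+1.
  by rewrite divnS//; case: (q %| _)%N; [right|left].
  by split; rewrite leq_addr.
have [h1 h2] := hC (p ^ n)%N (m %/ q)%N.
have h3 : (C * (m %/ q).+2 ^ D <= C * 2 ^ D * m.+1 ^ D)%N.
  rewrite -mulnA leq_mul2l -expnMn leq_exp2 ?orbT//.
  by have := leq_div m q; lia.
by split; [apply: (leq_trans h1)|apply: (leq_trans h2)]; rewrite leq_add2l.
Qed.

End Module.

End Characteristic.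

(** * Vanishing of the quotients in degrees beyond a multiple of q *)

Section FsumIdeal.
Context {k : fieldType} {A : comAlgType k} (GA : nat -> set A) (D : nat).
Context (F : graded_facts GA D.+2).
Implicit Types (fs : seq (nat * A)).

Lemma gmod_fsum (M : lmodType A) (G : nat -> set M) fs n : gmod GA G ->
  gmod GA (fsum G fs n).
Proof.
move=> gG; split=> [i|i j a v ai]; first exact: ksub_fsum gG.1.
elim: fs v => [|fn fs IH] v /=; first by move=> ->; rewrite scaler0.
move=> [u [w [hu /IH hw ->]]].
rewrite (@scalerDr A M); exists (a *: u), (a *: w); split=> //.
case: hu => [->|[l [x [<- Gx ->]]]]; first by left; apply: (@scaler0 A M).
right; exists (i + l)%N, (a *: x); split; [by rewrite addnA|exact: gG.2|].
by rewrite !scalerA mulrC.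
Qed.

Lemma fsum_scale (M : lmodType A) (G : nat -> set M) fs n l a r v : gmod GA G ->
  fsum (GA : nat -> set A^o) fs n l r -> G a v -> fsum G fs n (l + a)%N (r *: v).
Proof.
move=> gG + Gv; elim: fs r => [|fn fs IH] r /=; first by move=> ->; rewrite scale0r.
move=> [u [w [hu /IH hw ->]]].
rewrite (@scalerDl A M); exists (u *: v), (w *: v); split=> //.
case: hu => [->|[i [x [<- Gx ->]]]]; first by left; apply: (@scale0r A M).
right; exists (i + a)%N, (x *: v); split; [lia|exact: gG.2|].
by rewrite scalerA.
Qed.

Lemma fsum_frob fs q m a : (0 < q)%N ->
  (forall a b : A, (a + b) ^+ q = a ^+ q + b ^+ q) ->
  fsum (GA : nat -> set A^o) fs 1 m a -> fsum (GA : nat -> set A^o) fs q (m * q)%N (a ^+ q).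
Proof.
move=> q0 qD; elim: fs a => [|fn fs IH] a /=.
  by move=> ->; rewrite /= expr0n eqn0Ngt q0.
move=> [u [w [hu /IH hw ->]]]; rewrite qD; exists (u ^+ q), (w ^+ q); split=> //.
case: hu => [->|[l [x [<- xl ->]]]]; first by left; rewrite expr0n eqn0Ngt q0.
right; exists (l * q)%N, (x ^+ q); split; [by rewrite muln1 mulnDl|exact: (ga_exp F q xl)|].
by rewrite expr1 exprMn.
Qed.

(** In degrees above s N q every ring element is a combination of the X_j^(N q). As N > m0, each
    X_j^N is in the ideal generated by [fs], and its q-th power is in the one generated by the
    f^q. *)
Lemma hdim_vanish (p : nat) (M : lmodType A) (G : nat -> set M) V fs m0 :
  p \in [pchar k] -> gmod GA G -> generates GA 1 G V ->
  (forall m, (m0 <= m)%N -> GA m `<=` fsum (GA : nat -> set A^o) fs 1 m) ->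
  exists B, forall n m, (B * p ^ n <= m)%N -> G m `<=` fsum G fs (p ^ n) m.
Proof.
move=> pc gG [VG hV] hm0; have [s [X [X1 hX]]] := ga_pigeonhole F.
pose N := m0.+1; pose S := (\sum_(av <- V) av.1)%N.
(* The 1 provides the strict inequality that [ga_pigeonhole] asks for; S bounds the degrees of the
   module generators. *)
exists (s * N + 1 + S)%N => n m hm; set q := (p ^ n)%N in hm *.
have q0 : (0 < q)%N := frob_gt0 pc n.
have gf := gmod_fsum fs q gG.
have gfA := gmod_fsum fs q (gmod_GA F).
have hA l : (s * N * q < l)%N -> GA l `<=` fsum (GA : nat -> set A^o) fs q l.
  move=> hl a al; have [|b [hb ->]] := hX (N * q)%N l a _ al; first by rewrite mulnA.
  apply: (@ksub_sum k A A^o); first exact: gfA.1.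
  move=> j _; have Nl : (N * q <= l)%N.
    rewrite (leq_trans _ (ltnW hl))// leq_mul2r (leq_pmull N) ?orbT//.
    by rewrite (leq_ltn_trans _ (ltn_ord j)).
  rewrite -(subnK Nl) exprM; apply: gfA.2; first exact: hb.
  apply: fsum_frob => //; first exact: (frob_expD pc n).
  apply: hm0; first exact: leqnSn.
  by have := ga_exp F N (X1 j); rewrite mul1n.
move=> u /hV; apply: (tspans_sub (q := 1)) => [|a v vV _ [->|[l [r [e rl ->]]]]].
- exact: gf.1.
- exact: ksub0 (gf.1 m).
rewrite expr1 -e muln1; apply: fsum_scale => //; last exact: (VG _ vV).
apply: hA => //; have aS : (a <= S)%N.
  rewrite /S; elim: (V) vV => // -[a' v'] V' IH.
  rewrite in_cons big_cons => /orP[/eqP[-> _]|/IH h]; first exact: leq_addr.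
  by rewrite (leq_trans h)// leq_addl.
have Sq : (S <= S * q)%N by rewrite leq_pmulr.
by move: hm; rewrite -e !mulnDl mul1n; lia.
Qed.

End FsumIdeal.

(** * Homogeneous components *)

Section Components.
Context {V : zmodType} (G : nat -> set V).
Context (dG : direct_sum G).

Definition is_decomp (x : V) (c : nat -> V) := (forall i, G i (c i)) /\
  exists n, (forall i, (n <= i)%N -> c i = 0) /\ x = \sum_(i < n) c i.

Definition hcomp i x := xget 0 [set v | exists c, is_decomp x c /\ c i = v].

Lemma decomp_uniq x c c' : is_decomp x c -> is_decomp x c' -> c = c'.
Proof.
by have [_ /(_ x)[c0 [_ hc]]] := dG => /hc <- /hc <-.
Qed.

Lemma comp_decomp x : is_decomp x (hcomp^~ x).
Proof.
have [_ /(_ x)[c [hc _]]] := dG; rewrite (_ : hcomp^~ x = c)//.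
apply/funext => i; rewrite /hcomp; case: xgetP => [v _ [c' [hc' <-]]|/(_ (c i))[]].
  by rewrite (decomp_uniq hc' hc).
by exists c.
Qed.

Lemma comp_uniq x c i : is_decomp x c -> hcomp i x = c i.
Proof. by move=> h; rewrite -(decomp_uniq (comp_decomp x) h). Qed.

Lemma comp_in i x : G i (hcomp i x). Proof. by have [h _] := comp_decomp x. Qed.

Lemma dsum0 i : G i 0.
Proof. by have [/(_ i)[]] := dG; rewrite inE. Qed.

Lemma dsumB i u v : G i u -> G i v -> G i (u - v).
Proof.
have [/(_ i)[_ h] _] := dG => Gu Gv.
by have := h u v; rewrite !inE; apply.
Qed.

Lemma dsumD i u v : G i u -> G i v -> G i (u + v).
Proof.
move=> Gu Gv; rewrite -[v]opprK; apply: dsumB => //.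
by rewrite -sub0r; apply: dsumB => //; apply: dsum0.
Qed.

Lemma sum_widen (c : nat -> V) n m : (n <= m)%N -> (forall i, (n <= i)%N -> c i = 0) ->
  \sum_(i < n) c i = \sum_(i < m) c i.
Proof.
move=> nm h; rewrite -!(big_mkord xpredT) (big_cat_nat (leq0n n) nm)/= [X in _ + X]big_nat_cond.
by rewrite [X in _ + X]big1 ?addr0// => i /andP[/andP[ni _] _]; apply: h.
Qed.

Lemma comp_sum x : exists n, forall m, (n <= m)%N -> x = \sum_(i < m) hcomp i x.
Proof.
have [_ [n [h e]]] := comp_decomp x; exists n => m nm.
by rewrite {1}e; apply: (sum_widen (c := hcomp^~ x)).
Qed.

Lemma compD i u v : hcomp i (u + v) = hcomp i u + hcomp i v.
Proof.
apply: (comp_uniq (c := fun i => hcomp i u + hcomp i v)); split.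
  by move=> j; apply: dsumD; apply: comp_in.
have [_ [n [hn en]]] := comp_decomp u; have [_ [m [hm em]]] := comp_decomp v.
exists (n + m)%N; split=> [j hj|]; first by rewrite hn ?hm ?addr0//; lia.
rewrite big_split /=; congr (_ + _).
  by rewrite {1}en; apply: (sum_widen (c := hcomp^~ u)) => //; rewrite leq_addr.
by rewrite {1}em; apply: (sum_widen (c := hcomp^~ v)) => //; rewrite leq_addl.
Qed.

Lemma comp_hom i j v : G i v -> hcomp j v = if i == j then v else 0.
Proof.
move=> Gv; apply: (comp_uniq (c := fun j => if i == j then v else 0)); split.
  by move=> l; case: eqP => [<-//|_]; apply: dsum0.
exists i.+1; split=> [l hl|]; first by rewrite ltn_eqF.
rewrite big_ord_recr /= eqxx big1 ?add0r// => l _.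
by rewrite gtn_eqF.
Qed.

Lemma comp0 i : hcomp i 0 = 0.
Proof. by rewrite (comp_hom _ (dsum0 i)) eqxx. Qed.

Lemma compN i u : hcomp i (- u) = - hcomp i u.
Proof. by apply: (addrI (hcomp i u)); rewrite -compD !subrr comp0. Qed.

Lemma comp_bigsum i (I : Type) (r : seq I) (E : I -> V) :
  hcomp i (\sum_(j <- r) E j) = \sum_(j <- r) hcomp i (E j).
Proof.
elim: r => [|j r IH]; first by rewrite !big_nil comp0.
by rewrite !big_cons compD IH.
Qed.

End Components.

Section GradedModules.
Context {k : fieldType} {A : comAlgType k} (GA : nat -> set A).
Context (A_graded : standard_graded GA).

Let dA : direct_sum GA. Proof. by case: A_graded => -[]. Qed.

Lemma sg_mul i j a b : GA i a -> GA j b -> GA (i + j)%N (a * b).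
Proof. by case: A_graded => -[_ h] _ _; apply: h. Qed.

Lemma sg_scal (c : k) : GA 0%N c%:A.
Proof. by case: A_graded => _ -> _; exists c. Qed.

Lemma sg_zero a : GA 0%N a -> exists c : k, a = c%:A.
Proof. by case: A_graded => _ -> _ [c _ <-]; exists c. Qed.

Lemma graded_gmod (M : lmodType A) (G : nat -> set M) : graded_module GA G -> gmod GA G.
Proof.
move=> [dG mG]; split=> // i; apply: ksubP; first exact: dsum0 dG i.
  by move=> u v; apply: dsumD.
by move=> c u Gu; apply: (mG 0%N) => //; apply: sg_scal.
Qed.

Lemma graded_GA : graded_module GA (GA : nat -> set A^o).
Proof. by case: A_graded. Qed.

Section OneModule.
Context (M : lmodType A) (G : nat -> set M) (gG : graded_module GA G).

Let dG : direct_sum G. Proof. by case: gG. Qed.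

Lemma comp_mul i j a v : GA i a ->
  hcomp G j (a *: v) = if (i <= j)%N then a *: hcomp G (j - i) v else 0.
Proof.
move=> ai; pose c j := if (i <= j)%N then a *: hcomp G (j - i) v else 0.
apply: (comp_uniq dG (c := c)); split=> [l|].
  rewrite /c; case: leqP => [il|_]; last exact: dsum0 dG _.
  by rewrite -{1}(subnKC il); apply: gG.2 => //; apply: comp_in dG _ _.
have [_ [n [hn en]]] := comp_decomp dG v.
exists (i + n)%N; split=> [l hl|].
  by rewrite /c (leq_trans _ hl) ?leq_addr// hn ?scaler0// leq_subRL ?(leq_trans _ hl) ?leq_addr.
rewrite big_split_ord /= big1 ?add0r; last by move=> l _; rewrite /c leqNgt ltn_ord.
rewrite {1}en scaler_sumr; apply: eq_bigr => l _.
by rewrite /c leq_addr addKn.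
Qed.

(** The bridge from graded families to actual submodules, on which Krull dimension, Noetherianity
    and length are defined. *)
Definition tot (U : nat -> set M) : set M := [set v | forall m, U m (hcomp G m v)].

Lemma submoduleP (N : set M) : N 0 -> (forall u v, N u -> N v -> N (u + v)) ->
  (forall a u, N u -> N (a *: u)) -> submodule N.
Proof.
move=> N0 ND NZ; split; first by rewrite inE.
by move=> a u v; rewrite !inE => Nu Nv; apply: ND => //; apply: NZ.
Qed.

Lemma submodule_tot (U : nat -> set M) : gmod GA U -> submodule (tot U).
Proof.
move=> [sU mU].
have tD u v : tot U u -> tot U v -> tot U (u + v).
  by move=> hu hv m; rewrite (compD dG); apply: ksubD.
have t0 : tot U 0 by move=> m; rewrite (comp0 dG); apply: ksub0.
apply: submoduleP => // a u hu.
have [n /(_ n (leqnn n)) ->] := comp_sum dA a.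
rewrite scaler_suml; elim/big_ind: _ => // i _ m.
rewrite (comp_mul _ _ (comp_in dA i a)); case: leqP => [im|_]; last exact: ksub0.
by rewrite -{1}(subnKC im); apply: mU => //; apply: comp_in dA _ _.
Qed.

Lemma tot_hom (U : nat -> set M) m v : gmod GA U -> G m v -> U m v -> tot U v.
Proof.
move=> gU Gv Uv l; rewrite (comp_hom dG _ Gv); case: eqP => [<-//|_].
exact: ksub0 (gU.1 l).
Qed.

Lemma tot_hom_inv (U : nat -> set M) m v : G m v -> tot U v -> U m v.
Proof. by move=> Gv /(_ m); rewrite (comp_hom dG _ Gv) eqxx. Qed.

Lemma submodule0 (N : set M) : submodule N -> N 0.
Proof. by case; rewrite inE. Qed.

Lemma submoduleD (N : set M) u v : submodule N -> N u -> N v -> N (u + v).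
Proof. by move=> [_ h] Nu Nv; have := h 1 u v; rewrite !inE scale1r; apply. Qed.

Lemma submoduleZ (N : set M) a u : submodule N -> N u -> N (a *: u).
Proof. by move=> [N0 h] Nu; have := h a u 0; rewrite !inE addr0; apply=> //; rewrite inE in N0. Qed.

Lemma submodule_sum (N : set M) (I : Type) (r : seq I) (P : pred I) (E : I -> M) :
  submodule N -> (forall i, P i -> N (E i)) -> N (\sum_(i <- r | P i) E i).
Proof.
move=> sN h; elim/big_rec: _ => [|i x Pi Nx]; first exact: submodule0.
by apply: submoduleD => //; apply: h.
Qed.

Lemma submodule_gen (S : set M) : submodule (submod_gen S).
Proof.
apply: submoduleP.
- by move=> N [sN _]; apply: submodule0.
- by move=> u v hu hv N hN; apply: submoduleD hN.1 (hu _ hN) (hv _ hN).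
- by move=> a u hu N hN; apply: submoduleZ hN.1 (hu _ hN).
Qed.

Lemma submod_gen_sub (S N : set M) : submodule N -> S `<=` N -> submod_gen S `<=` N.
Proof. by move=> sN SN v; apply. Qed.

Lemma sub_submod_gen (S : set M) : S `<=` submod_gen S.
Proof. by move=> v Sv N [_]; apply. Qed.

Lemma submodule_comp (N : set M) v : submodule N -> (forall i, N (hcomp G i v)) -> N v.
Proof.
move=> sN h; have [n /(_ n (leqnn n)) ->] := comp_sum dG v.
exact: submodule_sum.
Qed.

End OneModule.

End GradedModules.

(** * Standard graded Noetherian rings satisfy [graded_facts] *)

Section StandardGradedFacts.
Context {k : fieldType} {A : comAlgType k} (GA : nat -> set A).
Context (A_graded : standard_graded GA) (A_noeth : noetherian A).

Let gA : graded_module GA (GA : nat -> set A^o). Proof. by case: A_graded. Qed.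
Let dA : direct_sum GA. Proof. by case: gA. Qed.
Let mA : gmod GA (GA : nat -> set A^o). Proof. exact: graded_gmod. Qed.

Local Notation atot := (@tot k A A^o GA).

(** By choice, a counterexample starts a strictly increasing sequence of homogeneous ideals; their
    union is finitely generated and so contained in one of them. *)
Lemma noeth_induction (Q : (nat -> set A) -> Prop) :
  (forall J, gideal GA J ->
     (forall J', gideal GA J' -> gproper J J' -> Q J') -> Q J) ->
  forall J, gideal GA J -> Q J.
Proof.
move=> HQ J0 gJ0; apply: contrapT => nQ0.
pose T := {J | gideal GA J /\ ~ Q J}.
have step (t : T) : exists t' : T, gproper (sval t) (sval t').
  case: t => J [gJ nQ] /=; apply: contrapT => h; apply: nQ; apply: HQ => // J' gJ' JJ'.
  by apply: contrapT => nQ'; apply: h; exists (exist _ J' (conj gJ' nQ')).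
have [f hf] := choice step.
pose J n := sval (iter n f (exist _ J0 (conj gJ0 nQ0))).
have gJ n : gideal GA (J n) by rewrite /J; case: (iter _ _ _) => K [].
have JS n : gproper (J n) (J n.+1) by apply: hf.
have Jmono n m : (n <= m)%N -> gsub (J n) (J m).
  elim: m => [|m IH]; first by rewrite leqn0 => /eqP -> i z.
  rewrite leq_eqVlt => /orP[/eqP -> i z //|/IH h].
  by apply: gsub_trans h _; case: (JS m).
have tmono n m : (n <= m)%N -> atot (J n) `<=` atot (J m).
  by move=> /Jmono h a ha i; apply: h.
pose U : set A := [set a | exists n, atot (J n) a].
have sJ n : submodule (atot (J n)) by apply: (submodule_tot A_graded gA); case: (gJ n).
have sU : submodule (U : set A^o).
  apply: submoduleP.
  - by exists 0%N; apply: (submodule0 (sJ 0%N)).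
  - move=> u v [n hn] [m hm]; exists (n + m)%N.
    apply: (submoduleD (sJ (n + m)%N)).
      by apply: tmono hn; rewrite leq_addr.
    by apply: tmono hm; rewrite leq_addl.
  - by move=> a u [n hn]; exists n; apply: (submoduleZ a (sJ n)).
have [s es] := A_noeth sU.
have [N hN] : exists N, [set` s] `<=` atot (J N).
  have : [set` s] `<=` U by rewrite es; apply: sub_submod_gen.
  elim: (s) => [|x s' IH] hs; first by exists 0%N => x.
  have [|N hN] := IH; first by move=> z zs; apply: hs; rewrite /= in_cons [z \in s']zs orbT.
  have [n hn] := hs x (mem_head _ _); exists (n + N)%N => z /=.
  rewrite in_cons => /orP[/eqP ->|zs]; first by apply: tmono hn; rewrite leq_addr.
  by apply: tmono (hN z zs); rewrite leq_addl.
have [i [z [Jz nJz]]] := gproper_ex (JS N).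
have zi : GA i z by apply: gideal_sub Jz.
apply: nJz; suff UN : U `<=` atot (J N).
  apply: (tot_hom_inv gA zi (UN z _)); exists N.+1.
  exact: (tot_hom gA (gJ N.+1).1 zi Jz).
by rewrite es; apply: (submod_gen_sub (sJ N) hN).
Qed.

Lemma gmod_irrelevant : gmod GA (girrelevant GA : nat -> set A^o).
Proof.
split=> [[|i]|i j a b ai bj]; [exact: ksub_set0|exact: mA.1|].
case: i j ai bj => [|i] [|j] ai bj /=.
- by rewrite bj scaler0.
- exact: (sg_mul A_graded ai bj).
- rewrite bj scaler0; exact: dsum0 dA _.
- exact: (sg_mul A_graded ai bj).
Qed.

Lemma submod_gen_seq (M : lmodType A) (s : seq M) v : submod_gen [set` s] v ->
  exists b : 'I_(size s) -> A, v = \sum_j b j *: s`_j.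
Proof.
pose N : set M := [set u | exists b : 'I_(size s) -> A, u = \sum_j b j *: s`_j].
suff sN : submod_gen [set` s] `<=` N by apply: sN.
apply: submod_gen_sub => [|x /= xs].
  apply: submoduleP.
  - by exists (fun=> 0); rewrite big1// => j _; rewrite scale0r.
  - move=> _ _ [b ->] [c ->]; exists (fun j => b j + c j).
    by rewrite -big_split; apply: eq_bigr => j _; rewrite scalerDl.
  - move=> a _ [b ->]; exists (fun j => a * b j).
    by rewrite scaler_sumr; apply: eq_bigr => j _; rewrite scalerA.
have xlt : (index x s < size s)%N by rewrite index_mem.
exists (fun j => (j == Ordinal xlt)%:R).
rewrite (bigD1 (Ordinal xlt))//= eqxx scale1r nth_index// big1 ?addr0// => j /negPf ->.
by rewrite scale0r.
Qed.

Lemma comp1_mul b x : hcomp GA 0 x = 0 -> hcomp GA 1 (b * x) = hcomp GA 0 b * hcomp GA 1 x.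
Proof.
move=> x0; have [n hn] := comp_sum dA b.
rewrite {1}(hn n.+2) ?leqW// mulr_suml (comp_bigsum dA) !big_ord_recl big1 ?addr0.
  rewrite !(comp_mul gA _ _ (comp_in dA _ _)) /= subnn.
  by rewrite [hcomp (GA : nat -> set A^o) 0 x]x0 scaler0 addr0.
move=> i _; rewrite (comp_mul gA _ _ (comp_in dA _ _)) //.
Qed.

(** The irrelevant ideal is finitely generated, and the linear components of its generators span
    R_1. The elements whose components of positive degree are combinations of these linear forms
    make up a subalgebra; it contains R_1 and is therefore the whole ring. *)
Lemma sg_gen : exists s (X : 'I_s -> A), (forall j, GA 1%N (X j)) /\
    forall m a, GA m.+1 a ->
      exists b : 'I_s -> A, (forall j, GA m (b j)) /\ a = \sum_j b j * X j.
Proof.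
have [s es] := A_noeth (submodule_tot A_graded gA gmod_irrelevant).
pose X (j : 'I_(size s)) : A := hcomp GA 1 s`_j.
exists (size s), X; split=> [j|]; first exact: comp_in dA _ _.
pose T m := [set u | exists b : 'I_(size s) -> A, (forall j, GA m (b j)) /\
  u = \sum_j b j * X j].
have TD m u v : T m u -> T m v -> T m (u + v).
  move=> [b [hb ->]] [c [hc ->]]; exists (fun j => b j + c j); split.
    by move=> j; apply: dsumD.
  by rewrite -big_split; apply: eq_bigr => j _; rewrite mulrDl.
have T0 m : T m 0.
  exists (fun=> 0); split; first by move=> j; apply: dsum0 dA _.
  by rewrite big1// => j _; rewrite mul0r.
have TM i m c u : GA i c -> T m u -> T (i + m)%N (c * u).
  move=> ci [b [hb ->]]; exists (fun j => c * b j); split.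
    by move=> j; apply: (sg_mul A_graded).
  by rewrite mulr_sumr; apply: eq_bigr => j _; rewrite mulrA.
pose S : set A := [set a | forall m, T m (hcomp GA m.+1 a)].
suff ST : S = setT.
  move=> m a am; have : S a by rewrite ST.
  by move=> /(_ m); rewrite (comp_hom dA _ am) eqxx.
case: A_graded => _ _; apply; last first.
  move=> a a1 m; rewrite (comp_hom dA _ a1); case: eqP => [[<-]|_ //].
  have : submod_gen [set` s] a by rewrite -es; apply: (tot_hom gA gmod_irrelevant a1).
  move=> /submod_gen_seq[b eb]; exists (fun j => hcomp GA 0 (b j)); split.
    by move=> j; apply: comp_in dA _ _.
  have -> : a = hcomp GA 1 a by rewrite (comp_hom dA _ a1).
  rewrite eb (comp_bigsum dA); apply: eq_bigr => j _.
  apply: comp1_mul; have : submod_gen [set` s] s`_j.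
    by apply: sub_submod_gen; rewrite /= mem_nth.
  by rewrite -es => /(_ 0%N).
have one0 : GA 0%N 1 by have := sg_scal A_graded 1; rewrite scale1r.
split.
- by rewrite inE => m; rewrite (comp_hom dA _ one0).
- move=> c u v; rewrite !inE => Su Sv m.
  rewrite (compD dA) -mulr_algl (comp_mul gA _ u (sg_scal A_graded c)) /= subn0.
  by apply: TD => //; apply: (TM 0%N) => //; apply: sg_scal.
- move=> u v; rewrite !inE => Su Sv m.
  have [n /(_ n (leqnn n)) ->] := comp_sum dA u.
  have [n' /(_ n' (leqnn n')) ->] := comp_sum dA v.
  rewrite mulr_suml (comp_bigsum dA).
  apply: (big_ind (T m)) => [||i _]; [exact: T0|exact: TD|].
  rewrite mulr_sumr (comp_bigsum dA).
  apply: (big_ind (T m)) => [||j _]; [exact: T0|exact: TD|].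
  have ui := comp_in dA i u; have vj := comp_in dA j v.
  rewrite (comp_hom dA _ (sg_mul A_graded ui vj)); case: eqP => // e.
  case: (nat_of_ord i) (nat_of_ord j) ui vj e => [|i'] [|j'] ui vj // e.
  - by rewrite (_ : m = 0 + j')%N; [apply: TM|lia].
  - by rewrite mulrC (_ : m = 0 + i')%N; [apply: TM|lia].
  - by rewrite mulrC (_ : m = j'.+1 + i')%N; [apply: TM|lia].
Qed.

(** If neither u nor v belongs to the ideal, let i and j be the least degrees in which their
    components are outside P. In degree i + j, the product u v is the product of these two
    components up to terms with a factor in P. *)
Lemma prime_tot P : hprime GA P -> prime_ideal (atot P).
Proof.
move=> [gP P1 hP]; have sP := submodule_tot A_graded gA gP.1.
have one0 : GA 0%N 1 by have := sg_scal A_graded 1; rewrite scale1r.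
split; first split.
- by rewrite inE; apply: (submodule0 sP).
- by apply/negP; rewrite inE => h; apply: P1; apply: (tot_hom_inv gA one0 h).
- move=> a u v; rewrite !inE => hu hv.
  by apply: (submoduleD sP) => //; apply: (submoduleZ a sP).
move=> u v; rewrite inE => huv; apply/orP; rewrite !inE.
apply: contrapT => /not_orP[hu hv].
have minimal w : ~ atot P w -> exists i, ~ P i (hcomp GA i w) /\
    forall j, (j < i)%N -> P j (hcomp GA j w).
  move=> /existsNP[n0 hn0].
  have ex : exists i, ~~ `[< P i (hcomp GA i w) >] by exists n0; apply/asboolPn.
  have := ex_minnP ex; case=> i /asboolPn hi imin; exists i; split=> // j ji.
  apply: contrapT => /asboolPn /imin; lia.
have [i [hi imin]] := minimal u hu; have [j [hj jmin]] := minimal v hv.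
have ui := comp_in dA i u; have vj := comp_in dA j v.
suff : P (i + j)%N (hcomp GA i u * hcomp GA j v) by move=> /(hP _ _ _ _ ui vj)[].
have := huv (i + j)%N; have [n hn] := comp_sum dA u.
rewrite {1}(hn (n + i).+1) ?(leqW (leq_addr _ _))// mulr_suml (comp_bigsum dA).
have ilt : (i < (n + i).+1)%N by rewrite ltnS leq_addl.
rewrite (bigD1 (Ordinal ilt))//= (comp_mul gA _ v ui) leq_addr addKn => h.
set Z := \sum_(_ | _) _ in h.
rewrite -[X in P _ X](addrK Z); apply: (ksubB (gideal_ksub (i + j) gP)) h _.
apply: (@ksub_sum k A A^o) => [|l /eqP li]; first exact: gideal_ksub gP.
have ul := comp_in dA l u.
rewrite (comp_mul gA _ v ul); case: leqP => [lij|_]; last first.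
  exact: ksub0 (gideal_ksub _ gP).
have li' : (l : nat) <> i by move=> e; apply: li; apply: val_inj.
have [lti|gti] := ltnP l i.
  rewrite -{1}(subnKC lij); apply: (gideal_mulr gP (comp_in dA _ _) (imin _ lti)).
rewrite -{1}(subnKC lij); apply: (gideal_mul gP ul); apply: jmin; lia.
Qed.

Lemma krull_chain (R : realType) d n (P : nat -> nat -> set A) : krull_dim A R = d%:R%:E ->
  (forall i, (i <= n)%N -> hprime GA (P i)) ->
  (forall i, (i < n)%N -> gproper (P i) (P i.+1)) -> (n <= d)%N.
Proof.
move=> dimA P1 P2.
suff : (n%:R%:E <= krull_dim A R)%E by rewrite dimA lee_fin ler_nat.
apply: ereal_sup_ubound; exists n => //.
exists (fun i => atot (P i)); split=> [i /P1|i lt_in]; first exact: prime_tot.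
have [PP' _] := P2 _ lt_in.
split; first by move=> a ha j; apply: PP'.
have [j [z [P'z Pz]]] := gproper_ex (P2 _ lt_in) => h.
have gP' := hprime_gideal (P1 _ lt_in).
have zj := gideal_sub gP' P'z.
by apply: Pz; apply: (tot_hom_inv gA zj); apply: h; apply: (tot_hom gA gP'.1 zj).
Qed.

Lemma sg_facts (R : realType) d : krull_dim A R = d%:R%:E -> graded_facts GA d.
Proof.
move=> dimA; split.
- exact: mA.1.
- by move=> i j a b; apply: sg_mul.
- by have := sg_scal A_graded 1; rewrite scale1r.
- exact: sg_zero.
- exact: sg_gen.
- exact: noeth_induction.
- by move=> n P; apply: krull_chain dimA.
Qed.

End StandardGradedFacts.

(** * Homogeneous generators of I and of its Frobenius powers *)

Section HomogeneousIdeal.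
Context {k : fieldType} {A : comAlgType k} (GA : nat -> set A) (D : nat).
Context (A_graded : standard_graded GA) (A_noeth : noetherian A).
Context (F : graded_facts GA D.+2).
Context (I : set A) (I_homog : homogeneous_ideal GA I).

Let gA : graded_module GA (GA : nat -> set A^o). Proof. by case: A_graded. Qed.
Let dA : direct_sum GA. Proof. by case: gA. Qed.

Lemma homogeneous_seq (M : lmodType A) (G : nat -> set M) (s : seq M) :
  graded_module GA G ->
  exists V : seq (nat * M), [/\ forall av, av \in V -> G av.1 av.2,
    forall av, av \in V -> exists2 x, x \in s & av.2 = hcomp G av.1 x
  & forall x i, x \in s -> hcomp G i x = 0 \/ (i, hcomp G i x) \in V].
Proof.
move=> [dG mG]; elim: s => [|x s [V [VG Vs sV]]]; first by exists [::].
have [_ [n [hn _]]] := comp_decomp dG x.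
exists ([seq (i, hcomp G i x) | i <- iota 0 n] ++ V); split.
- move=> av; rewrite mem_cat => /orP[/mapP[i _ ->]|/VG//]; exact: comp_in dG _ _.
- move=> av; rewrite mem_cat => /orP[/mapP[i _ ->]|/Vs[z zs e]].
    by exists x; rewrite ?mem_head.
  by exists z; rewrite // in_cons zs orbT.
- move=> z i; rewrite in_cons => /orP[/eqP ->|zs].
    have [ni|ilt] := leqP n i; first by left; apply: hn.
    by right; rewrite mem_cat map_f// mem_iota.
  by have [|h] := sV z i zs; [left|right; rewrite mem_cat h orbT].
Qed.

Lemma ideal_sub : submodule (I : set A^o).
Proof. by have [S [_ ->]] := I_homog; apply: submodule_gen. Qed.

Lemma ideal_comp a i : I a -> I (hcomp GA i a).
Proof.
have sI := ideal_sub.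
pose J : nat -> set A^o := fun m => I `&` GA m.
have gJ : gmod GA J.
  have mA := graded_gmod A_graded gA.
  split=> [m|l j b u bl [Iu uj]].
    apply: ksubP; first by split; [apply: (submodule0 sI)|apply: dsum0 dA _].
      by move=> u v [Iu um] [Iv vm]; split; [apply: (submoduleD sI)|apply: dsumD].
    move=> c u [Iu um]; split; first exact: (submoduleZ _ sI).
    exact: (ksubZ c (mA.1 m) um).
  by split; [apply: (submoduleZ b sI Iu)|apply: (sg_mul A_graded bl uj)].
suff : I `<=` @tot k A A^o GA J by move=> IJ /IJ /(_ i)[].
have [S [Shom eI]] := I_homog.
rewrite {1}eI; apply: (@submod_gen_sub k A A^o _ _ (submodule_tot A_graded gA gJ)) => x Sx.
have [j _ xj] := Shom x Sx.
apply: (tot_hom gA gJ xj); split=> //.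
by rewrite eI; apply: sub_submod_gen.
Qed.

(** Generation is phrased as an induction principle, ready for ideals such as the set of all a with
    a^q v in a given submodule. *)
Lemma ideal_gens : exists fs, [/\ homog GA fs, forall fn, fn \in fs -> I fn.2
  & forall N : set A^o, submodule N -> (forall fn, fn \in fs -> N fn.2) -> I `<=` N].
Proof.
have [s es] := A_noeth ideal_sub.
have [fs [fG fs_s s_fs]] := homogeneous_seq s gA.
exists fs; split=> //.
  move=> fn /fs_s[x xs ->]; apply: ideal_comp; rewrite es.
  exact: sub_submod_gen.
move=> N sN hN; rewrite es; apply: (@submod_gen_sub k A A^o _ _ sN) => x /= xs.
apply: (submodule_comp gA sN) => i; have [->|/hN//] := s_fs x i xs.
exact: submodule0.
Qed.

Section FrobeniusPower.
Context (p : nat) (p_char : p \in [pchar k]).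
Context (fs : seq (nat * A)) (fs_homog : homog GA fs) (fs_I : forall fn, fn \in fs -> I fn.2).
Context (fs_gen : forall N : set A^o, submodule N ->
  (forall fn, fn \in fs -> N fn.2) -> I `<=` N).
Context (M : lmodType A) (G : nat -> set M) (gG : graded_module GA G).

Let dG : direct_sum G. Proof. by case: gG. Qed.
Let mG : gmod GA G. Proof. exact: graded_gmod. Qed.

Lemma fsum_mem fn n m (w : M) l : fn \in fs -> G l w -> (l + fn.1 * n)%N = m ->
  fsum G fs n m (fn.2 ^+ n *: w).
Proof.
move=> ffs Gw e; elim: (fs) ffs => // gn gs IH; rewrite in_cons /=.
have sG := mG.1; move=> /orP[/eqP <-|/IH h].
  by apply: ksuml; [apply: ksub_fsum|right; exists l, w].
by apply: ksumr => //; apply: ksub_shiftmul.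
Qed.

(** The a with a^q M inside the sum of the f^q M form an ideal, because the q-th power map is
    additive; it contains the generators of I, hence I. *)
Lemma tot_fsum n x (v : M) : I x -> tot G (fsum G fs (p ^ n)) (x ^+ (p ^ n) *: v).
Proof.
move=> Ix; set q := (p ^ n)%N.
have gf := gmod_fsum fs q mG; have sT := submodule_tot A_graded gG gf.
have q0 : (0 < q)%N := frob_gt0 p_char n.
pose N : set A^o := [set a | forall v : M, tot G (fsum G fs q) ((a : A) ^+ q *: v)].
suff : I `<=` N by move=> /(_ x Ix) /(_ v).
apply: fs_gen.
  apply: submoduleP.
  - by move=> w; rewrite expr0n eqn0Ngt q0 scale0r; apply: (submodule0 sT).
  - move=> a b Na Nb w.
    by rewrite (frob_expD p_char n) scalerDl; apply: (submoduleD sT).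
  - move=> a b Nb w; rewrite exprMn -scalerA.
    exact: (submoduleZ _ sT).
move=> fn ffs w m; rewrite (comp_mul gG _ _ (ga_exp F q (fs_homog ffs))).
case: leqP => [le|_]; last exact: ksub0 (gf.1 m).
by apply: (fsum_mem ffs (comp_in dG _ w)); rewrite subnK.
Qed.

Lemma gsub_fsum n : gsub (fsum G fs n) G.
Proof.
move=> m; elim: (fs) fs_homog => [_ u ->|fn gs IH /homog_cons[hf hgs]] /=.
  exact: ksub0 (mG.1 m).
apply: ksum_sub; [exact: mG.1| |exact: IH].
move=> _ [->|[l [w [<- Gw ->]]]]; first exact: ksub0 (mG.1 _).
by rewrite addnC; apply: mG.2 => //; apply: (ga_exp F n hf).
Qed.

Lemma smul_tot n : ideal_smul (frob_power I (p ^ n)) M = tot G (fsum G fs (p ^ n)).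
Proof.
set q := (p ^ n)%N; have gf := gmod_fsum fs q mG.
have sT := submodule_tot A_graded gG gf.
have sJ : submodule (ideal_smul (frob_power I q) M) by apply: submodule_gen.
apply/seteqP; split=> v.
  move: v; apply: (submod_gen_sub sT) => _ [a ha [v _ <-]].
  pose N : set A^o := [set a | tot G (fsum G fs q) ((a : A) *: v)].
  suff : frob_power I q `<=` N by move=> /(_ a ha).
  have sN : submodule N; last first.
    by apply: (@submod_gen_sub k A A^o _ _ sN) => _ [x Ix <-]; apply: tot_fsum.
  apply: submoduleP.
  - by rewrite /N /= scale0r; apply: (submodule0 sT).
  - by move=> b c Nb Nc; rewrite /N /= scalerDl; apply: (submoduleD sT).
  - by move=> b c Nc; rewrite /N /= -scalerA; apply: (submoduleZ _ sT).
move=> hv; apply: (submodule_comp gG sJ) => m; move: (hv m); move: (hcomp G m v).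
have : forall gs, (forall fn, fn \in gs -> I fn.2) -> fsum G gs q m `<=` ideal_smul (frob_power I q) M.
  elim=> [_ u ->|fn gs IH hgs] /=; first exact: (submodule0 sJ).
  move=> _ [u [w [hu hw ->]]]; apply: (submoduleD sJ); last first.
    by apply: IH => // gn ggs; apply: hgs; rewrite in_cons ggs orbT.
  case: hu => [->|[l [x [_ Gx ->]]]]; first exact: (submodule0 sJ).
  apply: sub_submod_gen; exists (fn.2 ^+ q); last by exists x.
  apply: sub_submod_gen; exists fn.2 => //.
  by apply: hgs; rewrite mem_head.
by move=> /(_ fs fs_I); apply.
Qed.

Lemma fsum_smul n m : G m `&` ideal_smul (frob_power I (p ^ n)) M = fsum G fs (p ^ n) m.
Proof.
rewrite smul_tot; apply/seteqP; split=> v; first by move=> [/(tot_hom_inv gG) h /h].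
move=> hv; have Gv := gsub_fsum hv; split=> //.
exact: (tot_hom gG (gmod_fsum fs _ mG) Gv hv).
Qed.

End FrobeniusPower.

(** If no R_m were contained in I, requiring membership in I for fewer and fewer of the low
    components would give strict chains of every length. Once one R_m is in I, so are the later
    ones, since linear forms generate. *)
Lemma colength_bound (R : realType) : (quot_length (V := A^o) R setT I < +oo)%E ->
  exists m0, forall m, (m0 <= m)%N -> GA m `<=` I.
Proof.
have sI := ideal_sub.
move=> fin; have [[m0 h0]|/forallNP hn] := pselect (exists m0, GA m0 `<=` I).
  exists m0 => m; elim: m => [|m IH]; first by rewrite leqn0 => /eqP <-.
  rewrite leq_eqVlt => /orP[/eqP <- //|/IH hm] a am.
  have [s [X [X1 hX]]] := ga_gen F; have [b [hb ->]] := hX _ _ am.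
  apply: (@submodule_sum k A A^o) => // j _; rewrite mulrC.
  by apply: (@submoduleZ k A A^o) => //; apply: hm.
suff h n : (n%:R%:E <= quot_length (V := A^o) R setT I)%E.
  move: fin; case: (quot_length _ _ _) h => // [r|] h; last by have := h 0%N.
  move=> _; have := h (Num.truncn `|r|).+1; rewrite lee_fin leNgt => /negP; case.
  by apply: (le_lt_trans (ler_norm r)); apply: truncnS_gt.
apply: ereal_sup_ubound; exists n => //.
pose C i : set A^o := [set a | forall l, (l < n - i)%N -> I (hcomp GA l a)].
exists C; split=> [i le_in|i lt_in].
  split; last split=> //; last by move=> a Ia l _; apply: ideal_comp.
  apply: submoduleP.
  - by move=> l _; rewrite (comp0 dA); apply: (submodule0 sI).
  - by move=> u v hu hv l hl; rewrite (compD dA); apply: (submoduleD sI); [apply: hu|apply: hv].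
  - move=> a u hu l hl; have [m /(_ m (leqnn m)) ->] := comp_sum dA a.
    rewrite scaler_suml (comp_bigsum dA); apply: (@submodule_sum k A A^o) => // j _.
    rewrite (comp_mul gA _ _ (comp_in dA j a)); case: leqP => [jl|_]; last exact: (submodule0 sI).
    apply: (submoduleZ _ sI); apply: hu; lia.
split=> [a ha l hl|]; first by apply: ha; lia.
have [a /not_implyP[am na]] : exists a, ~ (GA (n - i.+1)%N a -> I a).
  by apply/existsNP; apply: hn.
move=> /(_ a) h; apply: na.
have e := comp_hom dA (n - i.+1) am; rewrite eqxx in e; rewrite -e.
apply: h; last lia.
move=> l hl; rewrite (comp_hom dA _ am) gtn_eqF//; exact: (submodule0 sI).
Qed.

End HomogeneousIdeal.

(** * Lengths of graded quotients *)

Section Lengths.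
Context (R : realType).

Lemma quot_length_eq (A : nzRingType) (V : lmodType A) (U W : set V) n :
  (forall m (C : nat -> set V),
     (forall i, (i <= m)%N -> submodule (C i) /\ W `<=` C i /\ C i `<=` U) ->
     (forall i, (i < m)%N -> C i `<` C i.+1) -> (m <= n)%N) ->
  (exists C : nat -> set V,
     (forall i, (i <= n)%N -> submodule (C i) /\ W `<=` C i /\ C i `<=` U) /\
     (forall i, (i < n)%N -> C i `<` C i.+1)) ->
  quot_length R U W = n%:R%:E.
Proof.
move=> hub hex; apply/eqP; rewrite eq_le; apply/andP; split.
  apply: ge_ereal_sup => _ [m [C [C1 C2]] <-].
  by rewrite lee_fin ler_nat (hub m C).
by apply: ereal_sup_ubound; exists n.
Qed.

Lemma submodule_subsp (k : fieldType) (V : lmodType k) (N : set V) : submodule N <-> subsp N.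
Proof.
split=> -[N0 NZ]; split; rewrite ?inE// in N0 *.
  by move=> c u v Nu Nv; have := NZ c u v; rewrite !inE; apply.
by move=> c u v; rewrite !inE; apply: NZ.
Qed.

Lemma quot_length_rdim (k : fieldType) (V : lmodType k) (U W : set V) :
  subsp U -> subsp W -> W `<=` U -> fdim U -> quot_length R U W = (rdim U W)%:R%:E.
Proof.
move=> sU sW WU fU; apply: quot_length_eq => [m C C1 C2|].
  apply: (rdim_chain sW fU) C2 => i /C1[/submodule_subsp sC [WC CU]]; split=> //.
have [C [C1 C2]] := rdim_chain_ex sU sW WU fU; exists C; split=> // i /C1[sC WC CU].
by split=> //; apply/submodule_subsp.
Qed.

Section Total.
Context {k : fieldType} {A : comAlgType k} (GA : nat -> set A).
Context (A_graded : standard_graded GA).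
Context (M : lmodType A) (G U : nat -> set M) (gG : graded_module GA G).
Context (gU : gmod GA U) (UG : gsub U G) (fG : forall m, kfin (G m)).
Context (B : nat) (hB : forall m, (B <= m)%N -> G m `<=` U m).

Let dG : direct_sum G. Proof. by case: gG. Qed.
Let mG : gmod GA G. Proof. exact: graded_gmod. Qed.
Let sT : submodule (tot G U). Proof. exact: (submodule_tot A_graded gG gU). Qed.

Lemma submodule_ksub (N : set M) : submodule N -> ksub N.
Proof.
move=> sN; apply: ksubP => [|u v|c u]; first exact: submodule0.
  exact: submoduleD.
exact: submoduleZ.
Qed.

Let low := fix low n : set M := if n is m.+1 then ksum (low m) (G m) else [set 0].

Lemma low_bound n : [/\ ksub (low n), kfin (low n) &
  (kdim (low n) (tot G U) <= \sum_(m < n) kdim (G m) (U m))%N].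
Proof.
have sTk := submodule_ksub sT.
elim: n => [|n [s f h]].
  split; [exact: ksub_set0|exact: kfin_set0|].
  by rewrite kdim_eq0// => _ ->; apply: ksub0.
split; [exact: ksub_ksum (mG.1 n)|exact: kfin_ksum (fG n)|].
rewrite big_ord_recr /= (leq_trans (kdim_ksum_le s (mG.1 n) sTk f (fG n)))//.
rewrite leq_add// (@kdim_eq_ext _ _ _ _ _ (U n))//; last exact: mG.1.
by move=> u Gu; split=> [|Uu]; [apply: (tot_hom_inv gG Gu)|apply: (tot_hom gG gU Gu Uu)].
Qed.

Lemma low_trunc n x : low n (\sum_(i < n) hcomp G i x).
Proof.
elim: n => [|n IH]; first by rewrite big_ord0.
by rewrite big_ord_recr; exists (\sum_(i < n) hcomp G i x), (hcomp G n x); split=> //; apply: comp_in dG _ _.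
Qed.

Lemma trunc_tot x : tot G U (x - \sum_(i < B) hcomp G i x).
Proof.
move=> m; rewrite (compD dG) (compN dG) (comp_bigsum dG).
case: (ltnP m B) => mB.
  rewrite (bigD1 (Ordinal mB))//= (comp_hom dG _ (comp_in dG _ _)) eqxx big1.
    by rewrite addr0 subrr; apply: ksub0 (gU.1 m).
  move=> i /eqP im; rewrite (comp_hom dG _ (comp_in dG _ _)); case: eqP => // e.
  by case: im; apply: val_inj.
rewrite big1 ?subr0; first by apply: hB => //; apply: comp_in dG _ _.
move=> i _; rewrite (comp_hom dG _ (comp_in dG _ _)) ltn_eqF//.
exact: leq_trans (ltn_ord i) mB.
Qed.

(** Every element is congruent modulo [tot G U] to its truncation below B. A chain above [tot G U]
    thus stays strict after intersection with the finite-dimensional space [low B], where dimensions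
    bound its length. *)
Lemma chain_upper n (C : nat -> set M) :
  (forall i, (i <= n)%N -> submodule (C i) /\ tot G U `<=` C i /\ C i `<=` [set: M]) ->
  (forall i, (i < n)%N -> C i `<` C i.+1) ->
  (n <= \sum_(m < B) kdim (G m) (U m))%N.
Proof.
move=> C1 C2; have [sl fl hl] := low_bound B; apply: leq_trans hl.
have sTk := submodule_ksub sT.
rewrite (@kdim_eq_ext _ _ _ _ _ (tot G U `&` low B))//; last first.
  by move=> u lu; split=> [|[]].
apply: (@rdim_chain k (restr_scalars M) _ _ n (fun i => C i `&` low B)) => //.
- exact: (@subspI k (restr_scalars M)).
- move=> i /C1[sC [TC _]]; split=> [|x [/TC] //|x []//].
  exact: (@subspI k (restr_scalars M)) (submodule_ksub sC) sl.
- move=> i lt_in; have [CC' CC'N] := C2 _ lt_in.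
  have [sC [TC _]] := C1 _ (ltnW lt_in); have [sC' [TC' _]] := C1 _ lt_in.
  split=> [x [/CC' ? ?]//|h]; apply: CC'N => x C'x.
  have hx := trunc_tot x; set y := \sum_(_ < _) _ in hx.
  have xy : x = (x - y) + y by rewrite subrK.
  have C'y : C i.+1 y.
    rewrite (_ : y = x - (x - y)); last by rewrite opprB addrCA subrr addr0.
    by apply: ksubB (submodule_ksub sC') _ _ => //; apply: TC'.
  rewrite xy; apply: (submoduleD sC); first exact: TC.
  by have [] : (C i `&` low B) y by apply: h; split=> //; apply: low_trunc.
Qed.

(** A chain of subspaces between U_n and G_n lifts to A-submodules by requiring membership in U
    below degree n and nothing above it: elements of positive degree carry the constrained lower
    components into U, and those of degree 0 are scalars. *)
Lemma chain_lower n : exists C : nat -> set M,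
  let L := (\sum_(m < n) kdim (G m) (U m))%N in
  (forall i, (i <= L)%N -> submodule (C i) /\
     forall v, (forall m, (m < n)%N -> U m (hcomp G m v)) -> C i v) /\
  (forall i, (i < L)%N -> C i `<` C i.+1).
Proof.
elim: n => [|n [C /= [C1 C2]]].
  exists (fun=> setT); rewrite /= big_ord0; split=> // i _; split=> //.
  exact: submoduleP.
rewrite big_ord_recr /=; set L := (\sum_(m < n) _)%N in C1 C2 *.
have [E [E1 E2]] := @rdim_chain_ex k (restr_scalars M) (G n) (U n) (mG.1 n) (gU.1 n) (@UG n) (fG n).
rewrite -/(kdim (G n) (U n)) in E1 E2; set r := kdim _ _ in E1 E2 *.
pose Z i : set M := [set v | (forall m, (m < n)%N -> U m (hcomp G m v)) /\ E i (hcomp G n v)].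
have sZ i : (i <= r)%N -> submodule (Z i).
  move=> /E1[sE UE EG]; apply: submoduleP.
  - split=> [m _|]; rewrite (comp0 dG); first exact: ksub0 (gU.1 m).
    exact: (@ksub0 k A M).
  - move=> u v [hu eu] [hv ev]; split=> [m mn|]; rewrite (compD dG).
      by apply: ksubD (gU.1 m) _ _; [apply: hu|apply: hv].
    exact: (@ksubD k A M).
  - move=> a u [hu eu].
    have dA : direct_sum GA by case: A_graded => -[].
    have [l /(_ l (leqnn l)) ->] := comp_sum dA a.
    have hUm b j m : (m < n)%N -> GA j b -> U m (hcomp G m (b *: u)).
      move=> mn bj; rewrite (comp_mul gG _ _ bj); case: leqP => [jm|_]; last exact: ksub0 (gU.1 m).
      by rewrite -{1}(subnKC jm); apply: gU.2 => //; apply: hu; lia.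
    rewrite scaler_suml; split=> [m mn|]; rewrite (comp_bigsum dG).
      by apply: ksub_sum (gU.1 m) _ => j _; apply: hUm mn (comp_in dA _ _).
    apply: (@ksub_sum k A M) => // j _; have aj := comp_in dA j a.
    rewrite (comp_mul gG _ _ aj); case: leqP => [jn|_]; last exact: (@ksub0 k A M).
    case: (posnP j) aj jn => [-> aj _|j0 aj jn].
      rewrite subn0; have [c ->] := sg_zero A_graded aj.
      exact: (@ksubZ k A M).
    by apply: UE; rewrite -{1}(subnKC jn); apply: gU.2 => //; apply: hu; lia.
(* The new links come before the old ones; all of them lie in [C 0], which contains every element
   with components in [U] below degree n. *)
exists (fun i => if (i < r)%N then Z i else C (i - r)%N); split=> [i hi|i hi].
  case: ltnP => ir.
    split; first by apply: sZ; apply: ltnW.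
    move=> v hv; split=> [m mn|]; first by apply: hv; apply: ltnW.
    by have [_ UE _] := E1 _ (ltnW ir); apply: UE; apply: hv.
  have [|sC hC] := C1 (i - r)%N; first lia.
  by split=> // v hv; apply: hC => m mn; apply: hv; apply: ltnW.
case: (ltnP i r) => ir; last first.
  rewrite ltnNge (leq_trans ir)//= subSn//; apply: C2; lia.
have [EE' EE'N] := E2 _ ir.
have [_ _ EG'] := E1 _ ir.
have hE : exists2 x, E i.+1 x & ~ E i x.
  apply: contrapT => h; apply: EE'N => x Ex; apply: contrapT => nx.
  by apply: h; exists x.
have [x E'x nEx] := hE.
have Gx : G n x := EG' _ E'x.
have xlow m : (m < n)%N -> U m (hcomp G m x).
  by move=> mn; rewrite (comp_hom dG _ Gx) gtn_eqF//; apply: ksub0 (gU.1 m).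
have nZ : ~ Z i x by move=> [_]; rewrite (comp_hom dG _ Gx) eqxx.
case: ltnP => ir'.
  split; first by move=> v [hv Ev]; split=> //; apply: EE'.
  by move=> /(_ x) h; apply: nZ; apply: h; split=> //; rewrite (comp_hom dG _ Gx) eqxx.
have -> : (i.+1 - r = 0)%N by lia.
have [_ hC] := C1 0%N (leq0n _).
split; first by move=> v [hv _]; apply: hC.
by move=> /(_ x) h; apply: nZ; apply: h; apply: hC.
Qed.

Lemma quot_length_tot :
  quot_length R [set: M] (tot G U) = (\sum_(m < B) kdim (G m) (U m))%:R%:E.
Proof.
apply: quot_length_eq => [m C|]; first exact: chain_upper.
have [C /= [C1 C2]] := chain_lower B; exists C; split=> // i /C1[sC hC].
split=> //; split=> // v hv; apply: hC => m _; exact: hv.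
Qed.

End Total.
End Lengths.

Lemma fin_gen_generates (k : fieldType) (A : comAlgType k) (GA : nat -> set A) (D : nat)
    (M : lmodType A) (GM : nat -> set M) :
  standard_graded GA -> graded_facts GA D.+2 -> graded_module GA GM ->
  fin_gen [set: M] -> exists V, generates GA 1 GM V.
Proof.
move=> A_graded F gM [s es].
have [V [VG _ sV]] := homogeneous_seq s gM; exists V; split=> // m.
have sub m' := tspans_subspace F (ltn0Sn 0) (@frob1D k A) (@frob1_surj k) V m'.
have gT : gmod GA (tspans GA 1 V).
  split=> [i|i j a v ai hv]; first by case: (sub i).
  have := tspans_mul F ai hv; rewrite muln1 expr1 //.
have sT := submodule_tot A_graded gM gT.
suff T v : tot GM (tspans GA 1 V) v by move=> v Gv; apply: (tot_hom_inv gM Gv).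
have : submod_gen [set` s] v by rewrite -es.
apply: (submod_gen_sub sT) => x /= xs i.
have [->|h] := sV x i xs; first by apply: ksub0; case: (sub i).
apply: (tspans_mem F (ltn0Sn 0) (@frob1D k A) (@frob1_surj k) h).
right; exists 0%N, 1; split; [by rewrite mul0n|exact: ga1 F|].
by rewrite expr1 scale1r.
Qed.

(** All that the analysis needs from algebra, as inequalities between natural numbers. The threshold
    e comes from the iteration of Frobenius, and the bound on [h n 0] serves the passage from degree
    -1 to degree 0. *)
Lemma hk_dimensions (R : realType) (k : fieldType) (p : nat)
    (k_perfect : perfect_field k) (k_char : p \in [pchar k])
    (A : comAlgType k) (GA : nat -> set A) (D : nat)
    (A_noeth : noetherian A) (A_graded : standard_graded GA)
    (A_dim : krull_dim A R = D.+2%:R%:E)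
    (I : set A) (I_homog : homogeneous_ideal GA I)
    (I_colength : (quot_length (V := A^o) R setT I < +oo)%E)
    (M : lmodType A) (GM : nat -> set M)
    (M_graded : graded_module GA GM) (M_fg : fin_gen [set: M]) :
  exists (h : nat -> nat -> nat) (e C B : nat),
  [/\ forall n m, hk_component_length R p I GM n (Posz m) = (h n m)%:R%:E,
      forall n, quot_length R [set: M] (ideal_smul (frob_power I (p ^ n)) M) =
        (\sum_(m < B * p ^ n) h n m)%:R%:E,
      forall n m, (B * p ^ n <= m)%N -> h n m = 0%N,
      forall n m, (e <= n)%N ->
        (h n.+1 m <= p ^ D.+1 * h n (m %/ p) + C * m.+1 ^ D)%N /\
        (p ^ D.+1 * h n (m %/ p) <= h n.+1 m + C * m.+1 ^ D)%N
    & (forall n m, (e <= n)%N ->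
        (h n m.+1 <= h n m + C * m.+1 ^ D)%N /\
        (h n m <= h n m.+1 + C * m.+1 ^ D)%N) /\
      (forall n, (h n 0 <= C)%N)].
Proof.
have F := sg_facts A_graded A_noeth A_dim.
have kp := k_perfect p k_char.
have [V gV] := fin_gen_generates A_graded F M_graded M_fg.
have mG := graded_gmod A_graded M_graded.
have fG m : kfin (GM m).
  apply: kfin_sub (gV.2 m) _.
  by case: (tspans_subspace F (ltn0Sn 0) (@frob1D k A) (@frob1_surj k) V m).
have [fs [hfs fsI fs_gen]] := ideal_gens A_graded A_noeth I_homog.
have [m0 hm0] := colength_bound A_graded F I_homog I_colength.
have gA := graded_GA A_graded.
have hm0' m : (m0 <= m)%N -> GA m `<=` fsum (GA : nat -> set A^o) fs 1 m.
  (* On the ring itself, the exponent p^0 in [tot_fsum] says that the components of I are spanned by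
     multiples of [fs]. *)
  move=> /hm0 mI a am; have := tot_fsum A_graded F k_char hfs fs_gen gA 0 1 (mI _ am).
  rewrite expn0 expr1 => /(_ m); rewrite (comp_hom gA.1 (i := m)) ?eqxx /GRing.scale /= mulr1//.
have [B hB] := hdim_vanish F k_char mG gV hm0'.
have [e [[C1 h1] [C2 h2]]] := hdim_estimates F k_char kp mG gV hfs.
pose N0 : nat -> set M := fun=> [set 0].
pose h n m := hdim GM N0 fs (p ^ n) m.
have ksum0 (X : set M) : ksum [set 0] X = X.
  by rewrite /ksum (@addSC k (restr_scalars M)) -/(ksum X [set 0]) ksum_set0.
have hE n m : h n m = kdim (GM m) (fsum GM fs (p ^ n) m) by rewrite /h /hdim ksum0.
have gf n := gmod_fsum fs (p ^ n) mG.
have fsG n : gsub (fsum GM fs (p ^ n)) GM by exact: (@gsub_fsum k A GA D A_graded F fs hfs M GM M_graded (p ^ n)%N).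
(* The last summand is the dimension of M_0, which bounds [h n 0] for every n. *)
pose z : set M := [set 0]; pose C := (C1 + C2 + kdim (GM 0%N) z)%N.
have hC C' m : (C' <= C)%N -> (C' * m.+1 ^ D <= C * m.+1 ^ D)%N.
  by move=> cc; rewrite leq_mul2r cc orbT.
have c1 : (C1 <= C)%N by rewrite /C; lia.
have c2 : (C2 <= C)%N by rewrite /C; lia.
exists h, e, C, B; split.
- move=> n m; rewrite /hk_component_length.
  rewrite (fsum_smul A_graded F k_char hfs fsI fs_gen M_graded) hE.
  apply: quot_length_rdim; [exact: mG.1|exact: (gf n).1|exact: fsG|exact: fG].
- move=> n; rewrite (smul_tot A_graded F k_char hfs fsI fs_gen M_graded).
  rewrite (quot_length_tot R A_graded M_graded (gf n) (fsG n) fG (hB n)).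
  by congr (_%:R%:E); apply: eq_bigr => m _; rewrite hE.
- by move=> n m /hB hm; rewrite hE; apply: kdim_eq0 hm; apply: (gf n).1.
- move=> n m en; have [l1 l2] := h1 (n - e)%N m; rewrite subnK// in l1 l2.
  by split; [apply: (leq_trans l1)|apply: (leq_trans l2)]; rewrite leq_add2l hC.
- split=> [n m en|n].
    have [l1 l2] := h2 (n - e)%N m; rewrite subnK// in l1 l2.
    by split; [apply: (leq_trans l1)|apply: (leq_trans l2)]; rewrite leq_add2l hC.
  rewrite hE (leq_trans (kdim_subr (@ksub_set0 k A M) ((gf n).1 0%N) (fG 0%N) _))//.
    by move=> _ ->; apply: ksub0 ((gf n).1 0%N).
  by rewrite /C leq_addl.
Qed.

(** * The density function *)

Section RealLemmas.
Context (R : realType).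
Implicit Types (f g : R -> R) (x y : R).

Lemma supported_segment f (a b : R) : (forall x, f x != 0 -> a <= x <= b) ->
  compactly_supported f.
Proof.
move=> h; apply: (@subclosed_compact _ _ `[a, b]).
- exact: closed_closure.
- exact: segment_compact.
- have /closure_id cl : closed `[a, b]%classic by apply: interval_closed.
  by rewrite [X in _ `<=` X]cl; apply: closureS => x /= /h; rewrite in_itv.
Qed.

Lemma piecewise_linear_cst (c : R) : piecewise_linear (fun=> c).
Proof.
by exists [::] => J _; exists 0, c => x _; rewrite mul0r add0r.
Qed.

Lemma piecewise_linearD f g : piecewise_linear f -> piecewise_linear g ->
  piecewise_linear (fun x => f x + g x).
Proof.
move=> [s hs] [t ht]; exists (s ++ t) => J hJ.
have [|a [b fJ]] := hs J; first by move=> c cs; apply: hJ; rewrite mem_cat cs.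
have [|a' [b' gJ]] := ht J; first by move=> c ct; apply: hJ; rewrite mem_cat ct orbT.
by exists (a + a'), (b + b') => x xJ; rewrite fJ// gJ//; ring.
Qed.

Lemma piecewise_linearZ (c : R) f : piecewise_linear f -> piecewise_linear (fun x => c * f x).
Proof.
move=> [s hs]; exists s => J /hs[a [b fJ]].
by exists (c * a), (c * b) => x xJ; rewrite fJ//; ring.
Qed.

Lemma piecewise_linear_sum (I : Type) (r : seq I) (F : I -> R -> R) :
  (forall i, piecewise_linear (F i)) -> piecewise_linear (fun x => \sum_(i <- r) F i x).
Proof.
move=> h; elim: r => [|i r IH].
  rewrite (_ : (fun _ => _) = fun=> 0); first exact: piecewise_linear_cst.
  by apply/funext => x; rewrite big_nil.
rewrite (_ : (fun _ => _) = fun x => F i x + \sum_(i <- r) F i x).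
  exact: piecewise_linearD.
by apply/funext => x; rewrite big_cons.
Qed.

Lemma piecewise_linear_abs (a b : R) : a != 0 -> piecewise_linear (fun x => `|x * a + b|).
Proof.
move=> a0; exists [:: - b / a] => J /(_ _ (mem_head _ _)) nJ.
have hE x : x * a + b = (x - (- b / a)) * a by field.
have [[x0 [x0J x0lt]]|h] := pselect (exists x, x \in J /\ x < - b / a).
  exists (- `|a|), (`|a| * (- b / a)) => x xJ; rewrite hE normrM.
  have xlt : x < - b / a.
    rewrite ltNge; apply/negP => lex; move/negP: nJ; apply.
    exact: (interval_is_interval x0J xJ (introT andP (conj (ltW x0lt) lex))).
  by rewrite ltr0_norm ?subr_lt0//; ring.
exists `|a|, (- (`|a| * (- b / a))) => x xJ; rewrite hE normrM ger0_norm; first ring.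
rewrite subr_ge0 leNgt; apply/negP => xlt; apply: h; by exists x.
Qed.

(** The tent of height 1 over [-1, 1], written with absolute values so that continuity and piecewise
    linearity are inherited from |x|. *)
Definition hat (u : R) : R := (`|u + 1| + `|u - 1| - 2 * `|u|) / 2.

Lemma hat_out u : 1 <= `|u| -> hat u = 0.
Proof.
rewrite /hat; case: (leP 0 u) => u0.
  rewrite (ger0_norm u0) => u1; rewrite !ger0_norm; lra.
rewrite (ltr0_norm u0) => u1; rewrite (ler0_norm (x := u + 1)); last lra.
rewrite (ltr0_norm (x := u - 1)); lra.
Qed.

Lemma hat_pos u : 0 <= u <= 1 -> hat u = 1 - u.
Proof.
move=> /andP[u0 u1]; rewrite /hat (ger0_norm u0) (ger0_norm (x := u + 1)); last lra.
rewrite (ler0_norm (x := u - 1)); lra.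
Qed.

Lemma hat_neg u : - 1 <= u <= 0 -> hat u = 1 + u.
Proof.
move=> /andP[u0 u1]; rewrite /hat (ler0_norm u1) (ger0_norm (x := u + 1)); last lra.
rewrite (ler0_norm (x := u - 1)); lra.
Qed.

Lemma piecewise_linear_hat (a b : R) : a != 0 -> piecewise_linear (fun x => hat (x * a + b)).
Proof.
move=> a0; rewrite (_ : (fun _ => _) = fun x => 2^-1 * ((`|x * a + (b + 1)| +
    `|x * a + (b - 1)|) + - 2 * `|x * a + b|)).
  apply: piecewise_linearZ; apply: piecewise_linearD.
    by apply: piecewise_linearD; apply: piecewise_linear_abs.
  by apply: piecewise_linearZ; apply: piecewise_linear_abs.
by apply/funext => x; rewrite /hat !addrA; field.
Qed.

Lemma continuous_hat (a b : R) : continuous (fun x => hat (x * a + b)).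
Proof.
have cl (c : R) : continuous (fun x => `|x * a + b + c|).
  move=> x; apply: cvg_norm; apply: cvgD; last exact: cvg_cst.
  by apply: cvgD; [apply: cvgMl|exact: cvg_cst].
move=> x; rewrite /hat; apply: cvgMl; apply: cvgB.
  by apply: cvgD; apply: cl.
apply: cvgMr; apply: cvg_norm.
by apply: cvgD; [apply: cvgMl|exact: cvg_cst].
Qed.

Lemma continuous_sum (I : Type) (r : seq I) (F : I -> R -> R) :
  (forall i, continuous (F i)) -> continuous (fun x => \sum_(i <- r) F i x).
Proof.
move=> h; elim: r => [|i r IH] x.
  rewrite (_ : (fun _ => _) = fun=> 0); first exact: cvg_cst.
  by apply/funext => z; rewrite big_nil.
rewrite (_ : (fun _ => _) = fun x => F i x + \sum_(i <- r) F i x).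
  by apply: cvgD; [apply: h|apply: IH].
by apply/funext => z; rewrite big_cons.
Qed.

Lemma geometric_small (K e : R) : 0 <= K -> 0 < e -> exists N, forall n, (N <= n)%N ->
  K / 2 ^+ n <= e.
Proof.
move=> K0 e0; exists (Num.truncn (K / e)).+1 => n Nn.
rewrite ler_pdivrMr ?exprn_gt0// -ler_pdivrMl// mulrC.
apply: (le_trans (ltW (truncnS_gt _))); rewrite -natrX ler_nat.
exact: leq_trans Nn (ltnW (ltn_expl n (ltnSn 1))).
Qed.

Lemma geometric_cvg (a : nat -> R) (l K : R) (e : nat) : 0 <= K ->
  (forall n, (e <= n)%N -> `|l - a n| <= K / 2 ^+ n) -> a @ \oo --> l.
Proof.
move=> K0 h; apply/cvgrPdist_le => eps eps0; have [N hN] := geometric_small K0 eps0.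
exists (N + e)%N => // n /= hn; apply: (le_trans (h n _)); first lia.
by apply: hN; lia.
Qed.

Lemma geometric_tail (a : nat -> R) (K : R) (e : nat) : 0 <= K ->
  (forall n, (e <= n)%N -> `|a n.+1 - a n| <= K / 2 ^+ n) ->
  forall n m, (e <= n)%N -> `|a (n + m)%N - a n| <= 2 * K / 2 ^+ n.
Proof.
move=> K0 h n m en.
(* The telescoping form, with the remaining tail subtracted, is the one that passes through the
   induction. *)
suff H : `|a (n + m)%N - a n| <= 2 * K / 2 ^+ n - 2 * K / 2 ^+ (n + m).
  by rewrite (le_trans H)// gerBl divr_ge0 ?exprn_ge0// mulr_ge0.
elim: m => [|m IH]; first by rewrite addn0 !subrr normr0.
rewrite addnS; have h1 := h (n + m)%N (leq_trans en (leq_addr _ _)).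
have -> : a (n + m).+1 - a n = (a (n + m).+1 - a (n + m)%N) + (a (n + m)%N - a n) by ring.
apply: (le_trans (ler_normD _ _)); apply: (le_trans (lerD h1 IH)).
rewrite exprS; have : 2 ^+ (n + m) != 0 :> R by rewrite expf_neq0.
have : 2 ^+ n != 0 :> R by rewrite expf_neq0.
move: (2 ^+ (n + m)) (2 ^+ n) => u v v0 u0.
by move=> *; rewrite le_eqVlt; apply/orP; left; apply/eqP; field; rewrite u0 v0.
Qed.

Lemma geometric_limit (a : nat -> R) (K : R) (e : nat) : 0 <= K ->
  (forall n, (e <= n)%N -> `|a n.+1 - a n| <= K / 2 ^+ n) -> cvgn a.
Proof.
move=> K0 h; apply/cauchy_cvgP; apply: cauchy_exP => eps eps0.
have [N hN] := geometric_small (K := 2 * K) (e := eps / 2) (mulr_ge0 (ler0n _ 2) K0)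
  (divr_gt0 eps0 (ltr0n _ 2)).
exists (a (N + e)%N); exists (N + e)%N => // n /= hn; rewrite /ball /= distrC -(subnKC hn).
apply: (@le_lt_trans _ _ (eps / 2)); last lra.
apply: (le_trans (geometric_tail K0 h _ _)); first by rewrite leq_addl.
by apply: hN; rewrite leq_addr.
Qed.

Lemma geometric_le0 (y K : R) (e : nat) : 0 <= K ->
  (forall n, (e <= n)%N -> y <= K / 2 ^+ n) -> y <= 0.
Proof.
move=> K0 h; rewrite leNgt; apply/negP => y0.
have [N hN] := geometric_small K0 (divr_gt0 y0 (ltr0n _ 2)).
have := h (N + e)%N (leq_addl _ _); have := hN (N + e)%N (leq_addr _ _).
move: (_ / _) => u; lra.
Qed.

(** At u only the tents centred at floor u and floor u + 1 can be nonzero, and their values are the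
    weights of linear interpolation. *)
Lemma hat_floor (u : R) (j : nat) : let m := Num.floor u in
  hat (u - j%:R) = (1 - (u - m%:~R)) * (Posz j == m)%:R + (u - m%:~R) * (Posz j == m + 1)%:R.
Proof.
move=> m; have /andP[mu um] := floor_itv u; rewrite -/m in mu um.
rewrite intrD in um; set t := u - m%:~R.
have t0 : 0 <= t by rewrite /t; lra.
have t1 : t < 1 by rewrite /t; move: um; rewrite rmorph1; lra.
have jE : j%:R = (Posz j)%:~R :> R by [].
have [jm|mj|jm] := ltgtP (Posz j) m.
- rewrite (_ : (Posz j == m + 1) = false); last by apply/eqP => e; rewrite e in jm; lia.
  rewrite !mulr0 addr0 hat_out// ger0_norm.
    have : (Posz j + 1)%:~R <= m%:~R :> R by rewrite ler_int; lia.
    by rewrite intrD rmorph1 jE; lra.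
  have : (Posz j)%:~R <= m%:~R :> R by rewrite ler_int; lia.
  rewrite jE; lra.
- rewrite mulr0 add0r; case: eqP => [e|ne].
    have e' : j%:R = m%:~R + 1 :> R by rewrite jE e intrD rmorph1.
    rewrite mulr1 hat_neg; first by rewrite e' /t; ring.
    by rewrite e'; move: t0 t1; rewrite /t; lra.
  rewrite mulr0 hat_out//.
  have : (m + 2)%:~R <= (Posz j)%:~R :> R by rewrite ler_int; lia.
  rewrite intrD -jE (_ : (2%:~R : R) = 2)// => h.
  rewrite ler0_norm; move: t0 t1; rewrite /t; lra.
- have e' : j%:R = m%:~R :> R by rewrite jE jm.
  rewrite (_ : (Posz j == m + 1) = false); last by apply/eqP => e; rewrite e in jm; lia.
  by rewrite mulr0 addr0 mulr1 e' hat_pos// t0 ltW.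
Qed.

Lemma natr_dist (a b c : nat) : (a <= b + c)%N -> (b <= a + c)%N ->
  `|a%:R - b%:R| <= c%:R :> R.
Proof.
move=> h1 h2; rewrite ler_norml lerBlDl -natrD ler_nat h1 andbT.
by rewrite lerNl opprB lerBlDl -natrD ler_nat h2.
Qed.

Lemma uniform_cvg_le (g : nat -> R -> R) f :
  (forall e : R, 0 < e -> exists N, forall n, (N <= n)%N -> forall x, `|f x - g n x| <= e) ->
  {uniform, g @ \oo --> f}.
Proof.
move=> h U /uniform_nbhs[E [entE EU]].
move: entE; rewrite -entourage_ballE => -[e /= e0 hE].
have [N hN] := h (e / 2) (divr_gt0 e0 (ltr0n _ 2)).
exists N => // n /= Nn; apply: EU => x _; apply: hE; rewrite /ball /=.
by apply: (le_lt_trans (hN n Nn x)); lra.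
Qed.

End RealLemmas.

(** * Convergence of the interpolations and of the Riemann sums *)

Section DensityFunction.
Context (R : realType) (p D : nat) (p_gt1 : (1 < p)%N).
Context (h : nat -> nat -> nat) (e C B : nat).
Context (h_vanish : forall n m, (B * p ^ n <= m)%N -> h n m = 0%N).
Context (h_frob : forall n m, (e <= n)%N ->
  (h n.+1 m <= p ^ D.+1 * h n (m %/ p) + C * m.+1 ^ D)%N /\
  (p ^ D.+1 * h n (m %/ p) <= h n.+1 m + C * m.+1 ^ D)%N).
Context (h_step : forall n m, (e <= n)%N ->
  (h n m.+1 <= h n m + C * m.+1 ^ D)%N /\ (h n m <= h n m.+1 + C * m.+1 ^ D)%N).
Context (h_zero : forall n, (h n 0 <= C)%N).

Let q n : R := (p ^ n)%:R.

Definition node n (m : int) : R :=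
  if m is Posz j then (h n j)%:R / q n ^+ D.+1 else 0.

Definition interp n (x : R) : R :=
  let m := Num.floor (x * q n) in
  let t := x * q n - m%:~R in
  (1 - t) * node n m + t * node n (m + 1).

Lemma q_gt0 n : 0 < q n.
Proof. by rewrite ltr0n expn_gt0 (ltnW p_gt1). Qed.

Lemma q_ge0 n : 0 <= q n.
Proof. exact: ltW (q_gt0 n). Qed.

Lemma qS n : q n.+1 = p%:R * q n.
Proof. by rewrite /q expnS natrM. Qed.

Lemma inv_q_le n : (q n)^-1 <= (2 ^+ n)^-1.
Proof.
rewrite lef_pV2 ?posrE ?q_gt0 ?exprn_gt0// /q -natrX ler_nat.
by case: n => // n; rewrite leq_exp2r.
Qed.

Lemma node_ge0 n m : 0 <= node n m.
Proof. by case: m => //= j; rewrite divr_ge0// exprn_ge0// q_ge0. Qed.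

Lemma node_vanish n j : (B * p ^ n <= j)%N -> node n (Posz j) = 0.
Proof. by move=> /h_vanish /= ->; rewrite mul0r. Qed.

(** One finite formula on the whole line, so that no gluing at the nodes is needed; nodes of
    negative index or of index at least B q have value 0. *)
Lemma interpE n x :
  interp n x = \sum_(j < B * p ^ n) node n (Posz j) * hat (x * q n + - j%:R).
Proof.
under eq_bigr do rewrite hat_floor mulrDr.
rewrite big_split /= /interp; set m := Num.floor _; set t := _ - m%:~R.
have pick (c : R) (i : int) :
    \sum_(j < B * p ^ n) node n (Posz j) * (c * (Posz j == i)%:R) = c * node n i.
  have vanish (j : 'I_(B * p ^ n)) : (Posz j == i) = false ->
      node n (Posz j) * (c * (Posz j == i)%:R) = 0 by move=> ->; rewrite !mulr0.
  case: i vanish => [i|i] vanish; last by rewrite big1 ?mulr0// => j _; rewrite vanish.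
  case: (ltnP i (B * p ^ n)) => hi; last first.
    rewrite node_vanish// mulr0 big1// => j _; apply: vanish.
    by apply/eqP => -[ji]; move: hi; rewrite -ji leqNgt ltn_ord.
  rewrite (bigD1 (Ordinal hi))//= eqxx mulr1 big1 ?addr0; first by rewrite mulrC.
  move=> j /eqP ji; apply: vanish; apply/eqP => -[ji']; apply: ji; exact: val_inj.
by rewrite !pick.
Qed.

(** The left end cannot be 0, as the graph may rise between the nodes -1/q and 0; the interval
    [-1, B] serves all n at once. *)
Lemma interp_support n x : interp n x != 0 -> - 1 <= x <= B%:R.
Proof.
apply: contraR => hx; rewrite interpE big1// => j _; rewrite hat_out ?mulr0//.
have q1 : 1 <= q n by rewrite ler1n expn_gt0 (ltnW p_gt1).
move: hx; rewrite negb_and -!ltNge => /orP[x1|xB].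
  rewrite ler0_norm; have : x * q n < - q n by rewrite -mulN1r ltr_pM2r ?q_gt0.
    have : 0 <= j%:R :> R by []; lra.
  have : 0 <= j%:R :> R by []; lra.
have jN : (j.+1)%:R <= B%:R * q n by rewrite /q -natrM ler_nat.
have xq : B%:R * q n < x * q n by rewrite ltr_pM2r ?q_gt0.
by rewrite -natr1 in jN; rewrite ger0_norm; lra.
Qed.

Lemma interp_piecewise_linear n : piecewise_linear (interp n).
Proof.
rewrite (_ : interp n = fun x =>
    \sum_(j < B * p ^ n) node n (Posz j) * hat (x * q n + - j%:R)).
  apply: piecewise_linear_sum => j; apply: piecewise_linearZ.
  by apply: piecewise_linear_hat; rewrite gt_eqF// q_gt0.
by apply/funext => x; rewrite interpE.
Qed.

Lemma interp_continuous n : continuous (interp n).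
Proof.
rewrite (_ : interp n = fun x =>
    \sum_(j < B * p ^ n) node n (Posz j) * hat (x * q n + - j%:R)).
  apply: continuous_sum => j x; apply: cvgMr; exact: continuous_hat.
by apply/funext => x; rewrite interpE.
Qed.

(** B^D comes from (m + 1)^D <= (B q)^D in the degrees m < B q; the added 1 covers the step into
    degree 0. *)
Let K1 : R := (C * (B ^ D + 1))%:R.

Lemma K1_ge0 : 0 <= K1. Proof. exact: ler0n. Qed.

(** An error of order q^D becomes O(1/q) after division by q^(D+1). *)
Lemma node_bound n (c : nat) (d : R) : `|d| <= c%:R -> (c <= C * (B * p ^ n) ^ D)%N ->
  `|d / q n ^+ D.+1| <= (C * B ^ D)%:R / q n.
Proof.
move=> dc cC; have qn := q_gt0 n.
rewrite normrM normfV (ger0_norm (x := q n ^+ _)) ?exprn_ge0 ?q_ge0//.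
rewrite ler_pdivrMr ?exprn_gt0//.
apply: (le_trans dc); apply: (le_trans (y := (C * (B * p ^ n) ^ D)%:R)).
  by rewrite ler_nat.
rewrite expnMn mulnA natrM natrX -/(q n) exprS mulrA divfK ?gt_eqF//.
Qed.

Lemma node_step n m : (e <= n)%N -> `|node n (m + 1) - node n m| <= K1 / q n.
Proof.
move=> en; have qn := q_gt0 n.
have K10 : 0 <= K1 / q n by rewrite divr_ge0 ?K1_ge0 ?q_ge0.
case: m => [j|[|j]].
- rewrite (_ : Posz j + 1 = Posz j.+1); last by rewrite -PoszD addn1.
  have [hj|hj] := leqP (B * p ^ n) j.
    by rewrite !node_vanish// ?subrr ?normr0// leqW.
  rewrite /= -mulrBl; have [l1 l2] := h_step j en.
  have cC := leq_mul (leqnn C) (leq_exp2 D hj).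
  apply: (le_trans (node_bound (natr_dist _ l1 l2) cC)).
  by rewrite ler_pM2r ?invr_gt0// ler_nat leq_mul2l leq_addr orbT.
(* The step from degree -1, where the node is 0, to degree 0 is bounded by [h_zero]. *)
- rewrite (_ : Negz 0 + 1 = Posz 0)//= subr0 ger0_norm ?divr_ge0 ?exprn_ge0 ?q_ge0//.
  rewrite exprS invfM mulrA ler_pdivrMr ?exprn_gt0//.
  apply: (le_trans (y := K1 / q n)); last first.
    rewrite ler_peMr// exprn_ege1// /q ler1n expn_gt0 (ltnW p_gt1)//.
  rewrite ler_pM2r ?invr_gt0// ler_nat (leq_trans (h_zero n))//.
  by rewrite mulnDr muln1 leq_addl.
- rewrite (_ : Negz j.+1 + 1 = Negz j); last by rewrite !NegzE; lia.
  by rewrite /= subrr normr0.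
Qed.

Lemma interp_node n x : (e <= n)%N ->
  `|interp n x - node n (Num.floor (x * q n))| <= K1 / q n.
Proof.
move=> en; rewrite /interp; set m := Num.floor _; set t := _ - m%:~R.
have /andP[mu um] := floor_itv (x * q n); rewrite -/m intrD rmorph1 in mu um.
have t0 : 0 <= t by rewrite /t subr_ge0.
have t1 : t <= 1 by rewrite /t lerBlDl ltW.
have -> : (1 - t) * node n m + t * node n (m + 1) - node n m =
  t * (node n (m + 1) - node n m) by ring.
rewrite normrM (ger0_norm t0); apply: le_trans (node_step m en).
by rewrite ler_piMl.
Qed.

(** The subdivision at level n + 1 refines the one at level n, which matches the index m/p in
    [h_frob]. *)
Lemma floor_div n x j : Num.floor (x * q n.+1) = Posz j ->
  Num.floor (x * q n) = Posz (j %/ p).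
Proof.
move=> ej; apply: floor_def; have /andP[] := floor_itv (x * q n.+1).
have p0 : 0 < p%:R :> R by rewrite ltr0n (ltnW p_gt1).
rewrite ej qS mulrCA => h1 h2; rewrite -(ler_pM2l p0) -[X in _ && X](ltr_pM2l p0).
apply/andP; split.
  apply: le_trans h1; rewrite -natrM -[X in _ <= X]/(j%:R) ler_nat mulnC.
  exact: leq_trunc_div.
apply: (lt_le_trans h2).
rewrite -PoszD -[X in X <= _]/((j + 1)%:R) -[X in _ * X]/((j %/ p + 1)%:R) -natrM ler_nat.
by rewrite !addn1 mulnC ltn_ceil// (ltnW p_gt1).
Qed.

Lemma floor_neg n x j : Num.floor (x * q n.+1) = Negz j ->
  node n (Num.floor (x * q n)) = 0.
Proof.
move=> ej; have x0 : x < 0.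
  have /andP[_] := floor_itv (x * q n.+1); rewrite ej => h1.
  have : x * q n.+1 < 0.
    by apply: (lt_le_trans h1); rewrite -[0]/(0%:~R) ler_int NegzE; lia.
  by rewrite pmulr_llt0 ?q_gt0.
case E : (Num.floor (x * q n)) => [i|//].
have /andP[+ _] := floor_itv (x * q n); rewrite E => h1.
have : x * q n < 0 by rewrite pmulr_llt0 ?q_gt0.
have : 0 <= (Posz i)%:~R :> R by exact: ler0n.
lra.
Qed.

(** Three errors of order 1/q: interpolation against the left node at the levels n + 1 and n, and
    the Frobenius recursion between these two nodes. Bounding 1/q by 2^(-n) makes them summable. *)
Lemma interp_cauchy n x : (e <= n)%N ->
  `|interp n.+1 x - interp n x| <= 3 * K1 / 2 ^+ n.
Proof.
move=> en; have qn := q_gt0 n; have qn1 := q_gt0 n.+1.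
have p0 : 0 < p%:R :> R by rewrite ltr0n (ltnW p_gt1).
have p1 : 1 <= p%:R :> R by rewrite ler1n (ltnW p_gt1).
have qle : (q n.+1)^-1 <= (q n)^-1.
  by rewrite lef_pV2 ?posrE// qS ler_peMl ?q_ge0.
have h1 := interp_node x (leqW en); have h2 := interp_node x en.
have h3 : `|node n.+1 (Num.floor (x * q n.+1)) - node n (Num.floor (x * q n))| <= K1 / q n.
  case E : (Num.floor (x * q n.+1)) => [j|j]; last first.
    by rewrite (floor_neg E) /= subrr normr0 divr_ge0 ?K1_ge0 ?q_ge0.
  rewrite (floor_div E).
  have [hj|hj] := leqP (B * p ^ n.+1) j.
    rewrite !node_vanish ?subrr ?normr0 ?divr_ge0 ?K1_ge0 ?q_ge0//.
    by rewrite leq_divRL ?(ltnW p_gt1)// -mulnA -expnSr.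
  have -> : node n.+1 (Posz j) - node n (Posz (j %/ p)) =
      ((h n.+1 j)%:R - (p ^ D.+1 * h n (j %/ p))%:R) / q n.+1 ^+ D.+1.
    rewrite /= mulrBl; congr (_ - _); rewrite natrM natrX qS exprMn invfM.
    by field; rewrite !gt_eqF ?exprn_gt0.
  have [l1 l2] := h_frob j en.
  have cC := leq_mul (leqnn C) (leq_exp2 D hj).
  apply: (le_trans (node_bound (natr_dist _ l1 l2) cC)).
  apply: (le_trans (y := K1 / q n.+1)); last by rewrite ler_wpM2l ?K1_ge0.
  by rewrite ler_pM2r ?invr_gt0// ler_nat leq_mul2l leq_addr orbT.
have h4 : K1 / q n.+1 <= K1 / q n by rewrite ler_wpM2l ?K1_ge0.
have h5 : K1 / q n <= K1 / 2 ^+ n by rewrite ler_wpM2l ?K1_ge0 ?inv_q_le.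
set a := interp _ _ in h1 *; set b := interp _ _ in h2 *.
set c := node _ _ in h1 h3; set d := node n _ in h2 h3.
have -> : a - b = (a - c) + (c - d) - (b - d) by ring.
apply: (le_trans (ler_normB _ _)); apply: (le_trans (lerD (ler_normD _ _) (lexx _))).
rewrite -mulrA; move: h1 h2 h3 h4 h5; lra.
Qed.

Let K : R := 3 * K1.

Lemma K_ge0 : 0 <= K. Proof. by rewrite mulr_ge0// K1_ge0. Qed.

Lemma interp_ge0 n x : 0 <= interp n x.
Proof.
have /andP[mu um] := floor_itv (x * q n); rewrite intrD rmorph1 in um.
rewrite /interp addr_ge0// mulr_ge0 ?node_ge0//; last by rewrite subr_ge0.
by rewrite subr_ge0 lerBlDl ltW.
Qed.

Lemma interp_limit : exists f : R -> R, forall x, interp n x @[n --> \oo] --> f x.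
Proof.
exists (fun x => limn (fun n => interp n x)) => x.
apply: (geometric_limit K_ge0 (e := e)) => n; exact: interp_cauchy.
Qed.

Section Limit.
Context (f : R -> R) (hf : forall x, interp n x @[n --> \oo] --> f x).

Lemma limit_close n x : (e <= n)%N -> `|f x - interp n x| <= 2 * K / 2 ^+ n.
Proof.
move=> en; apply/ler_addgt0Pl => eps eps0.
have /cvgrPdist_le/(_ eps eps0)[N _ hN] := @hf x.
have hn := hN (n + N)%N (leq_addl _ _); rewrite /= in hn.
have tail := geometric_tail K_ge0 (a := fun n => interp n x) (e := e)
  (fun i => @interp_cauchy i x) N en.
have -> : f x - interp n x = (f x - interp (n + N) x) + (interp (n + N) x - interp n x) by ring.
exact: le_trans (ler_normD _ _) (lerD hn tail).
Qed.

Lemma K2_ge0 : 0 <= 2 * K. Proof. by rewrite mulr_ge0// K_ge0. Qed.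

Lemma limit_uniform : {uniform, interp @ \oo --> f}.
Proof.
apply: uniform_cvg_le => eps eps0; have [N hN] := geometric_small K2_ge0 eps0.
exists (N + e)%N => n hn x; apply: (le_trans (limit_close x _)); first lia.
by apply: hN; lia.
Qed.

Lemma limit_continuous : continuous f.
Proof.
apply: (@uniform_limit_continuous _ _ (interp @ \oo)); last exact: limit_uniform.
by exists 0%N => // n _; apply: interp_continuous.
Qed.

(** Nonnegativity permits integrals in the extended reals without prior integrability. *)
Lemma limit_ge0 x : 0 <= f x.
Proof.
rewrite -oppr_le0; apply: (geometric_le0 (e := e) K2_ge0) => n en.
have := limit_close x en; have := interp_ge0 n x.
rewrite ler_norml => i0 /andP[h1 _]; lra.
Qed.

Lemma limit_support x : f x != 0 -> - 1 <= x <= B%:R.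
Proof.
apply: contraR => hx; rewrite -normr_le0; apply: (geometric_le0 (e := e) K2_ge0) => n en.
have := limit_close x en; suff -> : interp n x = 0 by rewrite subr0.
by apply: contraNeq hx; apply: interp_support.
Qed.

Lemma limit_node n x : (e <= n)%N ->
  `|f x - node n (Num.floor (x * q n))| <= (2 * K + K1) / 2 ^+ n.
Proof.
move=> en; have h1 := limit_close x en; have h2 := interp_node x en.
have h5 : K1 / q n <= K1 / 2 ^+ n by rewrite ler_wpM2l ?K1_ge0 ?inv_q_le.
have -> : f x - node n (Num.floor (x * q n)) =
  (f x - interp n x) + (interp n x - node n (Num.floor (x * q n))) by ring.
rewrite mulrDl; apply: (le_trans (ler_normD _ _)); apply: lerD => //.
exact: le_trans h5.
Qed.

Lemma node_support n x : node n (Num.floor (x * q n)) != 0 -> - 1 <= x <= B%:R.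
Proof.
have qn := q_gt0 n; have /andP[] := floor_itv (x * q n).
case: (Num.floor _) => [j|j]; last by rewrite eqxx.
rewrite intrD rmorph1 => h1 h2; have [/node_vanish -> //|jN _] := leqP (B * p ^ n) j.
  by rewrite eqxx.
have h0 : 0 <= x * q n by apply: le_trans h1; apply: (ler0n R j).
have x0 : 0 <= x by rewrite pmulr_lge0 in h0.
have jN' : (j.+1)%:R <= B%:R * q n by rewrite /q -natrM ler_nat.
have : x * q n < B%:R * q n.
  apply: lt_le_trans jN'; rewrite -natr1; exact: h2.
rewrite ltr_pM2r// => xB; rewrite (ltW xB) andbT; lra.
Qed.

Let cell n (j : nat) : set R := `[j%:R / q n, j.+1%:R / q n[.
Let mu := @lebesgue_measure R.

Lemma cellP n j x : cell n j x <-> Num.floor (x * q n) = Posz j.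
Proof.
have qn := q_gt0 n.
rewrite /cell /= in_itv /= ler_pdivrMr// ltr_pdivlMr//; split=> [hx|ej].
  by apply: floor_def; rewrite -PoszD addn1.
by have := floor_itv (x * q n); rewrite ej -PoszD addn1.
Qed.

Lemma node_sum n x : node n (Num.floor (x * q n)) =
  \sum_(j < B * p ^ n) node n (Posz j) * \1_(cell n j) x.
Proof.
have ind (j : nat) : \1_(cell n j) x = (Num.floor (x * q n) == Posz j)%:R :> R.
  by rewrite indicE; congr ((nat_of_bool _)%:R); apply/idP/eqP => [/set_mem/cellP|/cellP/mem_set].
under eq_bigr do rewrite ind.
case: (Num.floor _) => [j|j]; last by rewrite big1// => i _; rewrite mulr0.
have [hj|hj] := leqP (B * p ^ n) j.
  rewrite node_vanish// big1// => i _; case: eqP => [[ij]|_]; rewrite ?mulr0//.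
  by move: hj; rewrite ij leqNgt ltn_ord.
rewrite (bigD1 (Ordinal hj))//= eqxx mulr1 big1 ?addr0// => i /eqP ij.
case: eqP => [[ij']|_]; rewrite ?mulr0//.
by case: ij; apply: val_inj.
Qed.

(** The total length divided by q^d. By [integral_node] it is also the integral of the step function
    that takes on each cell the value of the left node. *)
Definition riemann n : R := (\sum_(j < B * p ^ n) h n j)%:R / q n ^+ D.+2.

Lemma measurable_cell n j : measurable (cell n j).
Proof. exact: measurable_itv. Qed.

Lemma integral_node n :
  (\int[mu]_x (node n (Num.floor (x * q n)))%:E = (riemann n)%:E)%E.
Proof.
have qn := q_gt0 n.
have E1 : (fun x => (node n (Num.floor (x * q n)))%:E) =
    (fun x => \sum_(j < B * p ^ n) ((node n (Posz j))%:E * (\1_(cell n j) x)%:E))%E.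
  by apply/funext => x; rewrite node_sum -sumEFin; apply: eq_bigr => j _; rewrite EFinM.
rewrite E1 ge0_integral_sum//; last 2 first.
- move=> j; apply: emeasurable_funM => //; apply/measurable_EFinP.
  exact: measurable_indic (measurable_cell n j).
- by move=> j x _; rewrite mule_ge0// lee_fin ?node_ge0.
have E2 (j : 'I_(B * p ^ n)) : (\int[mu]_x ((node n (Posz j))%:E * (\1_(cell n j) x)%:E) =
    ((h n j)%:R / q n ^+ D.+2)%:E)%E.
  rewrite ge0_integralZl//; last 2 first.
  - by apply/measurable_EFinP; apply: measurable_indic (measurable_cell n j).
  - by rewrite lee_fin node_ge0.
  rewrite integral_indic//; last exact: measurable_cell.
  rewrite setIT /mu /cell /= lebesgue_measure_itv /= lte_fin ltr_pM2r ?invr_gt0// ltr_nat ltnSn.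
  rewrite -EFinB -EFinM; congr (_%:E); rewrite -mulrBl -natr1 addrAC subrr add0r mul1r.
  by rewrite [q n ^+ D.+2]exprS invfM mulrA mulrAC.
under eq_bigr do rewrite E2.
by rewrite sumEFin -mulr_suml -natr_sum.
Qed.

Let supp : set R := `[- 1, B%:R].

Lemma integral_supp (c : R) : 0 <= c ->
  (\int[mu]_x (c * \1_supp x)%:E = (c * (B%:R + 1))%:E)%E.
Proof.
move=> c0; under eq_integral do rewrite EFinM.
have ms : measurable supp by exact: measurable_itv.
rewrite ge0_integralZl//; last by apply/measurable_EFinP; apply: measurable_indic.
rewrite integral_indic// setIT /mu /supp /= lebesgue_measure_itv /= lte_fin.
rewrite (_ : - 1 < B%:R)//; last by apply: (lt_le_trans (y := 0)) => //; rewrite ltrN10.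
by rewrite -EFinB -EFinM opprK.
Qed.

(** On [-1, B] the function u exceeds v by at most c; elsewhere u is 0 and v is nonnegative. *)
Lemma integral_close (u v : R -> R) (c : R) : 0 <= c ->
  (forall x, 0 <= u x) -> (forall x, 0 <= v x) ->
  measurable_fun setT u -> measurable_fun setT v ->
  (forall x, u x != 0 -> - 1 <= x <= B%:R) -> (forall x, `|u x - v x| <= c) ->
  (\int[mu]_x (u x)%:E <= \int[mu]_x (v x)%:E + (c * (B%:R + 1))%:E)%E.
Proof.
move=> c0 u0 v0 mU mV us uv; have ms : measurable supp by exact: measurable_itv.
have mc : measurable_fun setT (fun x => (c * \1_supp x)%:E).
  by apply/measurable_EFinP; apply: measurable_funM => //; apply: measurable_indic.
rewrite -integral_supp// -ge0_integralD//; last 3 first.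
- by move=> x _; rewrite lee_fin.
- exact/measurable_EFinP.
- by move=> x _; rewrite lee_fin mulr_ge0.
apply: ge0_le_integral => //.
- by move=> x _; rewrite lee_fin.
- exact/measurable_EFinP.
- by apply: emeasurable_funD => //; apply/measurable_EFinP.
- move=> x _; rewrite -EFinD lee_fin indicE; case: (boolP (x \in supp)) => [_|].
    have := uv x; rewrite mulr1 ler_norml => /andP[_]; lra.
  rewrite mulr0 addr0 => xs; suff -> : u x = 0 by [].
  apply/eqP; move: xs; apply: contraNT => /us hx.
  by apply/mem_set; rewrite /supp /= in_itv.
Qed.

(** The limit and the step function of level n are uniformly close and both vanish outside [-1, B].
    Comparing their integrals in one direction shows that the integral of f is finite, and in both
    directions that it is the limit. *)
Lemma riemann_cvg : exists I : R, (\int[mu]_x (f x)%:E = I%:E)%E /\ riemann @ \oo --> I.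
Proof.
pose K3 : R := (2 * K + K1) * (B%:R + 1).
have K4 : 0 <= 2 * K + K1 by rewrite addr_ge0 ?K2_ge0 ?K1_ge0.
have K30 : 0 <= K3 by rewrite mulr_ge0// addr_ge0.
have mf : measurable_fun setT f by apply: continuous_measurable_fun; apply: limit_continuous.
have mn n : measurable_fun setT (fun x : R => node n (Num.floor (x * q n))).
  rewrite (_ : (fun _ => _) = fun x => \sum_(j < B * p ^ n) node n (Posz j) * \1_(cell n j) x).
    apply: measurable_sum => j; apply: measurable_funM => //.
    exact: measurable_indic (measurable_cell n j).
  by apply/funext => x; rewrite node_sum.
have cE n : (2 * K + K1) / 2 ^+ n * (B%:R + 1) = K3 / 2 ^+ n by rewrite mulrAC.
have c0 n : 0 <= (2 * K + K1) / 2 ^+ n by rewrite divr_ge0 ?exprn_ge0.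
have h1 n : (e <= n)%N -> (\int[mu]_x (f x)%:E <= (riemann n + K3 / 2 ^+ n)%:E)%E.
  move=> en; rewrite EFinD -integral_node -cE; apply: integral_close => //.
  - exact: limit_ge0.
  - by move=> x; apply: node_ge0.
  - exact: limit_support.
  - by move=> x; apply: limit_node.
have h2 n : (e <= n)%N -> ((riemann n)%:E <= \int[mu]_x (f x)%:E + (K3 / 2 ^+ n)%:E)%E.
  move=> en; rewrite -integral_node -cE; apply: integral_close => //.
  - by move=> x; apply: node_ge0.
  - exact: limit_ge0.
  - by move=> x; apply: node_support.
  - by move=> x; rewrite distrC; apply: limit_node.
have i0 : (0 <= \int[mu]_x (f x)%:E)%E by apply: integral_ge0 => x _; rewrite lee_fin limit_ge0.
have fin : (\int[mu]_x (f x)%:E)%E \is a fin_num.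
  rewrite ge0_fin_numE//; apply: (le_lt_trans (h1 e (leqnn e))); exact: ltry.
exists (fine (\int[mu]_x (f x)%:E)%E); split; first by rewrite fineK.
apply: (geometric_cvg K30 (e := e)) => n en.
have := h1 n en; have := h2 n en; rewrite -(fineK fin) -EFinD !lee_fin.
by move=> l1 l2; rewrite ler_norml; apply/andP; split; lra.
Qed.

End Limit.
End DensityFunction.

Theorem theorem1p1 (R : realType) (k : fieldType) (p : nat)
    (k_perfect : perfect_field k) (k_char : p \in [pchar k])
    (A : comAlgType k) (GA : nat -> set A) (d : nat)
    (A_noeth : noetherian A) (A_graded : standard_graded GA)
    (A_dim : krull_dim A R = d%:R%:E) (d_ge2 : (2 <= d)%N)
    (I : set A) (I_homog : homogeneous_ideal GA I)
    (I_colength : (quot_length (V := A^o) R setT I < +oo)%E)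
    (M : lmodType A) (GM : nat -> set M)
    (M_graded : graded_module GA GM) (M_fg : fin_gen [set: M]) :
  let g : nat -> R -> R := hk_g p d I GM in
  (forall n, [/\ compactly_supported (g n), piecewise_linear (g n)
               & continuous (g n)]) /\
  (exists f : R -> R, {uniform, g @ \oo --> f}) /\
  (forall f : R -> R, (forall x, g n x @[n --> \oo] --> f x) ->
     [/\ compactly_supported f, continuous f,
         cvgn (hk_seq R p d I M)
       & (e_HK R p d I M)%:E = (\int[lebesgue_measure]_x (f x)%:E)%E]).
Proof.
(* With d = D + 2, the normalizing exponent d - 1 is D + 1 and the error exponent d - 2 is D. *)
case: d A_dim d_ge2 => [|[|D]]// A_dim _ g.
have [h [e [C [B [hE qE h0 hF [hS hZ]]]]]] := hk_dimensions k_perfect k_char A_noeth A_graded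
  A_dim I_homog I_colength M_graded M_fg.
have p1 : (1 < p)%N := prime_gt1 (pcharf_prime k_char).
have gE : g = interp p D h.
  apply/funext => n; apply/funext => x; rewrite /g /hk_g /interp.
  (* All lengths are finite, so [fine] meets no infinite value; both sides are 0 in negative
     degrees. *)
  have nodeE m : hk_node R p D.+2 I GM n m = node R p D h n m.
    by case: m => m; rewrite /hk_node ?hE //= mul0r.
  by rewrite !nodeE.
rewrite gE; split=> [n|].
  split.
  - exact: supported_segment (fun x => interp_support p1 h0 (x := x)).
  - exact: (interp_piecewise_linear _ _ p1 h0).
  - exact: (interp_continuous h0).
split.
  have [f hf] := interp_limit R p1 h0 hF hS hZ.
  by exists f; apply: (limit_uniform p1 h0 hF hS hZ).
move=> f hf.
have [J [fJ cvgJ]] := riemann_cvg p1 h0 hF hS hZ hf.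
have seqE : hk_seq R p D.+2 I M = riemann R p D h B.
  by apply/funext => n; rewrite /hk_seq qE /riemann expnM natrX.
split.
- exact: supported_segment (limit_support p1 h0 hF hS hZ hf).
- exact: (limit_continuous p1 h0 hF hS hZ hf).
- by rewrite seqE; apply/cvg_ex; exists J.
- by rewrite fJ /e_HK seqE (cvg_lim _ cvgJ).
Qed.
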